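(* The $\mathcal{C}$-Coalition Formation problem can be solved in FPT time when parameterized by the vertex integrity of the input graph.
   Context: $\mathcal{C}$-Coalition Formation (unweighted): the input is an undirected graph $G=(V,E)$ and a capacity $\mathcal{C}\in\mathbb{N}$. A $\mathcal{C}$-partition of $V$ is a partition $\mathcal{P}=\{C_1,\dots,C_p\}$ with $|C_i|\le\mathcal{C}$; its value is $v(\mathcal{P})=\sum_i|E(G[C_i])|$; the task is to find a $\mathcal{C}$-partition of maximum value. $G$ has vertex integrity at most $k$ if there is a set $U\subseteq V$ with $|U|=k'\le k$ such that every connected component of $G[V\setminus U]$ has at most $k-k'$ vertices. FPT time means time $f(k)\cdot|I|^{\mathcal{O}(1)}$ for a computable function $f$, where $k$ is the parameter and $|I|$ the input size. *)

(* Defs.v *)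
From mathcomp Require Import all_boot.

Set Implicit Arguments.
Unset Strict Implicit.
Unset Printing Implicit Defensive.

(* Random access machine with a read-only input tape and a write-only output
   tape (Aho-Hopcroft-Ullman), over natural numbers, with addition and
   truncated subtraction as its only arithmetic.  There is no multiplication,
   so a register gains at most one bit per step, and the uniform cost measure
   (one unit per instruction) is polynomially related to Turing machine time. *)

Inductive instr :=
| Const (r v : nat)       (* R[r] := v *)
| Add (r a b : nat)       (* R[r] := R[a] + R[b] *)
| Sub (r a b : nat)       (* R[r] := R[a] - R[b], truncated at 0 *)
| LoadInd (r a : nat)     (* R[r] := R[R[a]] *)
| StoreInd (a b : nat)    (* R[R[a]] := R[b] *)
| Jump (l : nat)
| JumpZero (r l : nat)    (* jump to l if R[r] = 0 *)
| Read (r : nat)          (* R[r] := next input number, 0 past the end *)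
| Write (r : nat).        (* append R[r] to the output *)

Definition program := seq instr.

Record config := Config {
  pc : nat;
  reg : nat -> nat;
  inp : seq nat;
  out : seq nat
}.

Definition exec (i : instr) (s : config) : config :=
  let: Config l R w o := s in
  match i with
  | Const r v => Config l.+1 [eta R with r |-> v] w o
  | Add r a b => Config l.+1 [eta R with r |-> R a + R b] w o
  | Sub r a b => Config l.+1 [eta R with r |-> R a - R b] w o
  | LoadInd r a => Config l.+1 [eta R with r |-> R (R a)] w o
  | StoreInd a b => Config l.+1 [eta R with R a |-> R b] w o
  | Jump l' => Config l' R w o
  | JumpZero r l' => Config (if R r == 0 then l' else l.+1) R w o
  | Read r => Config l.+1 [eta R with r |-> head 0 w] (behead w) o
  | Write r => Config l.+1 R w (rcons o (R r))
  end.

(* The machine halts when the program counter leaves the program. *)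
Definition halted (p : program) (s : config) : bool := size p <= pc s.

Definition step (p : program) (s : config) : config :=
  if onth p (pc s) is Some i then exec i s else s.

Definition init (w : seq nat) : config := Config 0 (fun=> 0) w [::].

Definition outputs_within (p : program) (w : seq nat) (t : nat) (o : seq nat)
    : Prop :=
  exists2 t', t' <= t &
    let s := iter t' (step p) (init w) in halted p s /\ out s = o.

Definition computable (f : nat -> nat) : Prop :=
  exists p : program, forall k, exists t, outputs_within p [:: k] t [:: f k].

(* Total binary length of an input; 0 is one bit long. *)
Definition bit_size (w : seq nat) : nat := \sum_(x <- w) (trunc_log 2 x).+1.

(* A search problem is given by the encoding enc of its instances and the
   relation sol between instances and correct outputs; par is the parameter,
   which is not part of the input. *)
Definition fpt_solvable (X : Type) (enc : X -> seq nat)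
    (sol : X -> seq nat -> Prop) (par : X -> nat) : Prop :=
  exists (p : program) (f : nat -> nat) (c : nat), computable f /\
    forall x : X, exists2 o : seq nat,
      outputs_within p (enc x) (f (par x) * bit_size (enc x) ^ c) o & sol x o.

Section Graph.

Variables (T : finType) (e : rel T).

Definition edges_in (A : {set T}) : {set {set T}} :=
  [set [set x; y] | x in A, y in A & e x y].

Definition capacity_partition (C : nat) (P : {set {set T}}) : bool :=
  partition P [set: T] && [forall A in P, #|A| <= C].

Definition value (P : {set {set T}}) : nat := \sum_(A in P) #|edges_in A|.

Definition optimal_partition (C : nat) (P : {set {set T}}) : Prop :=
  capacity_partition C P /\
  forall Q, capacity_partition C Q -> value Q <= value P.

(* Connected components of the subgraph induced by A. *)
Definition components (A : {set T}) : {set {set T}} :=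
  equivalence_partition (connect [rel x y in A | e x y]) A.

Definition integrity_at_most (k : nat) : bool :=
  [exists U : {set T}, (#|U| <= k) &&
     [forall D in components (~: U), #|D| <= k - #|U|]].

Lemma integrity_bounded : exists k, integrity_at_most k.
Proof.
exists #|T|; apply/existsP; exists [set: T]; rewrite max_card /=.
apply/forall_inP => D /imsetP[x]; by rewrite setCT inE.
Qed.

Definition vertex_integrity : nat := ex_minn integrity_bounded.

End Graph.

Record instance := Instance {
  nb_vertices : nat;
  adj : rel 'I_nb_vertices;
  adj_sym : symmetric adj;
  adj_irr : irreflexive adj;
  capacity : nat
}.

(* Number of vertices, capacity, then the adjacency matrix row by row. *)
Definition encode (I : instance) : seq nat :=
  nb_vertices I :: capacity I ::
    [seq (adj x y : nat) | x <- enum 'I_(nb_vertices I), y <- enum 'I_(nb_vertices I)].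

(* A partition is output as a list of labels, one per vertex; its blocks are
   the classes of vertices with the same label. *)
Definition label_partition (n : nat) (o : seq nat) : {set {set 'I_n}} :=
  preim_partition (fun i : 'I_n => nth 0 o i) [set: 'I_n].

(* If no partition respects the capacity (capacity 0 and at least one vertex),
   this is reported by the empty output. *)
Definition coalition_solution (I : instance) (o : seq nat) : Prop :=
  (size o = nb_vertices I /\
     optimal_partition (@adj I) (capacity I) (label_partition (nb_vertices I) o)) \/
  ((forall P : {set {set 'I_(nb_vertices I)}}, ~~ capacity_partition (capacity I) P)
     /\ o = [::]).

Definition integrity_parameter (I : instance) : nat :=
  vertex_integrity (@adj I).

(* Main.v *)
(** Fix [k] and suppose that removing a set [U] of at most [k] vertices leaves
    components with at most [k] vertices.  A partition is described by giving to every
    vertex either one of [k] shared labels, or a label private to its component, so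
    that the capacity constraint couples components only through [k] counters.  Given
    the labels of [U], the optimum is found by local search.  If a labelling is not
    optimal, each component contributes to a better one a bounded integer vector of
    counter changes; splitting this family of vectors into pieces of bounded size whose
    partial sums have constant sign in every coordinate (in the style of Graver bases),
    one piece already improves the value, so some improvement changes boundedly many
    components.  Components with the same internal structure, attachment to [U] and
    current labels can be exchanged, hence only boundedly many components of each type
    need to be considered and one of [f(k)] many guesses succeeds.  The value is at most
    [n^2], so [(n + 1)^2] rounds suffice.  [U] is found by branching on a connected set
    of [k + 1] vertices, and [k] by trying [0, 1, 2, ...].  Every guess is the base-[B]
    expansion of a counter below a tower of exponentials in [k]. *)

From mathcomp Require Import all_boot all_order ssralg ssrnum ssrint zify.
Require Import Defs.

Set Implicit Arguments.
Unset Strict Implicit.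
Unset Printing Implicit Defensive.

(** * A structured language and its compilation *)

(** At most [k] blocks meet [U], and a block avoiding [U] can be cut along components without losing
    an edge; this is why [k] shared labels suffice. Once the labels on [U] are fixed, the value and
    the shared counters change by sums of contributions of single components, and splitting into
    pieces needs exactly this additivity. Constant signs keep a piece feasible: each counter is
    either not increased or increased by no more than the complete change, so it stays below the
    larger of two feasible values. The algorithm must be a single machine program with a provable
    time bound. Hence the search consists of brute-force loops whose bounds are scalars that are
    never written, and its time is bounded by induction on the syntax. A single constant [B] is the
    base of the guesses and bounds component types, ranks and the number of changed components. A
    wrong guess does no harm: a wrong [U] fails the test on components, and a wrong relabelling does
    not raise the score. The search asks for [|U| <= k] and components of size at most [k], which
    integrity at most [k] implies, so the loop over [k] stops at the vertex integrity at the
    latest. *)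

Definition upd (T : Type) (f : nat -> T) (x : nat) (v : T) : nat -> T :=
  fun y => if y == x then v else f y.

(* [Loc x] is a loop variable, [Arr j e] the entry [e] of array [j].  [Fold x a lim e0 e]
   iterates [e] with counter [x] and accumulator [a], starting from [e0]. *)
Inductive expr :=
| Num (c : nat)
| Loc (x : nat)
| Arr (j : nat) (e : expr)
| EAdd (e1 e2 : expr)
| ESub (e1 e2 : expr)
| EIf (e1 e2 e3 : expr)
| Fold (x a : nat) (lim e0 e : expr)
| Sum (x : nat) (lim e : expr).

Fixpoint eval (rho : nat -> nat) (m : nat -> nat -> nat) (e : expr) : nat :=
  match e with
  | Num c => c
  | Loc x => rho x
  | Arr j e => m j (eval rho m e)
  | EAdd e1 e2 => eval rho m e1 + eval rho m e2
  | ESub e1 e2 => eval rho m e1 - eval rho m e2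
  | EIf e1 e2 e3 => if eval rho m e1 == 0 then eval rho m e3 else eval rho m e2
  | Fold x a lim e0 e =>
      iteri (eval rho m lim) (fun i r => eval (upd (upd rho x i) a r) m e) (eval rho m e0)
  | Sum x lim e => \sum_(i < eval rho m lim) eval (upd rho x i) m e
  end.

(* [ecost] and [ccost] count exactly the machine steps of the code compiled below. *)
Fixpoint ecost (rho : nat -> nat) (m : nat -> nat -> nat) (e : expr) : nat :=
  match e with
  | Num c => 1
  | Loc x => 2
  | Arr j e => ecost rho m e + 9
  | EAdd e1 e2 => ecost rho m e1 + ecost rho m e2 + 1
  | ESub e1 e2 => ecost rho m e1 + ecost rho m e2 + 1
  | EIf e1 e2 e3 =>
      ecost rho m e1 + 1 + (if eval rho m e1 == 0 then ecost rho m e3 else ecost rho m e2 + 1)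
  | Fold x a lim e0 e =>
      ecost rho m lim + 1 + ecost rho m e0 +
      (\sum_(i < eval rho m lim)
        (ecost (upd (upd rho x i) a
           (iteri i (fun i r => eval (upd (upd rho x i) a r) m e) (eval rho m e0))) m e + 2 + 5) + 1) + 2
  | Sum x lim e =>
      ecost rho m lim + 1 + 1 + (\sum_(i < eval rho m lim) (ecost (upd rho x i) m e + 1 + 5) + 1) + 2
  end.

Inductive cmd :=
| Skip
| Set_ (j : nat) (e1 e2 : expr)
| Seq (c1 c2 : cmd)
| If (e : expr) (c1 c2 : cmd)
| For (x : nat) (lim : expr) (c : cmd)
| ReadC (j : nat) (e : expr)
| WriteC (e : expr).

Record state := State { cells : nat -> nat -> nat; win : seq nat; wout : seq nat }.

Definition set_mem (st : state) (j i v : nat) : state :=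
  State (upd (cells st) j (upd (cells st j) i v)) (win st) (wout st).

Fixpoint run (rho : nat -> nat) (c : cmd) (st : state) : state :=
  match c with
  | Skip => st
  | Set_ j e1 e2 => set_mem st j (eval rho (cells st) e1) (eval rho (cells st) e2)
  | Seq c1 c2 => run rho c2 (run rho c1 st)
  | If e c1 c2 => if eval rho (cells st) e == 0 then run rho c2 st else run rho c1 st
  | For x lim c => iteri (eval rho (cells st) lim) (fun i st => run (upd rho x i) c st) st
  | ReadC j e =>
      let st' := set_mem st j (eval rho (cells st) e) (head 0 (win st)) in
      State (cells st') (behead (win st)) (wout st)
  | WriteC e => State (cells st) (win st) (rcons (wout st) (eval rho (cells st) e))
  end.

Fixpoint ccost (rho : nat -> nat) (c : cmd) (st : state) : nat :=
  match c with
  | Skip => 0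
  | Set_ j e1 e2 => ecost rho (cells st) e1 + 8 + ecost rho (cells st) e2 + 1
  | Seq c1 c2 => ccost rho c1 st + ccost rho c2 (run rho c1 st)
  | If e c1 c2 => ecost rho (cells st) e + 1 +
      (if eval rho (cells st) e == 0 then ccost rho c2 st else ccost rho c1 st + 1)
  | For x lim c => ecost rho (cells st) lim + 1 +
      (\sum_(i < eval rho (cells st) lim)
         (ccost (upd rho x i) c (iteri i (fun i st => run (upd rho x i) c st) st) + 5) + 1)
  | ReadC j e => ecost rho (cells st) e + 8 + 2
  | WriteC e => ecost rho (cells st) e + 1
  end.

(* Registers below [base] hold loop variables and temporaries; entry [i] of
   array [j < 64] lives at address [base + j + 64 * i], so that arrays are
   unbounded and an address is computed with six doublings. *)
Definition base := 128.
Definition addr (j i : nat) := base + j + 64 * i.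

(** [locked] keeps simplification from unfolding the code, so that proofs decompose only the program
    around it. *)
Definition addr_code (d j : nat) : seq instr :=
  locked [:: Add d d d; Add d d d; Add d d d; Add d d d; Add d d d; Add d d d;
             Const d.+1 (base + j); Add d d d.+1].

Definition loop_code (d s off : nat) (body : seq instr) : seq instr :=
  locked (JumpZero d (off + size body + 5) :: body ++
          [:: Const s 1; Sub d d s; Add d.+1 d.+1 s; Jump off]).

Lemma size_addr_code d j : size (addr_code d j) = 8.
Proof. by rewrite /addr_code -lock. Qed.

Lemma size_loop_code d s off body : size (loop_code d s off body) = size body + 5.
Proof. by rewrite /loop_code -lock /= size_cat /= !addnS. Qed.

(* Code placed at address [off] that leaves the value of [e] in register [d] and uses only
   registers from [d] on; [mp] maps loop variables to registers. *)
Fixpoint cexp (mp : nat -> nat) (d off : nat) (e : expr) : seq instr :=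
  match e with
  | Num c => [:: Const d c]
  | Loc x => [:: Const d 0; Add d d (mp x)]
  | Arr j e => cexp mp d off e ++ (addr_code d j ++ [:: LoadInd d d])
  | EAdd e1 e2 =>
      let c1 := cexp mp d off e1 in
      c1 ++ (cexp mp d.+1 (off + size c1) e2 ++ [:: Add d d d.+1])
  | ESub e1 e2 =>
      let c1 := cexp mp d off e1 in
      c1 ++ (cexp mp d.+1 (off + size c1) e2 ++ [:: Sub d d d.+1])
  | EIf e1 e2 e3 =>
      let c1 := cexp mp d off e1 in
      let c2 := cexp mp d (off + size c1 + 1) e2 in
      let l3 := off + size c1 + 1 + size c2 + 1 in
      let c3 := cexp mp d l3 e3 in
      c1 ++ (JumpZero d l3 :: c2 ++ (Jump (l3 + size c3) :: c3))
  | Fold x a lim e0 e =>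
      let c1 := cexp mp d off lim in
      let o2 := off + size c1 + 1 in
      let c2 := cexp mp d.+2 o2 e0 in
      let o3 := o2 + size c2 in
      let body := cexp (upd (upd mp x d.+1) a d.+2) d.+3 o3.+1 e ++
                  [:: Const d.+2 0; Add d.+2 d.+2 d.+3] in
      c1 ++ (Const d.+1 0 :: c2 ++ (loop_code d d.+3 o3 body ++ [:: Const d 0; Add d d d.+2]))
  | Sum x lim e =>
      let c1 := cexp mp d off lim in
      let o3 := off + size c1 + 2 in
      let body := cexp (upd mp x d.+1) d.+3 o3.+1 e ++ [:: Add d.+2 d.+2 d.+3] in
      c1 ++ (Const d.+1 0 :: Const d.+2 0 ::
              (loop_code d d.+3 o3 body ++ [:: Const d 0; Add d d d.+2]))
  end.

Fixpoint ccmd (mp : nat -> nat) (d off : nat) (c : cmd) : seq instr :=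
  match c with
  | Skip => [::]
  | Set_ j e1 e2 =>
      let c1 := cexp mp d off e1 ++ addr_code d j in
      c1 ++ (cexp mp d.+1 (off + size c1) e2 ++ [:: StoreInd d d.+1])
  | Seq c1 c2 =>
      let p1 := ccmd mp d off c1 in p1 ++ ccmd mp d (off + size p1) c2
  | If e c1 c2 =>
      let p := cexp mp d off e in
      let p1 := ccmd mp d (off + size p + 1) c1 in
      let l2 := off + size p + 1 + size p1 + 1 in
      let p2 := ccmd mp d l2 c2 in
      p ++ (JumpZero d l2 :: p1 ++ (Jump (l2 + size p2) :: p2))
  | For x lim c =>
      let p := cexp mp d off lim in
      let o2 := off + size p + 1 in
      p ++ (Const d.+1 0 :: loop_code d d.+2 o2 (ccmd (upd mp x d.+1) d.+2 o2.+1 c))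
  | ReadC j e => cexp mp d off e ++ (addr_code d j ++ [:: Read d.+1; StoreInd d d.+1])
  | WriteC e => cexp mp d off e ++ [:: Write d]
  end.

(** Number of registers, counted from [d], that the compiled code may touch. Keeping [d + edep e]
    within [base] separates temporaries from arrays. *)
Fixpoint edep (e : expr) : nat :=
  match e with
  | Num _ | Loc _ => 1
  | Arr _ e => maxn (edep e) 2
  | EAdd e1 e2 | ESub e1 e2 => maxn (edep e1) (edep e2).+1
  | EIf e1 e2 e3 => maxn (edep e1) (maxn (edep e2) (edep e3))
  | Fold _ _ lim e0 e => maxn (maxn (edep lim) (edep e0).+2) (maxn (edep e).+3 4)
  | Sum _ lim e => maxn (edep lim) (maxn (edep e).+3 4)
  end.

Fixpoint cdep (c : cmd) : nat :=
  match c with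
  | Skip => 0
  | Set_ _ e1 e2 => maxn (edep e1) (maxn (edep e2).+1 2)
  | Seq c1 c2 => maxn (cdep c1) (cdep c2)
  | If e c1 c2 => maxn (edep e) (maxn (cdep c1) (cdep c2))
  | For _ lim c => maxn (edep lim) (maxn (cdep c).+2 3)
  | ReadC _ e => maxn (edep e) 2
  | WriteC e => edep e
  end.

Fixpoint ewf (e : expr) : bool :=
  match e with
  | Num _ | Loc _ => true
  | Arr j e => (j < 64) && ewf e
  | EAdd e1 e2 | ESub e1 e2 | Sum _ e1 e2 => ewf e1 && ewf e2
  | EIf e1 e2 e3 | Fold _ _ e1 e2 e3 => [&& ewf e1, ewf e2 & ewf e3]
  end.

Fixpoint cwf (c : cmd) : bool :=
  match c with
  | Skip => true
  | Set_ j e1 e2 => [&& j < 64, ewf e1 & ewf e2]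
  | Seq c1 c2 => cwf c1 && cwf c2
  | If e c1 c2 => [&& ewf e, cwf c1 & cwf c2]
  | For _ lim c => ewf lim && cwf c
  | ReadC j e => (j < 64) && ewf e
  | WriteC e => ewf e
  end.

(** * Correctness of the compiled code *)

Definition code_at (p : program) (off : nat) (c : seq instr) : Prop :=
  forall i, i < size c -> onth p (off + i) = onth c i.

Lemma code_at_cat p off c1 c2 :
  code_at p off (c1 ++ c2) -> code_at p off c1 /\ code_at p (off + size c1) c2.
Proof.
move=> h; split=> i hi; first by rewrite h ?size_cat ?ltn_addr // onth_cat hi.
by rewrite -addnA h ?size_cat ?ltn_add2l // onth_cat ltnNge leq_addr /= addKn.
Qed.

Lemma code_at_cons p off i c :
  code_at p off (i :: c) -> onth p off = Some i /\ code_at p off.+1 c.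
Proof.
move=> h; split; first by have := h 0 isT; rewrite addn0.
by move=> j hj; have := h j.+1 hj; rewrite addnS -addSn.
Qed.

Definition reach (p : program) (t : nat) (s s' : config) : Prop :=
  iter t (step p) s = s'.

Lemma reach0 p s : reach p 0 s s. Proof. by []. Qed.

Lemma reach_trans p t1 t2 s1 s2 s3 :
  reach p t1 s1 s2 -> reach p t2 s2 s3 -> reach p (t1 + t2) s1 s3.
Proof. by rewrite /reach addnC iterD => -> ->. Qed.

Lemma reach1 p off R w o i :
  onth p off = Some i -> reach p 1 (Config off R w o) (exec i (Config off R w o)).
Proof. by rewrite /reach /= /step /= => ->. Qed.

Lemma reachS p off R w o i t s' :
  onth p off = Some i -> reach p t (exec i (Config off R w o)) s' ->
  reach p t.+1 (Config off R w o) s'.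
Proof. by move=> h h'; rewrite -add1n; apply: reach_trans (reach1 _ _ _ h) h'. Qed.

(** Expressions write only to temporaries from [d] up to [base]; both the loop variables below and
    the arrays above survive. *)
Definition agree (d : nat) (R R' : nat -> nat) : Prop :=
  forall r, (r < d) || (base <= r) -> R' r = R r.

Definition rep (m : nat -> nat -> nat) (R : nat -> nat) : Prop :=
  forall j i, j < 64 -> R (addr j i) = m j i.

Definition locs (mp : nat -> nat) (d : nat) (rho R : nat -> nat) : Prop :=
  forall x, mp x < d /\ R (mp x) = rho x.

Ltac exec_next hc :=
  let h := fresh in case/code_at_cons: hc => h hc; apply: (reachS h); clear h => /=.

Lemma agree_trans d R1 R2 R3 : agree d R1 R2 -> agree d R2 R3 -> agree d R1 R3.
Proof. by move=> h1 h2 r hr; rewrite h2 // h1. Qed.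

Lemma agree_rep d m R R' : agree d R R' -> rep m R -> rep m R'.
Proof. by move=> h hm j i hj; rewrite h ?hm // /addr; lia. Qed.

Lemma agree_locs d mp rho R R' : agree d R R' -> locs mp d rho R -> locs mp d rho R'.
Proof. by move=> h hm x; have [h1 h2] := hm x; rewrite h ?h1. Qed.

Lemma locs_le d d' mp rho R : d <= d' -> locs mp d rho R -> locs mp d' rho R.
Proof. by move=> h hm x; have [h1 h2] := hm x; split=> //; lia. Qed.

Lemma locs_upd mp d rho R x r v :
  locs mp d rho R -> r < d -> R r = v -> locs (upd mp x r) d (upd rho x v) R.
Proof. by move=> h hr hv y; rewrite /upd; case: eqP => // _; split. Qed.

Lemma addr_code_ok p off d j R w o :
  d.+1 < base -> code_at p off (addr_code d j) ->
  exists R', [/\ reach p 8 (Config off R w o) (Config (off + 8) R' w o),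
    agree d R R' & R' d = addr j (R d)].
Proof.
rewrite /addr_code -lock => hd hc; eexists; split.
- do 8 exec_next hc.
  rewrite [off + 8]addnC; exact: reach0.
- by move=> r hr /=; have [-> ->]: (r == d = false) /\ (r == d.+1 = false) by lia.
- rewrite /= !eqxx; have -> : d == d.+1 = false by lia.
  by rewrite /addr; lia.
Qed.

(* Register [d] counts the remaining iterations, [d.+1] the completed ones, and [s] is
   scratch. *)
Lemma loop_ok p d s off body (t : nat -> nat) N
    (Inv : nat -> (nat -> nat) -> seq nat -> seq nat -> Prop) R w o :
  d.+1 < s ->
  code_at p off (loop_code d s off body) ->
  (forall i R R' w o, Inv i R w o ->
     (forall r, r != d -> r != d.+1 -> r != s -> R' r = R r) -> Inv i R' w o) ->
  (forall i R w o, i < N -> Inv i R w o -> R d = N - i -> R d.+1 = i ->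
     exists R' w' o', [/\ reach p (t i) (Config off.+1 R w o)
        (Config (off.+1 + size body) R' w' o'), Inv i.+1 R' w' o',
        R' d = R d & R' d.+1 = R d.+1]) ->
  Inv 0 R w o -> R d = N -> R d.+1 = 0 ->
  exists R' w' o', [/\ reach p (\sum_(i < N) (t i + 5) + 1) (Config off R w o)
      (Config (off + size body + 5) R' w' o') & Inv N R' w' o'].
Proof.
rewrite /loop_code -lock => hs hc hstab hbody.
(* Induction on the number [q] of iterations left, because register [d] counts down to the exit
   test. *)
suff H q : q <= N -> forall R w o, Inv (N - q) R w o -> R d = q -> R d.+1 = N - q ->
  exists R' w' o', [/\ reach p (\sum_(N - q <= i < N) (t i + 5) + 1) (Config off R w o)
      (Config (off + size body + 5) R' w' o') & Inv N R' w' o'].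
  move=> h0 hd hd1; have := H N (leqnn N) R w o; rewrite subnn big_mkord; exact.
move/code_at_cons: hc => [hj /code_at_cat[hcb]] hce.
elim: q => [|q IH] hq {}R {}w {}o hI hd hd1.
  exists R, w, o; rewrite subn0 big_geq //; split; last by rewrite subn0 in hI.
  by apply: (reachS hj); rewrite /= hd eqxx; exact: reach0.
have hlt : N - q.+1 < N by lia.
have [R1 [w1 [o1 [hr1 hI1 hd' hd1']]]] : exists R' w' o', [/\ reach p (t (N - q.+1)) (Config off.+1 R w o)
        (Config (off.+1 + size body) R' w' o'), Inv (N - q.+1).+1 R' w' o',
        R' d = R d & R' d.+1 = R d.+1] by apply: hbody => //; lia.
have e1 : (N - q.+1).+1 = N - q by lia.
rewrite e1 in hI1.
rewrite big_ltn // e1.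
set R2 := [eta [eta [eta R1 with s |-> 1] with d |-> R1 d - 1] with d.+1 |-> R1 d.+1 + 1].
have hne1 : d == s = false by lia.
have hne2 : d.+1 == s = false by lia.
have hne3 : d == d.+1 = false by lia.
have hne4 : d.+1 == d = false by lia.
have [R3 [w3 [o3 [hr3 hI3]]]] : exists R' w' o', [/\ reach p (\sum_(N - q <= i < N) (t i + 5) + 1) (Config off R2 w1 o1)
      (Config (off + size body + 5) R' w' o') & Inv N R' w' o'].
  apply: IH; first lia.
  - apply: hstab hI1 _ => r /negbTE h1 /negbTE h2 /negbTE h3.
    by rewrite /R2 /= h1 h2 h3.
  - by rewrite /R2 /= eqxx hne3 hd' hd; lia.
  - by rewrite /R2 /= eqxx hd1' hd1; lia.
exists R3, w3, o3; split=> //.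
have -> : t (N - q.+1) + 5 + \sum_(N - q <= i < N) (t i + 5) + 1 =
  1 + (t (N - q.+1) + (4 + (\sum_(N - q <= i < N) (t i + 5) + 1))) by lia.
apply: (reach_trans (reach1 _ _ _ hj)); rewrite /= hd /=.
apply: (reach_trans hr1).
move/code_at_cons: hce => [i1 /code_at_cons [i2 /code_at_cons [i3 /code_at_cons[i4 _]]]].
apply: (reach_trans _ hr3).
apply: (reachS i1) => /=; apply: (reachS i2) => /=; apply: (reachS i3) => /=.
apply: (reachS i4) => /=; rewrite eqxx hne1 hne2 hne4 (eq_sym s d) hne1.
exact: reach0.
Qed.

Lemma iteri_sum n (F : nat -> nat) : iteri n (fun i r => r + F i) 0 = \sum_(i < n) F i.
Proof. by elim: n => [|n IH]; rewrite ?big_ord0 // big_ord_recr /= IH. Qed.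

(** Temporaries form a stack: code compiled for [d.+1] preserves everything below [d.+1], so the
    first operand survives in register [d]. For the two loops the invariant says that register
    [d.+2] holds the value iterated so far. *)
Lemma cexp_ok e : forall mp d off p rho m R w o,
  d + edep e <= base -> ewf e -> code_at p off (cexp mp d off e) ->
  locs mp d rho R -> rep m R ->
  exists R', [/\ reach p (ecost rho m e) (Config off R w o)
                   (Config (off + size (cexp mp d off e)) R' w o),
    agree d R R' & R' d = eval rho m e].
Proof.
have ne d : (d == d.+1 = false) * (d.+1 == d = false) * (d == d.+2 = false) *
   (d.+2 == d = false) * (d.+1 == d.+2 = false) * (d.+2 == d.+1 = false) *
   (d == d.+3 = false) * (d.+3 == d = false) * (d.+1 == d.+3 = false) *
   (d.+3 == d.+1 = false) * (d.+2 == d.+3 = false) * (d.+3 == d.+2 = false)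
  by repeat split; lia.
elim: e => [c|x|j e IH|e1 IH1 e2 IH2|e1 IH1 e2 IH2|e1 IH1 e2 IH2 e3 IH3|
        x a lim IHl e0 IH0 e IH|x lim IHl e IH] mp d off p rho m R w o /=.
- move=> hd _ /code_at_cons[h1 _] hl hm; exists [eta R with d |-> c].
  split; first by rewrite addn1; exact: reach1 h1.
    by move=> r hr /=; have -> : r == d = false by lia.
  by rewrite /= eqxx.
- move=> hd _ /code_at_cons[h1 /code_at_cons[h2 _]] hl hm; eexists; split.
  + by apply: (reachS h1); apply: (reachS h2) => /=; rewrite addn2; exact: reach0.
  + by move=> r hr /=; have -> : r == d = false by lia.
  + by have [h3 h4] := hl x; rewrite /= !eqxx; have -> : mp x == d = false by lia.
- move=> hd /andP[hj hw] /code_at_cat[h1 /code_at_cat[h2 /code_at_cons[h3 _]]] hl hm.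
  have [|R1 [r1 a1 v1]] := IH mp d off p rho m R w o _ hw h1 hl hm; first lia.
  rewrite size_addr_code in h3.
  have [|R2 [r2 a2 v2]] := addr_code_ok R1 w o _ h2; first lia.
  exists [eta R2 with d |-> R2 (R2 d)]; split.
  + rewrite -[9]/(8 + 1) !size_cat size_addr_code; apply: reach_trans r1 _.
    apply: (reach_trans r2); apply: (reachS h3) => /=.
    by rewrite !addnA addn1; exact: reach0.
  + move=> r hr /=; have -> : r == d = false by lia.
    by rewrite a2 // a1.
  + rewrite /= eqxx v2 (agree_rep (agree_trans a1 a2) hm) // v1 //.
- move=> hd /andP[w1 w2] /code_at_cat[h1 /code_at_cat[h2 /code_at_cons[h3 _]]] hl hm.
  have [|R1 [r1 a1 v1]] := IH1 mp d off p rho m R w o _ w1 h1 hl hm; first lia.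
  have [| |R2 [r2 a2 v2]] := IH2 mp d.+1 _ p rho m R1 w o _ w2 h2 _ (agree_rep a1 hm); first lia.
    by apply: locs_le (agree_locs a1 hl).
  exists [eta R2 with d |-> R2 d + R2 d.+1]; split.
  + rewrite !size_cat /= !addnA.
    apply: reach_trans (reach_trans r1 r2) _.
    by apply: (reachS h3) => /=; rewrite addn1; exact: reach0.
  + move=> r hr /=; have -> : r == d = false by lia.
    by rewrite a2 ?a1 //; lia.
  + by rewrite /= eqxx v2 a2 ?v1 // ltnSn.
- move=> hd /andP[w1 w2] /code_at_cat[h1 /code_at_cat[h2 /code_at_cons[h3 _]]] hl hm.
  have [|R1 [r1 a1 v1]] := IH1 mp d off p rho m R w o _ w1 h1 hl hm; first lia.
  have [| |R2 [r2 a2 v2]] := IH2 mp d.+1 _ p rho m R1 w o _ w2 h2 _ (agree_rep a1 hm); first lia.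
    by apply: locs_le (agree_locs a1 hl).
  exists [eta R2 with d |-> R2 d - R2 d.+1]; split.
  + rewrite !size_cat /= !addnA.
    apply: reach_trans (reach_trans r1 r2) _.
    by apply: (reachS h3) => /=; rewrite addn1; exact: reach0.
  + move=> r hr /=; have -> : r == d = false by lia.
    by rewrite a2 ?a1 //; lia.
  + by rewrite /= eqxx v2 a2 ?v1 // ltnSn.
- move=> hd /and3P[w1 w2 w3] /code_at_cat[h1 /code_at_cons[hj /code_at_cat[h2]]].
  move=> /code_at_cons[hj2 h3] hl hm.
  have [|R1 [r1 a1 v1]] := IH1 mp d off p rho m R w o _ w1 h1 hl hm; first lia.
  set s1 := size _ in h1 h2 h3 hj hj2 r1 *.
  move: h2 h3 hj2; rewrite -[(off + s1).+1]addn1 => h2; set s2 := size _ in h2 *.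
  rewrite -[(_ + s2).+1]addn1; set l3 := off + s1 + 1 + s2 + 1 => h3 hj2.
  rewrite size_cat /= size_cat /= -/s1 -/s2 -/l3; set s3 := size _ in h3 hj2 *.
  have -> : off + (s1 + (s2 + s3.+1).+1) = l3 + s3 by rewrite /l3; lia.
  case: eqP => hv.
  + have [|R2 [r2 a2 v2]] := IH3 mp d l3 p rho m R1 w o _ w3 h3 (agree_locs a1 hl) (agree_rep a1 hm); first lia.
    exists R2; split=> //; last exact: agree_trans a1 a2.
    rewrite -addnA; apply: reach_trans r1 _; apply: (reachS hj) => /=.
    by rewrite v1 hv eqxx.
  + have [|R2 [r2 a2 v2]] := IH2 mp d _ p rho m R1 w o _ w2 h2 (agree_locs a1 hl) (agree_rep a1 hm); first lia.
    exists R2; split=> //; last exact: agree_trans a1 a2.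
    rewrite -addnA; apply: reach_trans r1 _; apply: (reachS hj) => /=.
    rewrite v1; case: eqP hv => // _ _; rewrite -[(off + s1).+1]addn1.
    by apply: reach_trans r2 _; apply: (reachS hj2); exact: reach0.
- move=> hd /and3P[w1 w2 w3] /code_at_cat[h1 /code_at_cons[hj /code_at_cat[h2]]].
  move=> /code_at_cat[hlp /code_at_cons[i1 /code_at_cons[i2 _]]] hl hm.
  have [|R1 [r1 a1 v1]] := IHl mp d off p rho m R w o _ w1 h1 hl hm; first lia.
  set s1 := size _ in h1 h2 hlp hj i1 i2 r1 *.
  move: h2 hlp i1 i2; rewrite -[(off + s1).+1]addn1 => h2 hlp i1 i2.
  set s2 := size _ in hlp i1 i2 *.
  set body := (_ ++ [:: Const _ _; _]) in hlp i1 i2 *.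
  set g := (fun i r => eval (upd (upd rho x i) a r) m e); set N := eval rho m lim; set A := eval rho m e0.
  have [| | |R2 [r2 a2 v2]] := IH0 mp d.+2 _ p rho m [eta R1 with d.+1 |-> 0] w o _ w2 h2; first lia.
    move=> y; have [l1 l2] := agree_locs a1 hl y; split; first by lia.
    rewrite /=; have -> : mp y == d.+1 = false by lia.
    exact: l2.
    move=> k i hk /=; have -> : addr k i == d.+1 = false by rewrite /addr; lia.
    exact: (agree_rep a1 hm).
  have a02 : agree d R R2.
    move=> r hr; rewrite a2 /=; last lia.
    have -> : r == d.+1 = false by lia.
    by rewrite a1.
  have hstart : R2 d = N /\ R2 d.+1 = 0.
    split; first by rewrite a2 /= ?ne ?v1 // leqnSn.
    by rewrite a2 /= ?eqxx // ltnSn.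
  pose Inv i R' (w' o' : seq nat) := [/\ agree d R R', R' d.+2 = iteri i g A, w' = w & o' = o].
  have [| | | | | |R3 [w3' [o3' [r3 [a3 v3 ew eo]]]]] := @loop_ok p d d.+3 _ body
      (fun i => ecost (upd (upd rho x i) a (iteri i g A)) m e + 2) N Inv R2 w o _ hlp.
  + by [].
  + move=> i Ra Rb w' o' [b1 b2 b3 b4] hh; split=> //.
      by move=> r hr; rewrite hh ?b1 //; lia.
    by rewrite hh ?ne.
  + move=> i Ra w' o' hi [b1 b2 -> ->] c1 c2.
    have /code_at_cat[hb1 /code_at_cons[k1 /code_at_cons[k2 _]]] : code_at p (off + s1 + 1 + s2).+1 body.
      by move: hlp; rewrite /loop_code -lock => /code_at_cons[_ /code_at_cat[]].
    have [| | |R5 [r5 a5 v5]] := IH (upd (upd mp x d.+1) a d.+2) d.+3 _ p (upd (upd rho x i) a (iteri i g A)) m Ra w o _ w3 hb1.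
    - lia.
    - apply: locs_upd => //.
      apply: locs_upd => //.
      by apply: locs_le (agree_locs b1 hl); lia.
    - exact: agree_rep b1 hm.
    exists [eta [eta R5 with d.+2 |-> 0] with d.+2 |-> 0 + R5 d.+3], w, o; split.
    - rewrite size_cat addnA; apply: reach_trans r5 _.
      apply: (reachS k1); apply: (reachS k2) => /=; rewrite !ne eqxx addn2; exact: reach0.
    - split=> //=; last by rewrite eqxx v5.
      move=> r hr /=; have -> : r == d.+2 = false by lia.
      by rewrite a5 ?b1 //; lia.
    - by rewrite /= !ne a5 //; lia.
    - by rewrite /= !ne a5 //; lia.
  + by split.
  + by case: hstart.
  + by case: hstart.
  subst w3' o3'.
  exists [eta [eta R3 with d |-> 0] with d |-> 0 + R3 d.+2]; split.
  + rewrite !size_cat /= size_cat /= size_cat size_loop_code -/s1 -/s2 -/body.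
    rewrite -addnA -addnA -addnA; apply: reach_trans r1 _.
    apply: (reach_trans (reach1 _ _ _ hj)) => /=; rewrite -[(off + s1).+1]addn1.
    apply: (reach_trans r2); apply: (reach_trans r3).
    move: i1 i2; rewrite size_loop_code => i1 i2.
    apply: (reachS (i := Const d 0)).
      by rewrite -i1; congr (onth p _); lia.
    apply: (reachS (i := Add d d d.+2)).
      by rewrite -i2; congr (onth p _); lia.
    rewrite /= eqxx ne.
    match goal with |- reach _ _ (Config ?x _ _ _) (Config ?y _ _ _) =>
      have -> : y = x by lia end.
    exact: reach0.
  + move=> r hr /=; have -> : r == d = false by lia.
    by rewrite a3 ?a02 //; lia.
  + by rewrite /= eqxx v3.
- move=> hd /andP[w1 w3] /code_at_cat[h1 /code_at_cons[hj /code_at_cons[hj0]]].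
  move=> /code_at_cat[hlp /code_at_cons[i1 /code_at_cons[i2 _]]] hl hm.
  have [|R1 [r1 a1 v1]] := IHl mp d off p rho m R w o _ w1 h1 hl hm; first lia.
  set s1 := size _ in h1 hlp hj i1 i2 r1 *.
  have e0 : (off + s1).+2 = off + s1 + 2 by lia.
  rewrite e0 in hlp i1 i2.
  set body := (_ ++ [:: Add _ _ _]) in hlp i1 i2 *.
  set g := (fun i r => r + eval (upd rho x i) m e); set N := eval rho m lim.
  pose R2 := [eta [eta R1 with d.+1 |-> 0] with d.+2 |-> 0].
  have a02 : agree d R R2.
    move=> r hr /=.
    have [-> ->] : (r == d.+1 = false) /\ (r == d.+2 = false) by lia.
    by rewrite a1.
  pose Inv i R' (w' o' : seq nat) := [/\ agree d R R', R' d.+2 = iteri i g 0, w' = w & o' = o].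
  have [| | | | | |R3 [w3' [o3' [r3 [a3 v3 ew eo]]]]] := @loop_ok p d d.+3 _ body
      (fun i => ecost (upd rho x i) m e + 1) N Inv R2 w o _ hlp.
  + by [].
  + move=> i Ra Rb w' o' [b1 b2 b3 b4] hh; split=> //.
      by move=> r hr; rewrite hh ?b1 //; lia.
    by rewrite hh ?ne.
  + move=> i Ra w' o' hi [b1 b2 -> ->] c1 c2.
    have /code_at_cat[hb1 /code_at_cons[k1 _]] : code_at p (off + s1 + 2).+1 body.
      by move: hlp; rewrite /loop_code -lock => /code_at_cons[_ /code_at_cat[]].
    have [| | |R5 [r5 a5 v5]] := IH (upd mp x d.+1) d.+3 _ p (upd rho x i) m Ra w o _ w3 hb1.
    - lia.
    - apply: locs_upd => //.
      by apply: locs_le (agree_locs b1 hl); lia.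
    - exact: agree_rep b1 hm.
    exists [eta R5 with d.+2 |-> R5 d.+2 + R5 d.+3], w, o; split.
    - rewrite size_cat addnA; apply: reach_trans r5 _.
      apply: (reachS k1) => /=; rewrite addn1; exact: reach0.
    - split=> //=; last by rewrite eqxx v5 a5 ?b2 // ltnSn.
      move=> r hr /=; have -> : r == d.+2 = false by lia.
      by rewrite a5 ?b1 //; lia.
    - by rewrite /= !ne a5 //; lia.
    - by rewrite /= !ne a5 //; lia.
  + by split; rewrite //= eqxx.
  + by rewrite /R2 /= !ne v1.
  + by rewrite /R2 /= !ne eqxx.
  subst w3' o3'.
  exists [eta [eta R3 with d |-> 0] with d |-> 0 + R3 d.+2]; split.
  + rewrite size_cat /= size_cat size_loop_code -/s1 -/body.
    rewrite -addnA -addnA -addnA; apply: reach_trans r1 _.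
    apply: (reach_trans (reach1 _ _ _ hj)) => /=.
    apply: (reach_trans (reach1 _ _ _ hj0)) => /=; rewrite e0.
    apply: (reach_trans r3).
    move: i1 i2; rewrite size_loop_code => i1 i2.
    apply: (reachS (i := Const d 0)).
      by rewrite -i1; congr (onth p _); lia.
    apply: (reachS (i := Add d d d.+2)).
      by rewrite -i2; congr (onth p _); lia.
    rewrite /= eqxx ne.
    match goal with |- reach _ _ (Config ?x _ _ _) (Config ?y _ _ _) =>
      have -> : y = x by rewrite /=; lia end.
    exact: reach0.
  + move=> r hr /=; have -> : r == d = false by lia.
    by rewrite a3.
  + by rewrite /= eqxx v3 iteri_sum.
Qed.

(** Commands change the arrays, so only low registers are preserved; the arrays are followed by
    [rep] instead. *)
Definition low (d : nat) (R R' : nat -> nat) : Prop := forall r, r < d -> R' r = R r.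

Lemma agree_low d R R' : agree d R R' -> low d R R'.
Proof. by move=> h r hr; rewrite h // hr. Qed.

Lemma low_locs d mp rho R R' : low d R R' -> locs mp d rho R -> locs mp d rho R'.
Proof. by move=> h hm x; have [h1 h2] := hm x; rewrite h. Qed.

Lemma low_trans d R1 R2 R3 : low d R1 R2 -> low d R2 R3 -> low d R1 R3.
Proof. by move=> h1 h2 r hr; rewrite h2 // h1. Qed.

Lemma addr_inj j i j' i' : j < 64 -> j' < 64 -> addr j i = addr j' i' -> j = j' /\ i = i'.
Proof. by rewrite /addr; lia. Qed.

Lemma rep_set m R R' j i v :
  j < 64 -> rep m R -> (forall r, base <= r -> R' r = if r == addr j i then v else R r) ->
  rep (upd m j (upd (m j) i v)) R'.
Proof.
move=> hj hm hR j' i' hj'; rewrite hR; last by rewrite /addr; lia.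
rewrite /upd; case: eqP => [/addr_inj [] // -> ->|h]; first by rewrite !eqxx.
case: eqP => [e1|_]; last exact: hm.
by case: eqP => [e2|_]; [case: h; rewrite e1 e2|rewrite -e1 hm].
Qed.

Lemma ccmd_ok c : forall mp d off p rho st R,
  d + cdep c <= base -> cwf c -> code_at p off (ccmd mp d off c) ->
  locs mp d rho R -> rep (cells st) R ->
  exists R', [/\ reach p (ccost rho c st) (Config off R (win st) (wout st))
     (Config (off + size (ccmd mp d off c)) R' (win (run rho c st)) (wout (run rho c st))),
     low d R R' & rep (cells (run rho c st)) R'].
Proof.
elim: c => [|j e1 e2|c1 IH1 c2 IH2|e c1 IH1 c2 IH2|x lim c IH|j e|e] mp d off p rho st R /=.
- by move=> _ _ _ _ hm; exists R; split=> //; rewrite addn0.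
- move=> hd /and3P[hj w1 w2] /code_at_cat[/code_at_cat[h1 h2] /code_at_cat[h3 /code_at_cons[h4 _]]] hl hm.
  move: h3 h4; rewrite size_cat size_addr_code addnA => h3 h4.
  have [|R1 [r1 a1 v1]] := cexp_ok (win st) (wout st) _ w1 h1 hl hm; first lia.
  have [|R2 [r2 a2 v2]] := addr_code_ok R1 (win st) (wout st) _ h2; first lia.
  have a12 := agree_trans a1 a2.
  have [| |R3 [r3 a3 v3]] := @cexp_ok e2 mp d.+1 _ p rho (cells st) R2 (win st) (wout st) _ w2 h3 _ (agree_rep a12 hm); first lia.
    exact: locs_le (agree_locs a12 hl).
  eexists; split.
  + rewrite !size_cat size_addr_code !addnA.
    apply: reach_trans (reach_trans (reach_trans r1 r2) r3) _.
    by apply: (reachS h4); rewrite /= addn1; exact: reach0.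
  + move=> r hr /=; have -> : r == R3 d = false by rewrite a3 ?ltnSn // v2 /addr; lia.
    by rewrite a3 ?a12 ?hr //; lia.
  + apply: (rep_set hj hm) => r hr /=.
    rewrite a3 ?ltnSn // v2 v1 v3; case: eqP => // _.
    by rewrite a3 ?a12 // hr ?orbT.
- move=> hd /andP[w1 w2] /code_at_cat[h1 h2] hl hm.
  have [|R1 [r1 a1 v1]] := IH1 mp d off p rho st R _ w1 h1 hl hm; first lia.
  have [|R2 [r2 a2 v2]] := IH2 mp d _ p rho _ R1 _ w2 h2 (low_locs a1 hl) v1; first lia.
  exists R2; split=> //; last exact: low_trans a1 a2.
  by rewrite size_cat addnA; exact: reach_trans r1 r2.
- move=> hd /and3P[w1 w2 w3] /code_at_cat[h1 /code_at_cons[hj /code_at_cat[h2]]].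
  move=> /code_at_cons[hj2 h3] hl hm.
  have [|R1 [r1 a1 v1]] := cexp_ok (win st) (wout st) _ w1 h1 hl hm; first lia.
  set s1 := size _ in h1 h2 h3 hj hj2 r1 *.
  move: h2 h3 hj2; rewrite -[(off + s1).+1]addn1 => h2; set s2 := size _ in h2 *.
  rewrite -[(_ + s2).+1]addn1; set l3 := off + s1 + 1 + s2 + 1 => h3 hj2.
  rewrite size_cat /= size_cat /= -/s1 -/s2 -/l3; set s3 := size _ in h3 hj2 *.
  have -> : off + (s1 + (s2 + s3.+1).+1) = l3 + s3 by rewrite /l3; lia.
  case: eqP => hv.
  + have [|R2 [r2 a2 v2]] := IH2 mp d l3 p rho st R1 _ w3 h3 (agree_locs a1 hl) (agree_rep a1 hm); first lia.
    exists R2; split=> //; last exact: low_trans (agree_low a1) a2.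
    rewrite -addnA; apply: reach_trans r1 _; apply: (reachS hj) => /=.
    by rewrite v1 hv eqxx.
  + have [|R2 [r2 a2 v2]] := IH1 mp d _ p rho st R1 _ w2 h2 (agree_locs a1 hl) (agree_rep a1 hm); first lia.
    exists R2; split=> //; last exact: low_trans (agree_low a1) a2.
    rewrite -addnA; apply: reach_trans r1 _; apply: (reachS hj) => /=.
    rewrite v1; case: eqP hv => // _ _; rewrite -[(off + s1).+1]addn1.
    by apply: reach_trans r2 _; apply: (reachS hj2); exact: reach0.
- move=> hd /andP[w1 w2] /code_at_cat[h1 /code_at_cons[hj hlp]] hl hm.
  have [|R1 [r1 a1 v1]] := cexp_ok (win st) (wout st) _ w1 h1 hl hm; first lia.
  set s1 := size _ in h1 hlp hj r1 *.
  move: hlp; rewrite -[(off + s1).+1]addn1.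
  set body := ccmd _ _ _ _ => hlp.
  set g := (fun i st => run (upd rho x i) c st); set N := eval rho (cells st) lim.
  pose R2 := [eta R1 with d.+1 |-> 0].
  pose Inv i R' w' o' := [/\ low d R R', rep (cells (iteri i g st)) R',
     w' = win (iteri i g st) & o' = wout (iteri i g st)].
  have hcb : code_at p (off + s1 + 1).+1 body.
    by move: hlp; rewrite /loop_code -lock => /code_at_cons[_ /code_at_cat[]].
  have [| | | | | |R3 [w' [o' [r3 [a3 v3 ew eo]]]]] := @loop_ok p d d.+2 _ body
      (fun i => ccost (upd rho x i) c (iteri i g st)) N Inv R2 (win st) (wout st) _ hlp.
  + by [].
  + move=> i Ra Rb w' o' [b1 b2 b3 b4] hh; split=> //.
      by move=> r hr; rewrite hh ?b1 //; lia.
    move=> j' i' hj'; rewrite hh ?b2 //; rewrite /addr; lia.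
  + move=> i Ra w' o' hi [b1 b2 -> ->] c1 c2.
    have [| |R5 [r5 a5 v5]] := IH (upd mp x d.+1) d.+2 _ p (upd rho x i) _ Ra _ w2 hcb _ b2.
    - lia.
    - apply: locs_upd => //.
      by apply: locs_le (low_locs b1 hl); lia.
    exists R5, (win (iteri i.+1 g st)), (wout (iteri i.+1 g st)); split=> //.
    - split=> // r hr; rewrite a5 ?b1 //; lia.
    - by rewrite a5.
    - by rewrite a5.
  + split=> //.
    - move=> r hr; rewrite /R2 /=; have -> : r == d.+1 = false by lia.
      by rewrite a1 ?hr.
    - move=> j i hj' /=; have -> : addr j i == d.+1 = false by rewrite /addr; lia.
      exact: (agree_rep a1 hm).
  + by rewrite /R2 /=; have -> : d == d.+1 = false by lia.
  + by rewrite /R2 /= eqxx.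
  subst w' o'; exists R3; split=> //.
  rewrite size_cat /= size_loop_code -/s1.
  rewrite -addnA; apply: reach_trans r1 _.
  apply: (reach_trans (reach1 _ _ _ hj)) => /=; rewrite -[(off + s1).+1]addn1 -/body.
  have -> : off + (s1 + (size body + 5).+1) = off + s1 + 1 + size body + 5 by lia.
  exact: r3.
- move=> hd /andP[hj w1] /code_at_cat[h1 /code_at_cat[h2 /code_at_cons[h3 /code_at_cons[h4 _]]]] hl hm.
  move: h3 h4; rewrite size_addr_code => h3 h4.
  have [|R1 [r1 a1 v1]] := cexp_ok (win st) (wout st) _ w1 h1 hl hm; first lia.
  have [|R2 [r2 a2 v2]] := addr_code_ok R1 (win st) (wout st) _ h2; first lia.
  have a12 := agree_trans a1 a2.
  have hne : d == d.+1 = false by lia.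
  eexists; split.
  + rewrite !size_cat size_addr_code !addnA.
    apply: reach_trans (reach_trans r1 r2) _.
    by apply: (reachS h3); apply: (reachS h4); rewrite /= addn2; exact: reach0.
  + move=> r hr /=; rewrite hne eqxx; have -> : r == R2 d = false by rewrite v2 /addr; lia.
    have -> : r == d.+1 = false by lia.
    by rewrite a12 ?hr.
  + apply: (rep_set hj hm) => r hr /=.
    rewrite hne eqxx v2 v1; case: eqP => // _.
    have -> : r == d.+1 = false by lia.
    by rewrite a12 // hr orbT.
- move=> hd w1 /code_at_cat[h1 /code_at_cons[h2 _]] hl hm.
  have [|R1 [r1 a1 v1]] := cexp_ok (win st) (wout st) _ w1 h1 hl hm; first lia.
  exists R1; split; last exact: agree_rep a1 hm; last exact: agree_low.
  rewrite size_cat addnA; apply: reach_trans r1 _; apply: (reachS h2) => /=.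
  by rewrite v1 addn1; exact: reach0.
Qed.

(** Unbound loop variables all live in register 0, which is never written and therefore keeps its
    initial value 0; temporaries start at register 1. *)
Definition compile (c : cmd) : program := ccmd (fun=> 0) 1 0 c.

Definition start (w : seq nat) : state := State (fun _ _ => 0) w [::].

Lemma compile_ok c w t :
  cwf c -> cdep c < base -> ccost (fun=> 0) c (start w) <= t ->
  outputs_within (compile c) w t (wout (run (fun=> 0) c (start w))).
Proof.
move=> hw hd ht; exists (ccost (fun=> 0) c (start w)) => //=.
have [| | | |R' [hr _ _]] := @ccmd_ok c (fun=> 0) 1 0 (compile c) (fun=> 0) (start w) (fun=> 0) _ hw.
- by rewrite add1n.
- by move=> i hi; rewrite add0n.
- by [].
- by [].
by rewrite /init hr /halted /= add0n; split.
Qed.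

(** * Frame rules and running times *)

Fixpoint ereads (e : expr) : seq nat :=
  match e with
  | Num _ | Loc _ => [::]
  | Arr j e => j :: ereads e
  | EAdd e1 e2 | ESub e1 e2 | Sum _ e1 e2 => ereads e1 ++ ereads e2
  | EIf e1 e2 e3 | Fold _ _ e1 e2 e3 => ereads e1 ++ ereads e2 ++ ereads e3
  end.

Fixpoint writes (c : cmd) : seq nat :=
  match c with
  | Skip | WriteC _ => [::]
  | Set_ j _ _ | ReadC j _ => [:: j]
  | Seq c1 c2 | If _ c1 c2 => writes c1 ++ writes c2
  | For _ _ c => writes c
  end.

Fixpoint silent (c : cmd) : bool :=
  match c with
  | Skip | Set_ _ _ _ | ReadC _ _ => true
  | WriteC _ => false
  | Seq c1 c2 | If _ c1 c2 => silent c1 && silent c2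
  | For _ _ c => silent c
  end.

Lemma eval_ext e rho m m' :
  (forall j, j \in ereads e -> m' j = m j) -> eval rho m' e = eval rho m e.
Proof.
have iterE n (f g : nat -> nat -> nat) a : (forall i r, f i r = g i r) -> iteri n f a = iteri n g a.
  by move=> h; elim: n => //= n ->.
elim: e rho => [c|x|j e IH|e1 IH1 e2 IH2|e1 IH1 e2 IH2|e1 IH1 e2 IH2 e3 IH3|
        x a lim IHl e0 IH0 e IH|x lim IHl e IH] rho //= h.
- by rewrite IH => [|k hk]; rewrite h ?inE ?eqxx ?hk ?orbT.
- by rewrite IH1 ?IH2 // => k hk; rewrite h // mem_cat hk ?orbT.
- by rewrite IH1 ?IH2 // => k hk; rewrite h // mem_cat hk ?orbT.
- by rewrite IH1 ?IH2 ?IH3 // => k hk; rewrite h // !mem_cat hk ?orbT.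
- rewrite IHl ?IH0; first by apply: iterE => i r; rewrite IH // => k hk; rewrite h // !mem_cat hk ?orbT.
    by move=> k hk; rewrite h // !mem_cat hk ?orbT.
  by move=> k hk; rewrite h // !mem_cat hk ?orbT.
- rewrite IHl; first by apply: eq_bigr => i _; rewrite IH // => k hk; rewrite h // mem_cat hk ?orbT.
  by move=> k hk; rewrite h // mem_cat hk.
Qed.

Lemma run_Seq rho c1 c2 st : run rho (Seq c1 c2) st = run rho c2 (run rho c1 st).
Proof. by []. Qed.

Lemma run_If rho e c1 c2 st : run rho (If e c1 c2) st =
  if eval rho (cells st) e == 0 then run rho c2 st else run rho c1 st.
Proof. by []. Qed.

Lemma run_Set rho a e1 e2 st i : cells (run rho (Set_ a e1 e2) st) a i =
  if i == eval rho (cells st) e1 then eval rho (cells st) e2 else cells st a i.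
Proof. by rewrite /= /upd eqxx. Qed.

Lemma eval_ESub rho m e1 e2 : eval rho m (ESub e1 e2) = eval rho m e1 - eval rho m e2.
Proof. by []. Qed.

Lemma run_frame c rho st j : j \notin writes c -> cells (run rho c st) j = cells st j.
Proof.
elim: c rho st => [|k e1 e2|c1 IH1 c2 IH2|e c1 IH1 c2 IH2|x lim c IH|k e|e] rho st //=.
- by rewrite inE /upd => /negbTE ->.
- by rewrite mem_cat negb_or => /andP[h1 h2]; rewrite IH2 ?IH1.
- by rewrite mem_cat negb_or => /andP[h1 h2]; case: eqP => _; rewrite ?IH2 ?IH1.
- by move=> h; elim: (eval _ _ _) => //= n <-; rewrite IH.
- by rewrite inE /upd => /negbTE ->.
Qed.

Lemma run_silent c rho st : silent c -> wout (run rho c st) = wout st.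
Proof.
elim: c rho st => [|k e1 e2|c1 IH1 c2 IH2|e c1 IH1 c2 IH2|x lim c IH|k e|e] rho st //=.
- by case/andP=> /IH1 h1 /IH2 h2; rewrite h2 h1.
- by case/andP=> /IH1 h1 /IH2 h2; case: eqP.
- move=> h; elim: (eval _ _ _) => //= n <-; exact: IH.
Qed.

Lemma iteri_ind (T : Type) (Inv : nat -> T -> Prop) (F : nat -> T -> T) x n :
  Inv 0 x -> (forall i y, i < n -> Inv i y -> Inv i.+1 (F i y)) ->
  forall j, j <= n -> Inv j (iteri j F x).
Proof. by move=> h0 hS; elim=> //= j IH hj; apply: hS => //; apply: IH; apply: ltnW. Qed.

Lemma run_For_ind (Inv : nat -> state -> Prop) rho x lim c st N :
  eval rho (cells st) lim = N -> Inv 0 st ->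
  (forall i s, i < N -> Inv i s -> Inv i.+1 (run (upd rho x i) c s)) ->
  Inv N (run rho (For x lim c) st).
Proof.
move=> hN h0 hS /=; rewrite hN; exact: (iteri_ind h0 hS).
Qed.

Definition Tab (a x : nat) (lim e : expr) : cmd := For x lim (Set_ a (Loc x) e).

(** As [e] does not read the array being filled, every entry is computed from the initial memory. *)
Lemma run_Tab a x lim e rho st i :
  a \notin ereads e ->
  cells (run rho (Tab a x lim e) st) a i =
  if i < eval rho (cells st) lim then eval (upd rho x i) (cells st) e else cells st a i.
Proof.
move=> ha.
have [] // := @run_For_ind (fun n s => (forall j, j != a -> cells s j = cells st j) /\ cells s a i =
  if i < n then eval (upd rho x i) (cells st) e else cells st a i) rho x lim (Set_ a (Loc x) e) st _ erefl.
move=> n s hn [h1 h2]; split=> /= [j hj|].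
  by rewrite /upd (negbTE hj) h1.
rewrite (@eval_ext e _ (cells st)) => [|j hj]; last by rewrite h1 //; apply: contraNneq ha => <-.
rewrite /upd !eqxx ltnS leq_eqVlt; case: eqP => [->|_] //=; by rewrite h2.
Qed.

Lemma run_Tab_lt a x lim e rho st i :
  a \notin ereads e -> i < eval rho (cells st) lim ->
  cells (run rho (Tab a x lim e) st) a i = eval (upd rho x i) (cells st) e.
Proof. by move=> h hi; rewrite run_Tab // hi. Qed.

(* If all loop bounds are scalars from a set [ro] that the program never writes, the
   running time is polynomial in their values, with the program size as exponent. *)
Definition ro_lim (ro : seq nat) (e : expr) : bool :=
  if e is Arr j (Num 0) then j \in ro else false.

Fixpoint eok (ro : seq nat) (e : expr) : bool :=
  match e with
  | Num _ | Loc _ => true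
  | Arr j e => eok ro e
  | EAdd e1 e2 | ESub e1 e2 => eok ro e1 && eok ro e2
  | Sum _ e1 e2 => ro_lim ro e1 && eok ro e2
  | EIf e1 e2 e3 => [&& eok ro e1, eok ro e2 & eok ro e3]
  | Fold _ _ e1 e2 e3 => [&& ro_lim ro e1, eok ro e2 & eok ro e3]
  end.

Fixpoint cok (ro : seq nat) (c : cmd) : bool :=
  match c with
  | Skip => true
  | WriteC e => eok ro e
  | Set_ j e1 e2 => [&& j \notin ro, eok ro e1 & eok ro e2]
  | ReadC j e => (j \notin ro) && eok ro e
  | Seq c1 c2 => cok ro c1 && cok ro c2
  | If e c1 c2 => [&& eok ro e, cok ro c1 & cok ro c2]
  | For _ lim c => ro_lim ro lim && cok ro c
  end.

(** Exponent of the cost bound. Costs of parts add up while their bounds are multiplied, which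
    leaves room for the constants because every bound is at least 16. A loop adds 2 to the exponent,
    for its number of iterations and its overhead. *)
Fixpoint esz (e : expr) : nat :=
  match e with
  | Num _ | Loc _ => 1
  | Arr j e => (esz e).+1
  | EAdd e1 e2 | ESub e1 e2 => esz e1 + esz e2
  | Sum _ e1 e2 => esz e2 + 2
  | EIf e1 e2 e3 => esz e1 + esz e2 + esz e3
  | Fold _ _ e1 e2 e3 => esz e2 + esz e3 + 2
  end.

Fixpoint csz (c : cmd) : nat :=
  match c with
  | Skip => 1
  | WriteC e => (esz e).+1
  | Set_ j e1 e2 => esz e1 + esz e2
  | ReadC j e => (esz e).+1
  | Seq c1 c2 => csz c1 + csz c2
  | If e c1 c2 => esz e + csz c1 + csz c2
  | For _ lim c => csz c + 2
  end.

Lemma ecost_le ro M rho m e :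
  (forall j, j \in ro -> m j 0 <= M) -> eok ro e -> ecost rho m e <= (M + 16) ^ esz e.
Proof.
move=> hM; set A := M + 16.
(* Reading a scalar takes 10 steps: one for the index 0 and nine for the load. *)
have hlim rho' lim : ro_lim ro lim -> eval rho' m lim <= M /\ ecost rho' m lim = 10.
  by case: lim => // j [] // [] //= /hM.
have pos n : 0 < n -> 16 <= A ^ n.
  case: n => // n _; rewrite expnS; have : 0 < A ^ n by rewrite expn_gt0 /A addnC.
  by rewrite /A; nia.
have szpos e' : 0 < esz e' by elim: e' => //= *; lia.
have sum_le n (F : nat -> nat) B : n <= M -> (forall i, F i <= B) -> \sum_(i < n) F i <= M * B.
  move=> hn hF; apply: leq_trans (_ : n * B <= _); last by rewrite leq_mul2r hn orbT.
  rewrite -[n in n * B]card_ord -sum_nat_const; exact: leq_sum.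
elim: e rho => [c|x|j e IH|e1 IH1 e2 IH2|e1 IH1 e2 IH2|e1 IH1 e2 IH2 e3 IH3|
        x a lim IHl e0 IH0 e IH|x lim IHl e IH] rho /=.
- by rewrite expn1 /A addnC.
- by rewrite expn1 /A; lia.
- move=> /(IH rho); rewrite expnS; have := pos _ (szpos e); rewrite {3}/A; nia.
- move=> /andP[/(IH1 rho) + /(IH2 rho)]; rewrite expnD.
  have := pos _ (szpos e1); have := pos _ (szpos e2); nia.
- move=> /andP[/(IH1 rho) + /(IH2 rho)]; rewrite expnD.
  have := pos _ (szpos e1); have := pos _ (szpos e2); nia.
- move=> /and3P[/(IH1 rho) + /(IH2 rho) + /(IH3 rho)]; rewrite !expnD.
  have := pos _ (szpos e1); have := pos _ (szpos e2); have := pos _ (szpos e3).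
  set a := A ^ _; set b := A ^ _; set c := A ^ _ => ha hb hc h1 h2 h3.
  have : (if eval rho m e1 == 0 then ecost rho m e3 else ecost rho m e2 + 1) <= a + b + 1 by case: ifP; lia.
  have : a * b >= a + b + 16 by nia.
  nia.
- move=> /and3P[/(hlim rho)[hl ->] /(IH0 rho) h0 hb]; rewrite !expnD.
  have := pos _ (szpos e0); have := pos _ (szpos e).
  have /(sum_le _ _ _ hl) : forall i, ecost (upd (upd rho x i) a
           (iteri i (fun i r => eval (upd (upd rho x i) a r) m e) (eval rho m e0))) m e + 2 + 5 <= A ^ esz e + 7.
    by move=> i; rewrite -addnA leq_add2r IH.
  move: h0; set a0 := A ^ _; set b := A ^ _; set S := \sum_(_ < _) _ => h0 h1 h2 h3.
  have : a0 * b >= a0 + b + 16 by nia.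
  have : M * (b + 7) <= M * (a0 * b) by nia.
  rewrite /A; nia.
- move=> /andP[/(hlim rho)[hl ->] hb]; rewrite !expnD.
  have := pos _ (szpos e).
  have /(sum_le _ _ _ hl) : forall i, ecost (upd rho x i) m e + 1 + 5 <= A ^ esz e + 6.
    by move=> i; rewrite -addnA leq_add2r IH.
  set b := A ^ _; set S := \sum_(_ < _) _ => h1 h2.
  have : M * (b + 6) <= M * (b + b) by nia.
  rewrite /A; nia.
Qed.

Lemma cok_writes ro c j : cok ro c -> j \in ro -> j \notin writes c.
Proof.
move=> + hj; elim: c => [|k e1 e2|c1 IH1 c2 IH2|e c1 IH1 c2 IH2|x lim c IH|k e|e] //=.
- by case/and3P=> h _ _; rewrite inE; apply: contraNneq h => <-.
- by case/andP=> /IH1 h1 /IH2 h2; rewrite mem_cat negb_or h1.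
- by case/and3P=> _ /IH1 h1 /IH2 h2; rewrite mem_cat negb_or h1.
- by case/andP=> _ /IH.
- by case/andP=> h _; rewrite inE; apply: contraNneq h => <-.
Qed.

Lemma ccost_le ro M rho c st :
  (forall j, j \in ro -> cells st j 0 <= M) -> cok ro c -> ccost rho c st <= (M + 16) ^ csz c.
Proof.
set A := M + 16.
have pos n : 0 < n -> 16 <= A ^ n.
  case: n => // n _; rewrite expnS; have : 0 < A ^ n by rewrite expn_gt0 /A addnC.
  by rewrite /A; nia.
have szpos e' : 0 < esz e' by elim: e' => //= *; lia.
have cpos c' : 0 < csz c' by elim: c' => //= *; rewrite ?addn_gt0 ?szpos //; lia.
elim: c rho st => [|k e1 e2|c1 IH1 c2 IH2|e c1 IH1 c2 IH2|x lim c IH|k e|e] rho st //= hM.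
- move=> /and3P[_ /(ecost_le rho hM) h1 /(ecost_le rho hM) h2]; rewrite expnD.
  move: h1 h2; have := pos _ (szpos e1); have := pos _ (szpos e2); rewrite -/A; nia.
- move=> /andP[h1 h2].
  have := IH1 rho st hM h1.
  have : ccost rho c2 (run rho c1 st) <= A ^ csz c2.
    by apply: IH2 h2 => j hj; rewrite run_frame ?hM ?(cok_writes h1).
  rewrite expnD; have := pos _ (cpos c1); have := pos _ (cpos c2); nia.
- move=> /and3P[/(ecost_le rho hM)] + /(IH1 rho st hM) + /(IH2 rho st hM); rewrite -/A !expnD.
  have := pos _ (szpos e); have := pos _ (cpos c1); have := pos _ (cpos c2).
  set a := A ^ _; set b := A ^ _; set d := A ^ _ => ha hb hc h1 h2 h3.
  have : (if eval rho (cells st) e == 0 then ccost rho c2 st else ccost rho c1 st + 1) <= a + b + 1 by case: ifP; lia.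
  have : a * b >= a + b + 16 by nia.
  nia.
- move=> /andP[hl hc].
  have [hl1 ->] : eval rho (cells st) lim <= M /\ ecost rho (cells st) lim = 10.
    by case: lim hl => // j [] // [] //= /hM.
  have hI i : ccost (upd rho x i) c (iteri i (fun i st => run (upd rho x i) c st) st) <= A ^ csz c.
    apply: (IH) (hc) => j hj.
    have -> : cells (iteri i (fun i st0 => run (upd rho x i) c st0) st) j = cells st j; last exact: hM.
    by elim: i => //= i <-; rewrite run_frame // (cok_writes hc hj).
  have : \sum_(i < eval rho (cells st) lim) (ccost (upd rho x i) c (iteri i (fun i st => run (upd rho x i) c st) st) + 5)
     <= M * (A ^ csz c + 5).
    apply: leq_trans (_ : eval rho (cells st) lim * (A ^ csz c + 5) <= _); last by rewrite leq_mul2r hl1 orbT.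
    rewrite -[X in _ <= X * _]card_ord -sum_nat_const; apply: leq_sum => i _.
    by rewrite leq_add2r.
  rewrite expnD; have := pos _ (cpos c); set b := A ^ _; set S := \sum_(_ < _) _ => h1 h2.
  have : M * (b + 5) <= M * (b + b) by nia.
  rewrite /A; nia.
- move=> /andP[_ /(ecost_le rho hM)]; rewrite expnS -/A.
  have := pos _ (szpos e); rewrite {3}/A; nia.
- move=> /(ecost_le rho hM); rewrite expnS -/A.
  have := pos _ (szpos e); rewrite {3}/A; nia.
Qed.

(* A scalar variable is entry [0] of an array. *)
Definition V (j : nat) : expr := Arr j (Num 0).
Definition ELt (a b : expr) : expr := EIf (ESub b a) (Num 1) (Num 0).
Definition EEq (a b : expr) : expr := EIf (EAdd (ESub a b) (ESub b a)) (Num 0) (Num 1).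
Definition ENot (a : expr) : expr := EIf a (Num 0) (Num 1).
Definition EAnd (a b : expr) : expr := EIf a b (Num 0).
(** The last index satisfying [e], or [d] if there is none. Later [d] is [N], so that writing to the
    result of a failed search hits no vertex. *)
Definition ELast (x a : nat) (lim d e : expr) : expr := Fold x a lim d (EIf e (Loc x) (Loc a)).

Lemma if_lt (a b : nat) : (if b - a == 0 then 0 else 1) = (a < b).
Proof. by rewrite subn_eq0 ltnNge; case: (_ <= _). Qed.

Lemma if_eq (a b : nat) : (if a - b + (b - a) == 0 then 1 else 0) = (a == b).
Proof. by rewrite addn_eq0 !subn_eq0 -eqn_leq; case: (_ == _). Qed.

Lemma if_not (b : bool) : (if (b : nat) == 0 then 1 else 0) = ~~ b.
Proof. by case: b. Qed.

Lemma if_and (b b' : bool) : (if (b : nat) == 0 then 0 else (b' : nat)) = (b && b').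
Proof. by case: b. Qed.

(** * Sign-compatible pieces of bounded size *)

Ltac sum_lia :=
  repeat match goal with
  | |- context [@bigop.body ?A ?B ?i ?r ?f] => let S := fresh in set S := (@bigop.body A B i r f) in *; clearbody S
  | H : context [@bigop.body ?A ?B ?i ?r ?f] |- _ => let S := fresh in set S := (@bigop.body A B i r f) in *; clearbody S
  end; lia.

Section Pieces.
Local Open Scope ring_scope.
Import GRing.Theory Num.Theory Order.TTheory.

Lemma isum_cons (T : Type) (f : T -> int) (a : T) (s : seq T) :
  \sum_(x <- a :: s) f x = f a + \sum_(x <- s) f x.
Proof. exact: big_cons. Qed.

Lemma isum_cat (T : Type) (f : T -> int) (s t : seq T) :
  \sum_(x <- s ++ t) f x = \sum_(x <- s) f x + \sum_(x <- t) f x.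
Proof. exact: big_cat. Qed.

Lemma rem_perm (T : eqType) (x : T) (s : seq T) : x \in s -> perm_eq (x :: rem x s) s.
Proof. by move=> h; rewrite perm_sym; exact: perm_to_rem. Qed.

(* Terms are ordered greedily, always adding one whose sign is opposite to that of the
   current partial sum. *)
Lemma balanced_order (T : eqType) (f : T -> int) (D : nat) (s : seq T) (P : int) :
  (forall x, x \in s -> `|f x| <= D%:Z) -> - D%:Z <= P <= D%:Z ->
  0 <= P + \sum_(x <- s) f x <= D%:Z ->
  exists2 s', perm_eq s' s &
    forall i, - D%:Z <= P + \sum_(x <- take i s') f x <= D%:Z.
Proof.
move: {2}(size s) (leqnn (size s)) => n; elim: n s P => [|n IH] s P.
  by rewrite leqn0 => /nilP -> _ hP _; exists [::] => // i; rewrite big_nil addr0.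
case: s => [|a s'] hs hf hP ht.
  by exists [::] => // i; rewrite big_nil addr0.
set s := a :: s' in hs hf ht *.
have [x hx hPx] : exists2 x, x \in s & - D%:Z <= P + f x <= D%:Z.
  case: (lerP P 0) => hP0.
    case: (@hasP _ (fun x => 0 <= f x) s) => [[x hx h0]|hn].
      by exists x => //; have := hf x hx; sum_lia.
    (* With [P <= 0] and only negative terms left, the final sum would be negative. *)
    have hle : \sum_(x <- s') f x <= 0.
      by rewrite big_seq sumr_le0 // => x hx; rewrite leNgt; apply/negP => h; apply: hn; exists x; rewrite ?inE ?hx ?orbT //; sum_lia.
    have : f a < 0 by rewrite ltNge; apply/negP => h; apply: hn; exists a; rewrite ?inE ?eqxx.
    move: ht hle; rewrite /s isum_cons; set S := \sum_(_ <- _) _ => ht hle ha; exfalso. clearbody S; sum_lia.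
  case: (@hasP _ (fun x => f x < 0) s) => [[x hx h0]|hn].
    by exists x => //; have := hf x hx; sum_lia.
  have hle : 0 <= \sum_(x <- s') f x.
    by rewrite big_seq sumr_ge0 // => x hx; rewrite leNgt; apply/negP => h; apply: hn; exists x; rewrite ?inE ?hx ?orbT //; sum_lia.
  have : 0 <= f a by rewrite leNgt; apply/negP => h; apply: hn; exists a; rewrite ?inE ?eqxx.
  (* All terms left are nonnegative, so [P + f a] lies between [P] and the final sum, which is at
     most [D]. *)
  move=> ha; exists a; rewrite ?inE ?eqxx //; move: ht hle; rewrite /s isum_cons.
  set S := \sum_(_ <- _) _; clearbody S; sum_lia.
have hsum : \sum_(y <- s) f y = f x + \sum_(y <- rem x s) f y.
  by rewrite (perm_big _ (perm_to_rem hx)) isum_cons.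
have [|y /mem_rem|||s1 hp hb] := IH (rem x s) (P + f x) => //.
- by have := size_rem hx; rewrite /s /= in hs *; sum_lia.
- exact: hf.
- by rewrite -addrA -hsum.
exists (x :: s1); first by apply: perm_trans (rem_perm hx); rewrite perm_cons.
by case=> [|i] /=; rewrite ?big_nil ?addr0 // isum_cons addrA.
Qed.

(* Two of the balanced partial sums coincide, by the pigeonhole principle. *)
Lemma zero_piece (T : eqType) (f : T -> int) (D : nat) (s : seq T) :
  (forall x, x \in s -> `|f x| <= D%:Z) -> 0 <= \sum_(x <- s) f x <= D%:Z ->
  (D.*2.+1 < size s)%N ->
  exists p r, [/\ perm_eq (p ++ r) s, (0 < size p <= D.*2.+1)%N & \sum_(x <- p) f x = 0].
Proof.
move=> hf ht hs.
have [||s' hp hb] := @balanced_order T f D s 0 hf; [sum_lia|by rewrite add0r|].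
(* There are [2D + 2] prefixes, while their sums take only the [2D + 1] values from [-D] to [D],
   shifted here to start at 0. *)
pose g (i : 'I_D.*2.+2) : 'I_D.*2.+1 := inord (absz (\sum_(x <- take i s') f x + D%:Z)).
have hg i : g i = absz (\sum_(x <- take i s') f x + D%:Z) :> nat.
  rewrite inordK //; have := hb i; rewrite add0r.
  by set S := \sum_(_ <- _) _; clearbody S; sum_lia.
have /injectivePn[i [j hij hgij]] : ~~ injectiveb g.
  by apply/negP => /injectiveP /leq_card; rewrite !card_ord ltnn.
wlog hlt : i j hij hgij / (i < j)%N.
  move=> H; case: (ltngtP i j) => h; first exact: H h.
    by apply: (H j i) => //; rewrite eq_sym.
  by move/eqP: hij; case; apply: val_inj.
have hsz : size s' = size s by exact: perm_size.
exists (take (j - i) (drop i s')), (take i s' ++ drop j s'); split.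
- apply: perm_trans hp; rewrite perm_sym.
  have e : drop j s' = drop (j - i) (drop i s') by rewrite drop_drop; congr (drop _ s'); sum_lia.
  rewrite -{1}(cat_take_drop i s') -{1}(cat_take_drop (j - i) (drop i s')) -e.
  by rewrite perm_catCA.
- by rewrite size_take size_drop hsz; have := ltn_ord j; case: ifP; sum_lia.
- have e : take j s' = take i s' ++ take (j - i) (drop i s').
    by rewrite -takeD; congr (take _ s'); sum_lia.
  have := congr1 val hgij; rewrite /= !hg e isum_cat /=.
  have := hb i; have := hb j; rewrite e isum_cat /= !add0r.
  set S := \sum_(_ <- _) _; set S' := \sum_(_ <- _) _; clearbody S S'; sum_lia.
Qed.

(** Pieces whose sum lies between 0 and the total are split off, so that the rest remains
    nonnegative. A single term in this range is such a piece. Otherwise some nonnegative term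
    exceeds the total, so the total is at most [D] and a long list contains a piece of sum zero. *)
Lemma nonneg_pieces (T : eqType) (f : T -> int) (D : nat) (s : seq T) :
  (forall x, x \in s -> `|f x| <= D%:Z) -> 0 <= \sum_(x <- s) f x ->
  exists2 ss : seq (seq T), perm_eq (flatten ss) s &
    forall p, p \in ss -> (size p <= D.*2.+1)%N /\ 0 <= \sum_(x <- p) f x.
Proof.
move: {2}(size s) (leqnn (size s)) => n; elim: n s => [|n IH] s.
  by rewrite leqn0 => /nilP -> _ _; exists [::].
move=> hs hf ht; case: (leqP (size s) D.*2.+1) => hsz.
  by exists [:: s]; rewrite /= ?cats0 // => p; rewrite inE => /eqP ->.
have step p r : perm_eq (p ++ r) s -> (0 < size p <= D.*2.+1)%N ->
    0 <= \sum_(x <- p) f x <= \sum_(x <- s) f x ->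
    exists2 ss : seq (seq T), perm_eq (flatten ss) s &
    forall p, p \in ss -> (size p <= D.*2.+1)%N /\ 0 <= \sum_(x <- p) f x.
  move=> hp hsp hsum; have hsz' := perm_size hp; rewrite size_cat in hsz'.
  have hbig : \sum_(x <- p) f x + \sum_(x <- r) f x = \sum_(x <- s) f x.
    by rewrite -isum_cat; exact: perm_big.
  have [|x hx||ss h1 h2] := IH r; [sum_lia| |sum_lia|].
    by apply: hf; rewrite -(perm_mem hp) mem_cat hx orbT.
  exists (p :: ss); first by apply: perm_trans hp; rewrite /= perm_cat2l.
  by move=> q; rewrite inE => /predU1P[->|/h2 //]; sum_lia.
case: (@hasP _ (fun x => 0 <= f x <= \sum_(x <- s) f x) s) => [[x hx h0]|hn].
  by apply: (step [:: x] (rem x s)); rewrite ?big_seq1 //; exact: rem_perm.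
have [x hx h0] : exists2 x, x \in s & 0 <= f x.
  apply/hasP; apply/negPn; rewrite -all_predC; apply/negP => /allP hall.
  case: s hs hf ht hsz hn step hall => // a s hs hf ht hsz hn _ hall.
  have hle : \sum_(x <- s) f x <= 0.
    by rewrite big_seq sumr_le0 // => x hx; have := hall x; rewrite inE hx orbT /=; sum_lia.
  have h := hall a (mem_head _ _); rewrite /= -ltNge in h.
  by move: ht; rewrite isum_cons; sum_lia.
have [|p [r [h1 h2 h3]]] := @zero_piece T f D s hf _ hsz.
  have := hf x hx; have : ~~ (f x <= \sum_(x <- s) f x).
    by apply/negP => h; apply: hn; exists x; rewrite ?h0.
  sum_lia.
by apply: (step p r) => //; rewrite h3; sum_lia.
Qed.

(** Treating one coordinate groups at most [2D + 1] items together, which multiplies both the size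
    of pieces and the bound on the entries by this factor. *)
Fixpoint piece_bound (n D : nat) : nat :=
  if n is n.+1 then (D.*2.+1 * piece_bound n (D.*2.+1 * D))%N else 1.

Lemma sum_norm_le (T : eqType) (f : T -> int) (D L : nat) (p : seq T) :
  (forall x, x \in p -> `|f x| <= D%:Z) -> (size p <= L)%N ->
  `|\sum_(x <- p) f x| <= (L * D)%N%:Z.
Proof.
move=> hf; elim: p L hf => [|a p IH] [|L] hf //=; rewrite ?big_nil ?normr0 // => hs.
rewrite isum_cons; have h1 := hf a; have /(_ _ hs) h2 := IH L.
have : `|\sum_(x <- p) f x| <= (L * D)%N%:Z.
  by apply: h2 => x hx; apply: hf; rewrite inE hx orbT.
have : `|f a| <= D%:Z by apply: h1; rewrite inE eqxx.
rewrite mulSn; sum_lia.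
Qed.

(* Coordinates are treated one at a time: pieces for one coordinate become the items of
   the next, with a larger bound on the entries. *)
Lemma signed_pieces n : forall (D : nat) (T : eqType) (F : nat -> T -> int) (s : seq T),
  (forall j x, (j < n)%N -> x \in s -> `|F j x| <= D%:Z) ->
  exists ss : seq (seq T), [/\ perm_eq (flatten ss) s,
    forall p, p \in ss -> (size p <= piece_bound n D)%N &
    forall j, (j < n)%N -> (forall p, p \in ss -> 0 <= \sum_(x <- p) F j x) \/
                           (forall p, p \in ss -> \sum_(x <- p) F j x <= 0)].
Proof.
elim: n => [|n IH] D T F s hF.
  exists [seq [:: x] | x <- s]; split=> //.
    by elim: s {hF} => //= x s h; rewrite perm_cons.
  by move=> p /mapP[x _ ->].
have [ss1 hp1 [hs1 hsign]] : exists2 ss : seq (seq T), perm_eq (flatten ss) s &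
    (forall p, p \in ss -> (size p <= D.*2.+1)%N) /\
    ((forall p, p \in ss -> 0 <= \sum_(x <- p) F n x) \/
     (forall p, p \in ss -> \sum_(x <- p) F n x <= 0)).
  case: (lerP 0 (\sum_(x <- s) F n x)) => h.
    have [|ss h1 h2] := @nonneg_pieces T (F n) D s _ h; first by move=> x; apply: hF.
    by exists ss => //; split; [|left] => p /h2[].
  have [||ss h1 h2] := @nonneg_pieces T (fun x => - F n x) D s.
  - by move=> x hx; rewrite normrN; apply: hF.
  - by rewrite sumrN oppr_ge0 ltW.
  exists ss => //; split; [|right] => p /h2[] //.
  by rewrite sumrN oppr_ge0.
have [j p hj hp|sss [hp2 hs2 hsg2]] :=
    IH (D.*2.+1 * D)%N (seq T) (fun j p => \sum_(x <- p) F j x) ss1.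
  apply: sum_norm_le (hs1 p hp) => x hx; apply: hF; first sum_lia.
  by rewrite -(perm_mem hp1); apply/flattenP; exists p.
have hin q p : q \in sss -> p \in q -> p \in ss1.
  by move=> h1 h2; rewrite -(perm_mem hp2); apply/flattenP; exists q.
exists [seq flatten q | q <- sss]; split.
- apply: perm_trans hp1; apply: perm_trans (perm_flatten hp2).
  by elim: sss {hp2 hs2 hsg2 hin} => //= q sss h; rewrite flatten_cat perm_cat2l.
- move=> p /mapP[q hq ->] /=.
  apply: leq_trans (_ : D.*2.+1 * size q <= _)%N; last by rewrite leq_mul2l hs2.
  have : forall p, p \in q -> (size p <= D.*2.+1)%N by move=> p' /(hin _ _ hq) /hs1.
  elim: (q) => //= a q' IHq h; rewrite size_cat mulnS leq_add //; first by apply: h; rewrite inE eqxx.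
  by apply: IHq => p' hp'; apply: h; rewrite inE hp' orbT.
- move=> j; rewrite ltnS leq_eqVlt => /predU1P[->|hj].
    case: hsign => h; [left|right] => p /mapP[q hq ->]; rewrite big_flatten big_seq.
      by apply: sumr_ge0 => p' /(hin _ _ hq) /h.
    by apply: sumr_le0 => p' /(hin _ _ hq) /h.
  by case: (hsg2 j hj) => h; [left|right] => p /mapP[q hq ->]; rewrite big_flatten; exact: h.
Qed.

(** The gains of the pieces add up to a positive number, so one of them is positive. In a coordinate
    where all pieces are nonnegative, a single piece is at most the total; in the others it is at
    most 0. *)
Lemma improving_piece n D (T : eqType) (F : nat -> T -> int) (g : T -> int) (s : seq T) :
  (forall j x, (j < n)%N -> x \in s -> `|F j x| <= D%:Z) -> uniq s ->
  0 < \sum_(x <- s) g x ->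
  exists p : seq T, [/\ uniq p, {subset p <= s}, (size p <= piece_bound n D)%N,
    0 < \sum_(x <- p) g x &
    forall j, (j < n)%N -> \sum_(x <- p) F j x <= 0 \/
      \sum_(x <- p) F j x <= \sum_(x <- s) F j x].
Proof.
move=> hF hu hg; have [ss [hp hs hsg]] := signed_pieces hF.
have hsum (h : T -> int) : \sum_(x <- s) h x = \sum_(p <- ss) \sum_(x <- p) h x.
  by rewrite -big_flatten; apply: perm_big; rewrite perm_sym.
have /hasP[p hpss hgp] : has (fun p => 0 < \sum_(x <- p) g x) ss.
  apply/negPn; rewrite -all_predC; apply/negP => /allP hall.
  move: hg; rewrite hsum ltNge big_seq sumr_le0 // => p /hall /=; sum_lia.
have [r hpr] : exists r, perm_eq (p ++ r) s.
  exists (flatten (rem p ss)); apply: perm_trans hp.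
  exact: (perm_flatten (rem_perm hpss)).
exists p; split=> //.
- by move: hu; rewrite -(perm_uniq hpr) cat_uniq => /andP[].
- by move=> x hx; rewrite -(perm_mem hpr) mem_cat hx.
- exact: hs.
- move=> j hj; case: (hsg j hj) => h; last by left; apply: h.
  right; rewrite hsum (perm_big _ (perm_to_rem hpss)) isum_cons /= lerDl big_seq.
  by apply: sumr_ge0 => q /mem_rem /h.
Qed.
End Pieces.

(** * Labellings and local search *)

Section Labels.
Variables (n C : nat) (adj : rel 'I_n).

Definition class_size (l : 'I_n -> nat) (v : 'I_n) : nat := \sum_(w < n) (l v == l w).
Definition feasible (l : 'I_n -> nat) : bool := [forall v, class_size l v <= C].
Definition agreement (l : 'I_n -> nat) : nat := \sum_(v < n) \sum_(w < n) (adj v w && (l v == l w)).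
(* [agreement] counts ordered pairs, that is, twice the number of edges inside blocks; the
   score [0] is reserved for labellings that violate the capacity. *)
Definition score (l : 'I_n -> nat) : nat := if feasible l then (agreement l).+1 else 0.

Lemma score_eq l l' :
  (forall v w, (l v == l w) = (l' v == l' w)) -> score l = score l'.
Proof.
move=> h; rewrite /score /feasible /agreement.
have -> : [forall v, class_size l v <= C] = [forall v, class_size l' v <= C].
  by apply: eq_forallb => v; rewrite /class_size; under eq_bigr => w _ do rewrite h.
by case: ifP => // _; congr S; apply: eq_bigr => v _; apply: eq_bigr => w _; rewrite h.
Qed.

(** Splitting classes without cutting an edge inside a class keeps the capacity and all counted
    edges. *)
Lemma score_mono l l' :
  (forall v w, l' v = l' w -> l v = l w) ->
  (forall v w, adj v w -> l v = l w -> l' v = l' w) -> score l <= score l'.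
Proof.
move=> h1 h2; rewrite /score; case: ifP => // /forallP hf.
have -> : feasible l'.
  apply/forallP => v; apply: leq_trans (hf v); apply: leq_sum => w _.
  by case: (l' v =P l' w) => // /h1 ->; rewrite eqxx.
rewrite ltnS; apply: leq_sum => v _; apply: leq_sum => w _.
case ha: (adj v w) => //=; case: (l v =P l w) => // /(h2 _ _ ha) ->; by rewrite eqxx.
Qed.
End Labels.

Section LabelEq.
Variables (n k : nat) (rp : 'I_n -> 'I_n).

(* Labels below [k] are shared by all components, the others are private to the component
   represented by [rp v]; [k + rp v + n * d v] is injective in the pair [(rp v, d v)]. *)
Definition labf (d : 'I_n -> nat) (v : 'I_n) : nat :=
  if d v < k then d v else k + rp v + n * d v.

Definition same (d : 'I_n -> nat) (v w : 'I_n) : bool :=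
  (d v == d w) && ((d v < k) || (rp v == rp w)).

Lemma labfE d v w : (labf d v == labf d w) = same d v w.
Proof.
rewrite /labf /same; case: (ltnP (d v) k) => hv; case: (ltnP (d w) k) => hw /=.
- by rewrite andbT.
- by lia.
- by have := ltn_ord (rp v); lia.
- have hvn := ltn_ord (rp v); have hwn := ltn_ord (rp w).
  apply/eqP/andP => [h|[/eqP -> /eqP ->]] //.
  have hd : d v = d w by nia.
  by split; apply/eqP => //; apply: val_inj => /=; move: h; rewrite hd; lia.
Qed.

End LabelEq.

(** * Labellings relative to a separator, and local improvements *)

Section LocalSearch.
Variables (n C k : nat) (adj : rel 'I_n).
Hypotheses (adj_sym : symmetric adj).
Variables (U : {set 'I_n}) (rp : 'I_n -> 'I_n).
Hypotheses (rpU : forall v, (rp v \in U) = (v \in U)) (rpK : forall v, rp (rp v) = rp v)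
  (rp_adj : forall v w, v \notin U -> w \notin U -> adj v w -> rp v = rp w)
  (rp_size : forall v, v \notin U -> \sum_(w < n) (rp w == rp v) <= k)
  (U_size : #|U| <= k).

Definition good (d : 'I_n -> nat) : Prop :=
  (forall u, u \in U -> d u < k) /\ (forall v, d v <= k.*2).

(** Classes meeting [U] are renamed by their position among the labels of [U], hence below [k]. The
    other classes are split along components and renamed by positions within the component, offset
    by [k]; no edge is cut, since without [U] adjacent vertices share a component. *)
Lemma refine_labels l : exists2 d, good d & score C adj l <= score C adj (labf k rp d).
Proof.
pose LU := [seq l u | u <- enum U].
pose LD v := [seq l w | w <- enum 'I_n & rp w == rp v].
pose d v := if l v \in LU then index (l v) LU else k + index (l v) (LD v).
have hLU x : x \in LU -> index x LU < k.
  by rewrite -index_mem => h; apply: leq_trans h _; rewrite size_map -cardE.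
have inLU u : u \in U -> l u \in LU by move=> hu; apply: map_f; rewrite mem_enum.
have hLD v : l v \in LD v by apply: map_f; rewrite mem_filter eqxx mem_enum.
have hLDs v : v \notin U -> index (l v) (LD v) < k.
  move=> hv; apply: leq_trans (rp_size hv); apply: leq_trans (_ : size (LD v) <= _).
    by rewrite index_mem.
  rewrite size_map size_filter -sum1_count big_mkcond /= big_enum /=.
  by apply: leq_sum => w _; case: eqP.
exists d.
  split=> [u hu|v]; rewrite /d; first by rewrite inLU // hLU ?inLU.
  case: ifP => [/hLU|hv]; first by lia.
  have hvU : v \notin U by apply: contraFN hv; apply: inLU.
  by have := hLDs v hvU; lia.
apply: score_mono => v w.
  move/eqP; rewrite labfE /same /d => /andP[/eqP].
  case: ifP => hv; case: ifP => hw.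
  - by move=> h _; rewrite -(nth_index 0 hv) h nth_index.
  - by move=> h _; have := hLU _ hv; lia.
  - by move=> h _; have := hLU _ hw; lia.
  move/addnI => h /orP[h'|/eqP h']; first lia.
  have e : LD v = LD w by rewrite /LD h'.
  by rewrite -(nth_index 0 (hLD v)) h e nth_index.
move=> ha hl; apply/eqP; rewrite labfE /same /d hl.
case: ifP => hw; first by rewrite eqxx hLU.
have hv : l v \notin LU by rewrite hl hw.
have hvU : v \notin U by apply: contra hv; apply: inLU.
have hwU : w \notin U by apply: contraFN hw; apply: inLU.
by rewrite /LD (rp_adj hvU hwU ha) !eqxx orbT.
Qed.

Section Improve.
Variables (dig t : 'I_n -> nat).
Hypotheses (dig_good : good dig) (t_good : good t) (tU : forall u, u \in U -> t u = dig u)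
  (dig_pos : 0 < score C adj (labf k rp dig)) (t_better : score C adj (labf k rp dig) < score C adj (labf k rp t)).

Definition mix (X : seq 'I_n) (v : 'I_n) : nat := if rp v \in X then t v else dig v.

Definition cnt (d : 'I_n -> nat) (j : nat) : nat := \sum_(v < n) (d v == j).

Lemma class_small d v : d v < k -> class_size (labf k rp d) v = cnt d (d v).
Proof. by move=> h; apply: eq_bigr => w _; rewrite labfE /same h andbT eq_sym. Qed.

Lemma cnt_le d j : feasible C (labf k rp d) -> j < k -> cnt d j <= C.
Proof.
move=> /forallP hf hj; case: (pickP (fun v => d v == j)) => [v /eqP hv|h].
  by rewrite -hv -class_small ?hv.
by rewrite /cnt big1 // => v _; rewrite h.
Qed.

Definition wdeg (d : 'I_n -> nat) (v : 'I_n) : nat :=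
  \sum_(w < n) (adj v w && same k rp d v w) * (w \in U).+1.

Lemma same_sym d v w : same k rp d v w = same k rp d w v.
Proof. by rewrite /same eq_sym; case: eqP => //= ->; rewrite (eq_sym (rp v)). Qed.

(* Edges between [U] and its complement are charged twice to the endpoint outside [U]. *)
Lemma agreement_wdeg d : agreement adj (labf k rp d) =
  \sum_(v in U) \sum_(w in U) (adj v w && same k rp d v w) + \sum_(v | v \notin U) wdeg d v.
Proof.
rewrite /agreement (bigID (mem U)) /=.
under eq_bigr => v _.
  under eq_bigr => w _ do rewrite labfE.
  rewrite (bigID (mem U)) /=; over.
rewrite big_split /= -addnA; congr (_ + _).
rewrite exchange_big -big_split /=; apply: eq_bigr => v hv.
rewrite /wdeg [RHS](bigID (mem U)) [X in _ + X = _](bigID (mem U)) /= addnA; congr (_ + _).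
  rewrite -big_split /=; apply: eq_bigr => w hw.
  by rewrite hw labfE adj_sym same_sym; lia.
by apply: eq_bigr => w hw; rewrite (negbTE hw) labfE muln1.
Qed.

Definition reps : seq 'I_n := [seq r <- enum 'I_n | (rp r == r) && (r \notin U)].

Lemma mem_reps r : (r \in reps) = (rp r == r) && (r \notin U).
Proof. by rewrite mem_filter mem_enum andbT. Qed.

Lemma rp_reps v : (rp v \in reps) = (v \notin U).
Proof. by rewrite mem_reps rpK eqxx rpU. Qed.

Section IntSums.
Local Open Scope ring_scope.
Import GRing.Theory Num.Theory Order.TTheory.

Lemma Posz_sum (I : Type) (r : seq I) (P : pred I) (F : I -> nat) :
  (\sum_(i <- r | P i) F i)%N%:Z = \sum_(i <- r | P i) (F i)%:Z.
Proof. exact: (big_morph Posz PoszD (erefl _)). Qed.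

(** Makes the effect of relabelling the components in [X] additive over [X], for the counters as
    well as for the weighted degrees. *)
Lemma mix_sum (P : pred 'I_n) (p q : 'I_n -> nat) (X : seq 'I_n) : uniq X ->
  (\sum_(v | P v) (if rp v \in X then p v else q v))%N%:Z =
  (\sum_(v | P v) q v)%N%:Z + \sum_(r <- X) \sum_(v | P v && (rp v == r)) ((p v)%:Z - (q v)%:Z).
Proof.
elim: X => [|a X IH] /=; first by rewrite big_nil addr0.
move=> /andP[ha hu]; rewrite big_cons addrCA -IH // !Posz_sum.
rewrite big_mkcondr /= -big_split /=; apply: eq_bigr => v hv.
rewrite inE; case: eqP => [->|_] /=; last by rewrite add0r.
by rewrite (negbTE ha) subrK.
Qed.

Lemma local_improvement : exists X : seq 'I_n, [/\ uniq X, {subset X <= reps},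
  (size X <= piece_bound k k)%N & (score C adj (labf k rp dig) < score C adj (labf k rp (mix X)))%N].
Proof.
have [fd ft hlt] : [/\ feasible C (labf k rp dig), feasible C (labf k rp t) &
    (agreement adj (labf k rp dig) < agreement adj (labf k rp t))%N].
  move: dig_pos t_better; rewrite /score; case: (feasible C (labf k rp dig)) => // _.
  by case: (feasible C (labf k rp t)).
have ureps : uniq reps by rewrite filter_uniq ?enum_uniq.
pose F j r := \sum_(v | rp v == r) ((t v == j)%:Z - (dig v == j)%:Z).
pose g r := \sum_(v | (v \notin U) && (rp v == r)) ((wdeg t v)%:Z - (wdeg dig v)%:Z).
have mixU X u : {subset X <= reps} -> u \in U -> mix X u = dig u.
  by move=> hX hu; rewrite /mix; case: ifP => // /hX; rewrite rp_reps hu.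
(* A neighbour of [v] lies in the same component or in [U], where [t] and [dig] coincide; so the
   component of [v] alone decides which labelling is seen. *)
have mix_src X v w : {subset X <= reps} -> v \notin U -> adj v w ->
    same k rp (mix X) v w = if rp v \in X then same k rp t v w else same k rp dig v w.
  move=> hX hv ha; case: (boolP (w \in U)) => hw.
    by rewrite /same (mixU X w hX hw) -(tU hw) /mix; case: ifP.
  by rewrite /same /mix (rp_adj hv hw ha); case: ifP.
have hcnt X j : uniq X -> (cnt (mix X) j)%:Z = (cnt dig j)%:Z + \sum_(r <- X) F j r.
  move=> hu; rewrite /F -(mix_sum predT (fun v => t v == j) (fun v => dig v == j) hu).
  by congr Posz; apply: eq_bigr => v _; rewrite /mix; case: ifP.
have hagr X : uniq X -> {subset X <= reps} ->
    (agreement adj (labf k rp (mix X)))%:Z = (agreement adj (labf k rp dig))%:Z + \sum_(r <- X) g r.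
  move=> hu hX; rewrite !agreement_wdeg !PoszD -addrA; congr (Posz _ + _).
    apply: eq_bigr => v hv; apply: eq_bigr => w hw.
    by rewrite /same !(mixU X).
  rewrite /g -mix_sum //; congr Posz; apply: eq_bigr => v hv.
  rewrite /wdeg; case: ifP => hrv; apply: eq_bigr => w _.
    by case ha: (adj v w) => //=; rewrite mix_src // hrv.
  by case ha: (adj v w) => //=; rewrite mix_src // hrv.
have mixall v : mix reps v = t v.
  by rewrite /mix rp_reps; case: ifP => // /negbFE /tU.
have hall : (agreement adj (labf k rp (mix reps))) = agreement adj (labf k rp t).
  apply: eq_bigr => v _; apply: eq_bigr => w _.
  by rewrite /labf !mixall.
have hg : 0 < \sum_(r <- reps) g r.
  have := hagr reps ureps (fun x h => h); rewrite hall.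
  by move: (\sum_(r <- reps) g r) => S; lia.
(* There are [k] counters, and a component of at most [k] vertices changes each of them by at most
   [k]: hence [piece_bound k k]. *)
have [j r hj|X [uX hX sX gX fX]] := @improving_piece k k _ F g reps _ ureps hg.
  rewrite mem_reps => /andP[/eqP hr hrU].
  apply: le_trans (ler_norm_sum _ _ _) _.
  apply: le_trans (_ : (\sum_(v < n) (rp v == r))%N%:Z <= _); last first.
    by rewrite -{1}hr; have := rp_size hrU; lia.
  rewrite Posz_sum big_mkcond /=; apply: ler_sum => v _.
  by case: eqP => // _; case: (t v == j); case: (dig v == j).
exists X; split=> //.
(* By the choice of the piece, the counter is at most its value under [dig] or its value under [t],
   and both are feasible. *)
have hcntX j : (j < k)%N -> (cnt (mix X) j <= C)%N.
  move=> hj; have := fX j hj; have := hcnt X j uX.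
  have := hcnt reps j ureps.
  have -> : cnt (mix reps) j = cnt t j by apply: eq_bigr => v _; rewrite mixall.
  have := cnt_le fd hj; have := cnt_le ft hj.
  by move: (\sum_(r <- X) F j r) (\sum_(r <- reps) F j r) => S S'; lia.
have feasX : feasible C (labf k rp (mix X)).
  apply/forallP => v; case: (ltnP (mix X v) k) => hv.
    by rewrite class_small //; exact: hcntX.
  have hvU : v \notin U.
    by apply/negP => hu; move: hv; rewrite mixU // leqNgt (dig_good.1 _ hu).
  suff [s hs hcl] : exists2 s, feasible C (labf k rp s) & class_size (labf k rp (mix X)) v = class_size (labf k rp s) v.
    by rewrite hcl; exact: (forallP hs).
  (* A class with a private label stays inside one component, on which [mix X] is entirely [t] or
     entirely [dig]. *)
  exists (if rp v \in X then t else dig); first by case: ifP.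
  apply: eq_bigr => w _; rewrite !labfE /same.
  have -> : (if rp v \in X then t else dig) v = mix X v by rewrite /mix; case: ifP.
  rewrite ltnNge hv /=; case: (rp v =P rp w) => hvw; last by rewrite !andbF.
  by rewrite /mix -hvw; case: ifP.
rewrite /score fd feasX ltnS; have := hagr X uX hX.
by move: gX; move: (\sum_(r <- X) g r) => S; lia.
Qed.
End IntSums.
End Improve.
End LocalSearch.

(** * Exchanging isomorphic components *)

Lemma score_automorphism n C (adj : rel 'I_n) (phi : 'I_n -> 'I_n) (l : 'I_n -> nat) :
  involutive phi -> (forall v w, adj (phi v) (phi w) = adj v w) ->
  score C adj (l \o phi) = score C adj l.
Proof.
move=> phiK hadj; have bij : bijective phi by exists phi.
have hcl v : class_size (l \o phi) v = class_size l (phi v).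
  by rewrite /class_size [RHS](reindex phi) //=; apply: onW_bij.
rewrite /score; have -> : feasible C (l \o phi) = feasible C l.
  apply/forallP/forallP => h v; last by rewrite hcl.
  by rewrite -(phiK v) -hcl.
case: ifP => // _; congr S; rewrite /agreement [RHS](reindex phi) /=; last exact: onW_bij.
apply: eq_bigr => v _; rewrite [RHS](reindex phi) /=; last exact: onW_bij.
by apply: eq_bigr => w _; rewrite hadj.
Qed.

Section Exchange.
Variables (n C k : nat) (adj : rel 'I_n).
Hypotheses (adj_sym : symmetric adj).
Variables (U : {set 'I_n}) (rp : 'I_n -> 'I_n).
Hypotheses (rpU : forall v, (rp v \in U) = (v \in U)) (rpK : forall v, rp (rp v) = rp v)
  (rp_adj : forall v w, v \notin U -> w \notin U -> adj v w -> rp v = rp w)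
  (rp_size : forall v, v \notin U -> \sum_(w < n) (rp w == rp v) <= k)
  (U_size : #|U| <= k).
Variable dig : 'I_n -> nat.

Definition cl (r : 'I_n) : seq 'I_n := [seq v <- enum 'I_n | rp v == r].

Lemma mem_cl r v : (v \in cl r) = (rp v == r).
Proof. by rewrite mem_filter mem_enum andbT. Qed.

Lemma cl_uniq r : uniq (cl r). Proof. by rewrite filter_uniq ?enum_uniq. Qed.

(** Only the order-preserving bijection between the two components is considered. This distinguishes
    more types than isomorphism does, but still boundedly many, and equality of types becomes
    equality of words. *)
Definition iso (a b : 'I_n) : Prop :=
  [/\ size (cl a) = size (cl b),
      forall i, i < size (cl a) -> dig (nth a (cl a) i) = dig (nth b (cl b) i),
      forall i j, i < size (cl a) -> j < size (cl a) ->
        adj (nth a (cl a) i) (nth a (cl a) j) = adj (nth b (cl b) i) (nth b (cl b) j) &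
      forall i u, i < size (cl a) -> u \in U -> adj (nth a (cl a) i) u = adj (nth b (cl b) i) u].

Section Swap.
Variables (a b : 'I_n).
Hypotheses (ha : a \in reps U rp) (hb : b \in reps U rp) (hab : a != b) (hiso : iso a b).

Definition swap (v : 'I_n) : 'I_n :=
  if rp v == a then nth b (cl b) (index v (cl a))
  else if rp v == b then nth a (cl a) (index v (cl b)) else v.

Lemma idx_lt r v : rp v = r -> index v (cl r) < size (cl r).
Proof. by move=> h; rewrite index_mem mem_cl h. Qed.

Lemma nth_cl r i : i < size (cl r) -> rp (nth r (cl r) i) = r.
Proof. by move=> h; apply/eqP; rewrite -mem_cl mem_nth. Qed.

Lemma swapP v : (rp v = a /\ exists2 i, i < size (cl a) & v = nth a (cl a) i /\ swap v = nth b (cl b) i)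
  \/ (rp v = b /\ exists2 i, i < size (cl a) & v = nth b (cl b) i /\ swap v = nth a (cl a) i)
  \/ (rp v != a /\ rp v != b /\ swap v = v).
Proof.
have [hs _ _ _] := hiso; rewrite /swap; case: (rp v =P a) => [h|h].
  by left; split=> //; exists (index v (cl a)); rewrite ?idx_lt // nth_index ?mem_cl ?h.
case: (rp v =P b) => [h'|h']; last by right; right.
right; left; split=> //; exists (index v (cl b)); rewrite ?hs ?idx_lt //.
by rewrite nth_index ?mem_cl ?h'.
Qed.

Lemma rp_swap v : rp (swap v) = if rp v == a then b else if rp v == b then a else rp v.
Proof.
have [hs _ _ _] := hiso.
case: (swapP v) => [[h [i hi [_ ->]]]|[[h [i hi [_ ->]]]|[h1 [h2 ->]]]].
- by rewrite h eqxx nth_cl // -hs.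
- by rewrite h eq_sym (negbTE hab) eqxx nth_cl.
- by rewrite (negbTE h1) (negbTE h2).
Qed.

Lemma swapK : involutive swap.
Proof.
have [hs _ _ _] := hiso; move=> v.
case: (swapP v) => [[h [i hi [hv e]]]|[[h [i hi [hv e]]]|[h1 [h2 e]]]]; last by rewrite e.
- rewrite e /swap nth_cl -?hs // eq_sym (negbTE hab) eqxx.
  by rewrite index_uniq ?cl_uniq -?hs // -hv.
- rewrite e /swap nth_cl // eqxx.
  by rewrite index_uniq ?cl_uniq // -hv.
Qed.

Lemma rp_swap_eq v w : (rp (swap v) == rp (swap w)) = (rp v == rp w).
Proof.
rewrite !rp_swap; case: (rp v =P a) => [->|hv]; case: (rp w =P a) => [->|hw].
- by rewrite !eqxx.
- case: (rp w =P b) => [->|hw2]; first by rewrite eq_sym.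
  by apply/eqP/eqP => h; [case: hw2|case: hw]; rewrite h.
- case: (rp v =P b) => [->|hv2]; first by rewrite eq_sym.
  by apply/eqP/eqP => h; [case: hv2|case: hv]; rewrite h.
- case: (rp v =P b) => [->|hv2]; case: (rp w =P b) => [->|hw2] //; rewrite ?eqxx //.
    by apply/eqP/eqP => h; [case: hw|case: hw2]; rewrite h.
  by apply/eqP/eqP => h; [case: hv|case: hv2]; rewrite h.
Qed.

Lemma swapU u : u \in U -> swap u = u.
Proof.
move: ha hb; rewrite !mem_reps => /andP[_ haU] /andP[_ hbU] hu.
by case: (swapP u) => [[h _]|[[h _]|[_ []]]] //; [move: haU|move: hbU]; rewrite -h rpU hu.
Qed.

Lemma swap_notU v : (swap v \in U) = (v \in U).
Proof.
apply/idP/idP => h; last by rewrite swapU.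
by rewrite -(swapK v) swapU.
Qed.

Lemma dig_swap v : dig (swap v) = dig v.
Proof.
have [hs hd _ _] := hiso.
by case: (swapP v) => [[h [i hi [-> ->]]]|[[h [i hi [-> ->]]]|[h1 [h2 ->]]]] //; rewrite hd.
Qed.

Lemma adj_swapU v u : u \in U -> adj (swap v) u = adj v u.
Proof.
have [hs _ _ hd] := hiso => hu.
by case: (swapP v) => [[h [i hi [-> ->]]]|[[h [i hi [-> ->]]]|[h1 [h2 ->]]]] //; rewrite hd.
Qed.

Lemma adj_swap v w : adj (swap v) (swap w) = adj v w.
Proof.
case: (boolP (w \in U)) => hw; first by rewrite (swapU hw) adj_swapU.
case: (boolP (v \in U)) => hv; first by rewrite (swapU hv) adj_sym adj_swapU // adj_sym.
(* Outside [U] edges never join different components, and [swap] permutes the components. *)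
case: (rp v =P rp w) => hvw; last first.
  have -> : adj v w = false by apply/negbTE/negP => /(rp_adj hv hw).
  apply/negbTE/negP => /rp_adj; rewrite !swap_notU => /(_ hv hw) /eqP.
  by rewrite rp_swap_eq => /eqP.
have [hs _ had _] := hiso.
case: (swapP v) => [[h [i hi [ev ev']]]|[[h [i hi [ev ev']]]|[h1 [h2 ev']]]];
case: (swapP w) => [[g [j hj [ew ew']]]|[[g [j hj [ew ew']]]|[g1 [g2 ew']]]].
all: try by rewrite ev' ew' [in RHS]ev [in RHS]ew had.
all: try by rewrite ev' ew' [in RHS]ev [in RHS]ew -had.
all: try by rewrite ev' ew'.
all: try by case/eqP: hab; congruence.
all: try by case/eqP: g1; congruence.
all: try by case/eqP: g2; congruence.
all: try by case/eqP: h1; congruence.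
all: try by case/eqP: h2; congruence.
Qed.

(** Private labels depend on the representative, so [labf k rp (d \o swap)] is not
    [labf k rp d \o swap]; the two only induce the same classes, because [swap] maps components to
    components. *)
Lemma score_swap d : score C adj (labf k rp (d \o swap)) = score C adj (labf k rp d).
Proof.
rewrite -(score_automorphism C (labf k rp d) swapK adj_swap).
apply: score_eq => v w; rewrite labfE /= labfE /same /=.
by rewrite rp_swap_eq.
Qed.
End Swap.

Section Ranks.
Variables (B : nat) (code : 'I_n -> nat).
Hypothesis code_iso : forall a b, a \in reps U rp -> b \in reps U rp -> code a = code b -> iso a b.

Definition crank (r : 'I_n) : nat :=
  \sum_(s < n) [&& s \notin U, rp s == s, s < r & code s == code r].

Definition earlier (r : 'I_n) : {set 'I_n} := [set s | [&& s \notin U, rp s == s, s < r & code s == code r]].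

Lemma crankE r : crank r = #|earlier r|.
Proof. by rewrite /crank /earlier -sum1dep_card [RHS]big_mkcond; apply: eq_bigr => s _; case: ifP. Qed.

Definition changed (d : 'I_n -> nat) : {set 'I_n} :=
  [set r | (r \in reps U rp) && [exists v, (rp v == r) && (d v != dig v)]].

Lemma sum_subset (S T : {set 'I_n}) : S \subset T -> \sum_(r in S) (r : nat) <= \sum_(r in T) (r : nat).
Proof.
move=> h; rewrite big_mkcond [leqRHS]big_mkcond; apply: leq_sum => r _.
by case: ifP => // /(subsetP h) ->.
Qed.

(* Exchanging the contents of two isomorphic components moves a changed component to a
   smaller representative; an improvement minimising the sum of its changed
   representatives therefore only changes components of small rank. *)
Lemma low_rank_improvement (d : 'I_n -> nat) :
  good k U d -> (forall u, u \in U -> d u = dig u) -> #|changed d| <= B ->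
  exists d', [/\ good k U d', forall u, u \in U -> d' u = dig u,
    score C adj (labf k rp d') = score C adj (labf k rp d) &
    forall v, v \notin U -> d' v != dig v -> crank (rp v) < B].
Proof.
move eN: (\sum_(r in changed d) (r : nat)) => N.
elim/ltn_ind: N d eN => N IH d eN hg hU hB.
case: (boolP [forall v, (v \notin U) && (d v != dig v) ==> (crank (rp v) < B)]) => [/forallP h|].
  by exists d; split=> // v h1 h2; have := h v; rewrite h1 h2.
rewrite negb_forall => /existsP[v]; rewrite negb_imply -leqNgt => /andP[/andP[hv hdv] hcr].
have hc : rp v \in changed d by rewrite inE rp_reps // hv; apply/existsP; exists v; rewrite eqxx.
(* The component of [v] has at least [B] predecessors of its type. If all of them were changed, more
   than [B] components would be. *)
have [r hr hrc] : exists2 r, r \in earlier (rp v) & r \notin changed d.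
  apply/exists_inP; apply: contraT; rewrite negb_exists_in => /forall_inP hall.
  have : #|rp v |: earlier (rp v)| <= B.
    apply: leq_trans hB; apply/subset_leq_card/subsetP => s; rewrite in_setU1 => /predU1P[->//|/hall].
    by rewrite negbK.
  by rewrite cardsU1 -crankE [_ \in _]inE ltnn !andbF /=; lia.
move: hr; rewrite inE => /and4P[hrU /eqP hrr hlt /eqP hcode].
have hrR : r \in reps U rp by rewrite mem_reps // hrr eqxx.
have hvR : rp v \in reps U rp by rewrite rp_reps.
have hne : rp v != r by apply: contraTneq hlt => ->; rewrite ltnn.
have hiso := code_iso hvR hrR (esym hcode).
pose d1 := d \o swap (rp v) r.
(* As [dig] is invariant under the exchange, the change at [rp v] moves to the smaller
   representative [r] and nothing else becomes changed. *)
have hsub : changed d1 \subset r |: (changed d :\ rp v).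
  apply/subsetP => s; rewrite inE => /andP[hs /existsP[w /andP[/eqP hw hdw]]].
  have hw2 : rp (swap (rp v) r w) \in changed d.
    rewrite inE rp_reps // (swap_notU hvR hrR hne hiso) -(rpU w) hw.
    have -> : s \notin U by move: hs; rewrite mem_reps // => /andP[].
    apply/existsP; exists (swap (rp v) r w); rewrite eqxx /=.
    by rewrite (dig_swap hiso).
  move: hw2; rewrite (rp_swap hne hiso) hw in_setU1 in_setD1.
  case: (s =P r) => //= hsr; case: (s =P rp v) => [hsv|//] /=.
  by rewrite (negbTE hrc).
have [|||||d' [h1 h2 h3 h4]] := IH (\sum_(r in changed d1) (r : nat)) _ d1.
- apply: leq_ltn_trans (sum_subset hsub) _.
  move: eN; rewrite (bigD1 (rp v)) //= => eN.
  rewrite (big_setU1 _ (F := fun r : 'I_n => r : nat)) /=; last by rewrite in_setD1 (negbTE hrc) andbF.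
  have -> : \sum_(i in changed d :\ rp v) (i : nat) = \sum_(i in changed d | i != rp v) (i : nat).
    by apply: eq_bigl => i; rewrite in_setD1 andbC.
  by rewrite -eN ltn_add2r.
- by [].
- split=> [u hu|w]; last exact: hg.2.
  by rewrite /d1 /= (swapU hvR hrR hiso) // hg.1.
- by move=> u hu; rewrite /d1 /= (swapU hvR hrR hiso) // hU.
- apply: leq_trans (subset_leq_card hsub) _.
  apply: leq_trans hB; rewrite cardsU1 [#|changed d|](cardsD1 (rp v)) hc.
  by rewrite leq_add2r; case: (_ \notin _).
exists d'; split=> //.
by rewrite h3 /d1 score_swap.
Qed.
End Ranks.
End Exchange.

(** * Guesses describing an improvement *)

(** The program computes positions by counting smaller elements; this links its sums to [index]. *)
Lemma index_filter_enum n (p : pred 'I_n) (v : 'I_n) :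
  p v -> index v [seq w <- enum 'I_n | p w] = \sum_(w < n) (w < v) && p w.
Proof.
move=> pv; set s := enum 'I_n.
have hs : size (take v s) = v by rewrite size_takel // size_enum_ord ltnW.
have mem_take w : (w \in take v s) = (w < v) by rewrite in_take ?mem_enum // index_enum_ord.
have es : s = take v s ++ v :: drop v.+1 s.
  rewrite -{1}(cat_take_drop v s) (drop_nth v) ?size_enum_ord //.
  by rewrite nth_ord_enum.
have hp : index v [seq w <- s | p w] = count p (take v s).
  rewrite {1}es filter_cat /= pv index_cat mem_filter mem_take ltnn andbF /= eqxx addn0.
  by rewrite size_filter.
rewrite hp; have -> : \sum_(w < n) (w < v) && p w = \sum_(w <- s) (w < v) && p w by rewrite big_enum.
have hu : uniq s by exact: enum_uniq.
rewrite {2}es big_cat big_cons ltnn /= add0n.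
rewrite [X in _ = _ + X]big1_seq ?addn0; last first.
  move=> w /= hw; case: ltnP => // hlt; move: hu; rewrite {1}es cat_uniq => /and3P[_ /hasPn/(_ w)].
  by rewrite inE hw orbT /= mem_take hlt => /(_ isT).
rewrite -sum1_count big_mkcond big_seq [RHS]big_seq.
by apply: eq_bigr => w; rewrite mem_take => ->; case: (p w).
Qed.

(** The leading digit 1 lets the value determine the length of the word, so words of different
    lengths have different codes. *)
Definition horner (b : nat) (s : seq nat) : nat := foldl (fun a x => b * a + x) 1 s.

Lemma horner_rcons b s x : horner b (rcons s x) = b * horner b s + x.
Proof. by rewrite /horner foldl_rcons. Qed.

Lemma horner_gt0 b s : 0 < b -> 0 < horner b s.
Proof. by move=> hb; elim/last_ind: s => // s x IH; rewrite horner_rcons; nia. Qed.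

Lemma horner_lt b s : all (fun x => x < b) s -> horner b s < 2 * b ^ size s.
Proof.
elim/last_ind: s => [|s x IH] //; rewrite all_rcons => /andP[hx /IH h].
by rewrite horner_rcons size_rcons expnS; nia.
Qed.

Lemma horner_inj b s1 s2 : 1 < b -> all (fun x => x < b) s1 -> all (fun x => x < b) s2 ->
  horner b s1 = horner b s2 -> s1 = s2.
Proof.
move=> hb; elim/last_ind: s1 s2 => [|s1 x IH] s2; elim/last_ind: s2 => [|s2 y _] //.
- move=> _ _; rewrite horner_rcons -[horner b [::]]/1; have := horner_gt0 s2 (ltnW hb).
  by move=> h1 h2; exfalso; nia.
- move=> _ _; rewrite horner_rcons -[horner b [::]]/1; have := horner_gt0 s1 (ltnW hb).
  by move=> h1 h2; exfalso; nia.
rewrite !all_rcons !horner_rcons => /andP[hx h1] /andP[hy h2] h.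
have e : horner b s1 = horner b s2 by nia.
by rewrite (IH _ h1 h2 e); congr rcons; move: h; rewrite e; lia.
Qed.

Lemma digit_inj B a b x y : a < B -> b < B -> a + B * x = b + B * y -> a = b /\ x = y.
Proof.
move=> ha hb h; have hx : x = y by nia.
by move: h; rewrite hx => /addIn.
Qed.

Section Guess.
Variables (n C k : nat) (adj : rel 'I_n).
Hypotheses (adj_sym : symmetric adj).
Variables (U : {set 'I_n}) (rp : 'I_n -> 'I_n).
Hypotheses (rpU : forall v, (rp v \in U) = (v \in U)) (rpK : forall v, rp (rp v) = rp v)
  (rp_adj : forall v w, v \notin U -> w \notin U -> adj v w -> rp v = rp w)
  (rp_size : forall v, v \notin U -> \sum_(w < n) (rp w == rp v) <= k)
  (U_size : #|U| <= k).
Variables (dig : 'I_n -> nat) (B : nat).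
Hypotheses (dig_good : good k U dig) (kB : k <= B) (B_pieces : piece_bound k k <= B)
  (B_codes : 2 * (k.*2 + 2) ^ (k * (k.*2.+1)) <= B).

Definition rank (v : 'I_n) : nat := index v (cl rp (rp v)).

Lemma rankE v : rank v = \sum_(w < n) (w < v) && (rp w == rp v).
Proof. exact: index_filter_enum. Qed.

Definition chunk (s : seq 'I_n) (v : 'I_n) : seq nat :=
  dig v :: [seq (adj v w : nat) | w <- s] ++ [seq (adj v u : nat) | u <- enum U].

Definition items (r : 'I_n) : seq nat := flatten [seq chunk (cl rp r) v | v <- cl rp r].

(** The base [2k + 2] exceeds all labels and adjacency bits, and is above 1 even for [k = 0], as
    [horner_inj] requires. *)
Definition code (v : 'I_n) : nat := horner (k.*2 + 2) (items (rp v)).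

Lemma cl_size v : v \notin U -> size (cl rp (rp v)) <= k.
Proof.
move=> hv; apply: leq_trans (rp_size hv); rewrite size_filter -sum1_count big_mkcond big_enum /=.
by apply: leq_sum => w _; case: eqP.
Qed.

Lemma size_items r : size (items r) = size (cl rp r) * (size (cl rp r) + #|U|).+1.
Proof.
rewrite size_flatten /shape -map_comp.
have hc v : (size \o chunk (cl rp r)) v = (size (cl rp r) + #|U|).+1.
  by rewrite /= size_cat !size_map -cardE.
rewrite (eq_map hc); move: (_.+1) => m.
by elim: (cl rp r) => //= a s ->.
Qed.

Lemma items_lt r : all (fun x => x < k.*2 + 2) (items r).
Proof.
apply/allP => x /flattenP[s /mapP[v _ ->]]; rewrite inE mem_cat => /or3P[/eqP ->|/mapP[w _ ->]|/mapP[w _ ->]].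
- by have := dig_good.2 v; lia.
- by case: (adj v w); lia.
- by case: (adj v w); lia.
Qed.

(** A component has at most [k] vertices, and each contributes its label and at most [2k] adjacency
    bits. *)
Lemma code_lt v : v \notin U -> code v < B.
Proof.
move=> hv; apply: leq_trans B_codes; apply: leq_trans (horner_lt (items_lt _)) _.
rewrite leq_mul2l leq_pexp2l // ?addn_gt0 ?orbT //.
by rewrite size_items; have := cl_size hv; nia.
Qed.

(** With [s] vertices the word has length [s (s + |U| + 1)], which determines [s]. All chunks then
    have the same length and the words can be compared chunk by chunk. *)
Lemma items_iso a b : items a = items b -> iso adj U rp dig a b.
Proof.
move=> h; have hs : size (cl rp a) = size (cl rp b).
  have := congr1 size h; rewrite !size_items; nia.
have hc : [seq chunk (cl rp a) v | v <- cl rp a] = [seq chunk (cl rp b) v | v <- cl rp b].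
  apply: eq_from_flatten_shape => //; rewrite /shape -!map_comp.
  have hsz r v : (size \o chunk (cl rp r)) v = (size (cl rp r) + #|U|).+1.
    by rewrite /= size_cat !size_map -cardE.
  rewrite (eq_map (hsz a)) (eq_map (hsz b)) hs.
  move: (_.+1) => m; move: hs.
  by elim: (cl rp a) (cl rp b) => [|x s IH] [|y s'] //= [/IH ->].
have hi i : i < size (cl rp a) -> chunk (cl rp a) (nth a (cl rp a) i) = chunk (cl rp b) (nth b (cl rp b) i).
  move=> hi; have := congr1 (fun s => nth [::] s i) hc.
  by rewrite (nth_map a) // (nth_map b) // -hs.
have hparts i : i < size (cl rp a) ->
    [/\ dig (nth a (cl rp a) i) = dig (nth b (cl rp b) i),
     [seq (adj (nth a (cl rp a) i) w : nat) | w <- cl rp a] = [seq (adj (nth b (cl rp b) i) w : nat) | w <- cl rp b] &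
     [seq (adj (nth a (cl rp a) i) w : nat) | w <- enum U] = [seq (adj (nth b (cl rp b) i) w : nat) | w <- enum U]].
  move=> /hi [-> /eqP]; rewrite eqseq_cat ?size_map // => /andP[/eqP -> /eqP ->] //.
split=> //.
- by move=> i /hparts[].
- move=> i j /hparts[_ h1 _] hj; have := congr1 (fun s => nth 0 s j) h1.
  rewrite (nth_map a) // (nth_map b) -?hs //.
  by case: (adj _ _); case: (adj _ _).
- move=> i u /hparts[_ _ h1] hu; have hu' : index u (enum U) < size (enum U) by rewrite index_mem mem_enum.
  have := congr1 (fun s => nth 0 s (index u (enum U))) h1.
  rewrite !(nth_map u) // nth_index ?mem_enum //.
  by case: (adj _ _); case: (adj _ _).
Qed.

Lemma code_iso a b : a \in reps U rp -> b \in reps U rp -> code a = code b -> iso adj U rp dig a b.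
Proof.
rewrite !mem_reps => /andP[/eqP ha _] /andP[/eqP hb _].
rewrite /code ha hb => /horner_inj h; apply/items_iso/h; rewrite ?items_lt //; lia.
Qed.

(* A guess stores one digit for each component type, each rank of a component within its
   type, and each rank of a vertex within its component. *)
Definition slot (v : 'I_n) : nat := code v + B * (crank U rp code (rp v) + B * rank v).

(** The cap at [2k] makes the result [good] for every guess, so guesses need no validation. *)
Definition newdig (gs : nat -> nat) (v : 'I_n) : nat :=
  if v \in U then dig v
  else if crank U rp code (rp v) < B then minn k.*2 (gs (slot v)) else dig v.

Lemma rank_lt v : v \notin U -> rank v < k.
Proof. by move=> hv; apply: leq_trans (cl_size hv); rewrite index_mem mem_cl. Qed.

Lemma slot_lt v : v \notin U -> crank U rp code (rp v) < B -> slot v < B ^ 3.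
Proof.
move=> hv hc; have := code_lt hv; have := rank_lt hv; rewrite /slot !expnS expn0 muln1.
move: (code v) (crank _ _ _ _) (rank v) hc => x y z hy hz hx.
have : y + B * z < B * B by nia.
nia.
Qed.

Lemma crank_inj a b : a \in reps U rp -> b \in reps U rp -> code a = code b ->
  crank U rp code a = crank U rp code b -> a = b.
Proof.
wlog hlt : a b / a < b.
  move=> H ha hb hc hr; case: (ltngtP a b) => h; first exact: H.
    by symmetry; apply: H.
  exact: val_inj.
rewrite !mem_reps => /andP[/eqP ha1 ha2] _ hc hr.
suff : crank U rp code a < crank U rp code b by rewrite hr ltnn.
rewrite !crankE; apply: proper_card; apply/properP; split.
  apply/subsetP => s; rewrite !inE hc => /and4P[-> -> h ->] /=.
  by rewrite (ltn_trans h hlt).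
by exists a; rewrite !inE ?ltnn ?andbF // ha2 ha1 hlt hc !eqxx.
Qed.

Lemma slot_inj v w : v \notin U -> w \notin U ->
  crank U rp code (rp v) < B -> crank U rp code (rp w) < B -> slot v = slot w -> v = w.
Proof.
move=> hv hw hcv hcw; have hv1 := code_lt hv; have hw1 := code_lt hw.
have [rv rw] : (rp v \in reps U rp) /\ (rp w \in reps U rp) by rewrite !rp_reps.
have codeE x : code (rp x) = code x by rewrite /code rpK.
rewrite /slot => h.
have [h1 /(digit_inj hcv hcw)[h2 h3]] := digit_inj hv1 hw1 h.
have e : rp v = rp w by apply: crank_inj; rewrite ?codeE.
have := congr1 (fun i => nth v (cl rp (rp v)) i) h3.
by rewrite /rank nth_index ?mem_cl // e nth_index ?mem_cl.
Qed.

(** Some improvement changes at most [B] components, and after exchanges only components of rank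
    below [B]. Their vertices have distinct slots, so the digits can prescribe all new labels
    independently. *)
Lemma guess_improvement t : good k U t -> (forall u, u \in U -> t u = dig u) ->
  0 < score C adj (labf k rp dig) -> score C adj (labf k rp dig) < score C adj (labf k rp t) ->
  exists2 g : nat -> nat, (forall i, g i <= k.*2) &
    forall gs, (forall i, i < B ^ 3 -> gs i = g i) ->
      score C adj (labf k rp dig) < score C adj (labf k rp (newdig gs)).
Proof.
move=> t_good tU hpos hlt.
have [X [uX hX sX hXlt]] := local_improvement adj_sym rpU rpK rp_adj rp_size U_size dig_good tU hpos hlt.
pose d0 := mix rp dig t X.
have d0U u : u \in U -> d0 u = dig u.
  by move=> hu; rewrite /d0 /mix; case: ifP => // /hX; rewrite rp_reps // hu.
have d0g : good k U d0.
  split=> [u hu|v]; first by rewrite d0U // dig_good.1.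
  by rewrite /d0 /mix; case: ifP => _; [exact: t_good.2|exact: dig_good.2].
have hch : #|changed U rp dig d0| <= B.
  apply: leq_trans B_pieces; apply: leq_trans sX; rewrite -(card_uniqP uX).
  apply/subset_leq_card/subsetP => r; rewrite inE => /andP[_ /existsP[v /andP[/eqP <-]]].
  by rewrite /d0 /mix; case: ifP => //; rewrite eqxx.
have [d [d1 d2 d3 d4]] := low_rank_improvement C adj_sym rpU rpK rp_adj U_size code_iso d0g d0U hch.
pose act v := (v \notin U) && (crank U rp code (rp v) < B).
pose g i := if [pick v | act v && (slot v == i)] is Some v then d v else 0.
exists g => [i|gs hgs].
  by rewrite /g; case: pickP => // v _; exact: d1.2.
have hd v : newdig gs v = d v.
  rewrite /newdig; case: ifP => hU; first by rewrite d2.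
  have hvU : v \notin U by rewrite hU.
  case: ifP => hc; last first.
    by apply/eqP; apply: contraFT hc => h; apply: d4 => //; rewrite eq_sym.
  rewrite hgs ?slot_lt // /g; case: pickP => [w /andP[/andP[hw hcw] /eqP hs]|/(_ v)].
    by rewrite (slot_inj hw hvU hcw hc hs); apply/minn_idPr; exact: d1.2.
  by rewrite /act hvU hc eqxx.
have -> : score C adj (labf k rp (newdig gs)) = score C adj (labf k rp d).
  by apply: score_eq => v w; rewrite /labf !hd.
by rewrite d3.
Qed.

Lemma newdig_good gs : good k U (newdig gs).
Proof.
split=> [u hu|v]; first by rewrite /newdig hu dig_good.1.
rewrite /newdig; case: ifP => _; first exact: dig_good.2.
by case: ifP => _; [exact: geq_minl|exact: dig_good.2].
Qed.
End Guess.

(** * Labellings and partitions *)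

Section PartitionValue.
Variables (n C : nat) (adj : rel 'I_n).
Hypotheses (adj_sym : symmetric adj) (adj_irr : irreflexive adj).

(** An edge comes from exactly two ordered pairs, which differ because [adj] is irreflexive. *)
Lemma card_edges_in (A : {set 'I_n}) :
  2 * #|edges_in adj A| = \sum_(x in A) \sum_(y in A) adj x y.
Proof.
pose S := [set p : 'I_n * 'I_n | [&& p.1 \in A, p.2 \in A & adj p.1 p.2]].
pose f (p : 'I_n * 'I_n) := [set p.1; p.2].
have eS : edges_in adj A = f @: S.
  apply/setP => E; apply/imset2P/imsetP.
    by move=> [x y hx]; rewrite inE => /andP[hy he] ->; exists (x, y); rewrite // inE hx hy.
  by move=> [[x y]]; rewrite inE => /and3P[hx hy he] ->; exists x y; rewrite // inE hy.
have -> : \sum_(x in A) \sum_(y in A) adj x y = \sum_(p in S) 1.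
  rewrite pair_big_dep /= [LHS]big_mkcond [RHS]big_mkcond /=; apply: eq_bigr => p _.
  by rewrite inE; case: (p.1 \in A); case: (p.2 \in A) => //=; case: (adj _ _).
rewrite (partition_big f (mem (f @: S))) /= => [|p hp]; last exact: imset_f.
rewrite eS mulnC -sum_nat_const; apply: eq_bigr => E /imsetP[[x y]].
rewrite inE /= => /and3P[hx hy he] ->.
have hxy : x != y by apply: contraTneq he => ->; rewrite adj_irr.
have -> : \sum_(p in S | f p == f (x, y)) 1 = \sum_(p in [set (x, y); (y, x)]) 1.
  apply: eq_bigl => [[a b]]; rewrite !inE /= /f /= !xpair_eqE.
  apply/andP/idP => [[/and3P[ha hb hab] /eqP e]|].
    have : a \in [set x; y] by rewrite -e !inE eqxx.
    have : b \in [set x; y] by rewrite -e !inE eqxx orbT.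
    have hne : a != b by apply: contraTneq hab => ->; rewrite adj_irr.
    rewrite !inE => /orP[/eqP hb1|/eqP hb1] /orP[/eqP ha1|/eqP ha1]; move: hne; rewrite ha1 hb1 ?eqxx ?orbT //.
  case/orP => /andP[/eqP -> /eqP ->]; first by rewrite hx hy he.
  by rewrite hx hy adj_sym he setUC.
by rewrite sum1_card cards2 xpair_eqE negb_and hxy.
Qed.

Lemma value_pblock (P : {set {set 'I_n}}) : partition P [set: 'I_n] ->
  2 * value adj P = \sum_v \sum_w (adj v w && (pblock P v == pblock P w)).
Proof.
move=> hP; have /and3P[/eqP hc ht h0] := hP.
rewrite /value big_distrr /=; under eq_bigr => A _ do rewrite card_edges_in.
have hA A x : A \in P -> x \in A -> pblock P x = A by move=> h1 h2; exact: def_pblock.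
transitivity (\sum_(A in P) \sum_(x in A) \sum_w (adj x w && (pblock P x == pblock P w))).
  apply: eq_bigr => A hAP; apply: eq_bigr => x hx.
  rewrite big_mkcond; apply: eq_bigr => w _ /=.
  rewrite eq_pblock ?hc ?inE // (hA A) //.
  by case: (w \in A); rewrite ?andbT ?andbF.
have := @big_trivIset _ _ 0 addn P (fun x => \sum_w (adj x w && (pblock P x == pblock P w))) ht.
rewrite /= hc => <-.
by apply: eq_bigl => x; rewrite inE.
Qed.

Lemma capacity_pblock (P : {set {set 'I_n}}) : partition P [set: 'I_n] ->
  [forall A in P, #|A| <= C] = [forall v, \sum_(w < n) (pblock P v == pblock P w) <= C].
Proof.
move=> hP; have /and3P[/eqP hc ht h0] := hP.
have hcard v : \sum_(w < n) (pblock P v == pblock P w) = #|pblock P v|.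
  rewrite -sum1_card [RHS]big_mkcond; apply: eq_bigr => w _.
  by rewrite eq_pblock ?hc ?inE //; case: ifP.
apply/forall_inP/forallP => h => [v|A hA]; first by rewrite hcard h // pblock_mem // hc inE.
have [x hx] : exists x, x \in A by apply/set0Pn; apply: contraNneq h0 => <-.
by have := h x; rewrite hcard (def_pblock ht hA hx).
Qed.

Lemma label_partitionP (o : seq nat) : partition (label_partition n o) [set: 'I_n].
Proof. exact: preim_partitionP. Qed.

Lemma label_pblock (o : seq nat) (v w : 'I_n) :
  (pblock (label_partition n o) v == pblock (label_partition n o) w) = (nth 0 o v == nth 0 o w).
Proof.
have hP := label_partitionP o; have /and3P[/eqP hc ht h0] := hP.
rewrite eq_pblock ?hc ?inE //.
rewrite /label_partition /preim_partition pblock_equivalence_partition ?inE //.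
by move=> x y z _ _ _ /=; split=> // /eqP ->.
Qed.

Lemma score_optimal (o : seq nat) (l : 'I_n -> nat) :
  (forall v : 'I_n, nth 0 o v = l v) -> 0 < score C adj l ->
  (forall l', score C adj l' <= score C adj l) ->
  optimal_partition adj C (label_partition n o).
Proof.
move=> ho hpos hmax; have hP := label_partitionP o.
have hf : feasible C l by move: hpos; rewrite /score; case: ifP.
have hval : 2 * value adj (label_partition n o) = agreement adj l.
  rewrite value_pblock //; apply: eq_bigr => v _; apply: eq_bigr => w _.
  by rewrite label_pblock !ho.
split.
  rewrite /capacity_partition hP capacity_pblock //=; apply/forallP => v.
  by under eq_bigr => w _ do rewrite label_pblock !ho; exact: (forallP hf).
move=> Q /andP[hQ hQC].
(* Numbering the blocks turns a competing partition into a labelling with the same classes. *)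
pose l' v : nat := enum_rank (pblock Q v).
have hl' v w : (l' v == l' w) = (pblock Q v == pblock Q w).
  by apply/eqP/eqP => [/val_inj /enum_rank_inj|/(congr1 (fun A => enum_rank A : nat))].
have hf' : feasible C l'.
  move: hQC; rewrite capacity_pblock // => /forallP h; apply/forallP => v.
  by rewrite /class_size; under eq_bigr => w _ do rewrite hl'; exact: h.
have := hmax l'; rewrite /score hf hf' ltnS -hval.
have -> : agreement adj l' = 2 * value adj Q.
  by rewrite value_pblock //; apply: eq_bigr => v _; apply: eq_bigr => w _; rewrite hl'.
by rewrite leq_pmul2l.
Qed.

Lemma score_infeasible :
  (forall l, score C adj l = 0) -> forall P : {set {set 'I_n}}, ~~ capacity_partition C P.
Proof.
move=> h Q; apply/negP => /andP[hQ hQC].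
pose l' v : nat := enum_rank (pblock Q v).
have hl' v w : (l' v == l' w) = (pblock Q v == pblock Q w).
  by apply/eqP/eqP => [/val_inj /enum_rank_inj|/(congr1 (fun A => enum_rank A : nat))].
have hf' : feasible C l'.
  move: hQC; rewrite capacity_pblock // => /forallP h'; apply/forallP => v.
  by rewrite /class_size; under eq_bigr => w _ do rewrite hl'; exact: h'.
by have := h l'; rewrite /score hf'.
Qed.
End PartitionValue.

(** * The algorithm *)

Arguments upd T f x v y /.

(* Arrays of the program.  N, N1 = N + 1, C, K, K2 = 2 K, BS = 2 K + 2: numbers of the
   instance and of the current parameter.  B, PH: base and upper bound of the guesses.
   PTR, ROW, ADJ: adjacency matrix.  INU: membership in U.  MARK: set grown from a vertex.
   COMP: representative of a component.  FOUND: a component is too large.  GS: digits of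
   the current guess.  DIG, NEW: current and tentative labels.  CODE, CR: type of a
   component and rank within its type.  BV, BEST: best score and labelling so far.
   DONE: a suitable U has been found. *)
Definition aN := 0. Definition aC := 1. Definition aN1 := 2. Definition aK := 3.
Definition aB := 4. Definition aPH := 5. Definition aDONE := 6. Definition aPTR := 7.
Definition aROW := 8. Definition aADJ := 9. Definition aINU := 10. Definition aMARK := 11.
Definition aCOMP := 12. Definition aFOUND := 13. Definition aGS := 14. Definition aX := 15.
Definition aDIG := 16. Definition aCODE := 17. Definition aCR := 18. Definition aNEW := 19.
Definition aBV := 20. Definition aBEST := 21. Definition aK2 := 22. Definition aBS := 23.

Definition Cell (j x : nat) : expr := Arr j (Loc x).
(* The machine has no multiplication. *)
Definition EMul (j : nat) (e : expr) : expr := Sum 8 (V j) e.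
Definition Adj (x y : nat) : expr := Arr aADJ (EAdd (Cell aROW x) (Loc y)).

(** The quotient is obtained by counting the [i] with [B (i + 1) <= X]; those below [PH] suffice
    when [X <= PH]. *)
Definition DivX : expr := Sum 9 (V aPH) (ENot (ELt (V aX) (EMul aB (EAdd (Loc 9) (Num 1))))).
Definition Decode (x : nat) : cmd :=
  Seq (Set_ aX (Num 0) (Loc x))
      (For 13 (V aPH) (Seq (Set_ aGS (Loc 13) (ESub (V aX) (EMul aB DivX))) (Set_ aX (Num 0) DivX))).

Definition Cand : expr :=
  EAnd (ENot (Cell aINU 2)) (EAnd (ENot (Cell aMARK 2))
    (Sum 4 (V aN) (EIf (Cell aMARK 4) (Adj 4 2) (Num 0)))).
(** If there is no candidate, the search returns [N] and the mark is set outside the vertex range,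
    which leaves the marked set as it is. *)
Definition Grow : cmd :=
  Seq (Tab aMARK 2 (V aN) (EEq (Loc 2) (Loc 1)))
      (For 3 (V aK) (Set_ aMARK (ELast 2 0 (V aN) (V aN) Cand) (Num 1))).
(** After the first oversized set nothing is grown any more, so [MARK] still holds that set when
    [Branch] reads it. The truncated difference makes [FOUND] nonzero exactly when more than [K]
    vertices are marked. *)
Definition Find : cmd :=
  Seq (Set_ aFOUND (Num 0) (Num 0))
  (For 1 (V aN) (If (Cell aINU 1) (Set_ aCOMP (Loc 1) (Loc 1))
    (If (V aFOUND) Skip
      (Seq Grow
      (Seq (Set_ aCOMP (Loc 1) (ELast 2 0 (V aN) (V aN) (Cell aMARK 2)))
           (Set_ aFOUND (Num 0) (ESub (Sum 2 (V aN) (Cell aMARK 2)) (V aK)))))))).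
Definition RankIn (j : nat) : expr := Sum 4 (V aN) (EIf (ELt (Loc 4) (Loc 2)) (Cell j 4) (Num 0)).
(** Digit [i] of the guess names, by its rank, the vertex of the oversized set added in round [i].
    The last [Find] checks the outcome and computes the components. *)
Definition Branch : cmd :=
  Seq (Tab aINU 2 (V aN) (Num 0))
  (Seq (For 5 (V aK) (Seq Find (If (V aFOUND)
      (Set_ aINU (ELast 2 0 (V aN) (V aN) (EAnd (Cell aMARK 2) (EEq (RankIn aMARK) (Cell aGS 5)))) (Num 1))
      Skip)))
   Find).

Definition SameComp (x y : nat) : expr := EEq (Cell aCOMP x) (Cell aCOMP y).
Definition RankC (x : nat) : expr := Sum 4 (V aN) (EAnd (ELt (Loc 4) (Loc x)) (SameComp 4 x)).
(** Outside [U] all vertices start as singletons, so the start is feasible whenever some labelling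
    with these labels on [U] is. *)
Definition InitDig : cmd :=
  Tab aDIG 2 (V aN) (EIf (Cell aINU 2) (Arr aGS (RankIn aINU)) (EAdd (V aK) (RankC 2))).

Definition Lab (a x : nat) : expr :=
  EIf (ELt (Cell a x) (V aK)) (Cell a x)
      (EAdd (EAdd (V aK) (Cell aCOMP x)) (Sum 7 (V aN) (Cell a x))).
Definition SameLab (a x y : nat) : expr := EEq (Lab a x) (Lab a y).
Definition Score (a : nat) : expr :=
  EIf (Sum 1 (V aN) (ELt (V aC) (Sum 2 (V aN) (SameLab a 1 2)))) (Num 0)
      (EAdd (Num 1) (Sum 1 (V aN) (Sum 2 (V aN) (EAnd (Adj 1 2) (SameLab a 1 2))))).

Definition Push (e : expr) : expr := EAdd (EMul aBS (Loc 0)) e.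
(** A left fold over a filtered list of vertices is run over all vertices, the accumulator being
    returned unchanged at those outside the filter. *)
Definition CodeExp : expr :=
  Fold 2 0 (V aN) (Num 1) (EIf (SameComp 2 1)
    (Fold 3 0 (V aN)
      (Fold 3 0 (V aN) (Push (Cell aDIG 2)) (EIf (SameComp 3 1) (Push (Adj 2 3)) (Loc 0)))
      (EIf (Cell aINU 3) (Push (Adj 2 3)) (Loc 0)))
    (Loc 0)).
Definition Codes : cmd := Tab aCODE 1 (V aN) CodeExp.
Definition Cranks : cmd :=
  Tab aCR 1 (V aN) (Sum 2 (V aN) (EAnd (ENot (Cell aINU 2)) (EAnd (EEq (Cell aCOMP 2) (Loc 2))
    (EAnd (ELt (Loc 2) (Cell aCOMP 1)) (EEq (Cell aCODE 2) (Cell aCODE 1)))))).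
Definition Slot : expr := EAdd (Cell aCODE 1) (EMul aB (EAdd (Cell aCR 1) (EMul aB (RankC 1)))).
(* [K2 - (K2 - x)] is the minimum of [K2] and [x]. *)
Definition NewDig : cmd :=
  Tab aNEW 1 (V aN) (EIf (Cell aINU 1) (Cell aDIG 1) (EIf (ELt (Cell aCR 1) (V aB))
    (ESub (V aK2) (ESub (V aK2) (Arr aGS Slot))) (Cell aDIG 1))).
Definition Attempt : cmd :=
  Seq (Decode 12) (Seq Codes (Seq Cranks (Seq NewDig
    (If (ELt (Score aDIG) (Score aNEW)) (Tab aDIG 2 (V aN) (Cell aNEW 2)) Skip)))).
(** Nesting two loops yields [(N + 1)^2] rounds with read-only scalars as bounds. *)
Definition Local_search : cmd :=
  For 10 (V aN1) (For 11 (V aN1) (For 12 (V aPH) Attempt)).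
Definition Update : cmd :=
  If (ELt (V aBV) (Score aDIG))
    (Seq (Set_ aBV (Num 0) (Score aDIG)) (Tab aBEST 1 (V aN) (Lab aDIG 1))) Skip.
Definition Solve : cmd :=
  Seq (Set_ aDONE (Num 0) (Num 1))
      (For 6 (V aPH) (Seq (Decode 6) (Seq InitDig (Seq Local_search Update)))).
(** All guesses share the array [GS]: [Branch] uses its digits before [Solve] decodes others, and
    [InitDig] does so before [Local_search]. *)
Definition Body : cmd :=
  For 14 (V aPH) (Seq (Decode 14) (Seq Branch (If (V aFOUND) Skip Solve))).

Definition limits : seq nat := [:: aN; aN1; aK; aB; aPH; aBS].
Lemma Body_ok : cok limits Body. Proof. by []. Qed.

Definition const_arrays : seq nat := [:: aN; aC; aN1; aK; aB; aPH; aROW; aADJ; aK2; aBS].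
Lemma eval_Sum rho m x lim e :
  eval rho m (Sum x lim e) = \sum_(i < eval rho m lim) eval (upd rho x i) m e.
Proof. by []. Qed.

(** * Evaluation of the score by the program *)

Section Specs.
Variables (n C k B PH : nat) (adj : rel 'I_n).

Record consts (st : state) : Prop := Consts {
  c_N : cells st aN 0 = n;
  c_N1 : cells st aN1 0 = n.+1;
  c_C : cells st aC 0 = C;
  c_K : cells st aK 0 = k;
  c_B : cells st aB 0 = B;
  c_PH : cells st aPH 0 = PH;
  c_K2 : cells st aK2 0 = k.*2;
  c_BS : cells st aBS 0 = k.*2 + 2;
  c_adj : forall x y : 'I_n, cells st aADJ (cells st aROW x + y) = adj x y
}.

Lemma consts_frame rho c st :
  all (fun j => j \notin writes c) const_arrays -> consts st -> consts (run rho c st).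
Proof.
move=> /allP h [h1 h2 h3 h4 h5 h6 h7 h8 h9].
by split; rewrite ?run_frame //; try exact: h; move=> x y; rewrite !run_frame //; exact: h.
Qed.

Definition labA (st : state) (a : nat) (v : 'I_n) : nat :=
  if cells st a v < k then cells st a v else k + cells st aCOMP v + n * cells st a v.

Lemma eval_Lab st (rho : nat -> nat) a (x : nat) (i : 'I_n) : consts st -> x != 7 -> rho x = i ->
  eval rho (cells st) (Lab a x) = labA st a i.
Proof.
move=> h hx hi; rewrite /= hi c_K // if_lt /labA; case: ltnP => //= _.
by rewrite c_N // (negbTE hx) sum_nat_const card_ord.
Qed.

Lemma eval_SameLab st (rho : nat -> nat) a (x y : nat) (i j : 'I_n) : consts st -> x != 7 -> y != 7 ->
  rho x = i -> rho y = j ->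
  eval rho (cells st) (SameLab a x y) = (labA st a i == labA st a j).
Proof.
move=> h hx hy hi hj; rewrite -(eval_Lab a h hx hi) -(eval_Lab a h hy hj); exact: if_eq.
Qed.

Lemma eval_Score st rho a : consts st -> eval rho (cells st) (Score a) = score C adj (labA st a).
Proof.
move=> h.
have h1 : eval rho (cells st) (Sum 1 (V aN) (ELt (V aC) (Sum 2 (V aN) (SameLab a 1 2)))) =
    \sum_(i < n) (C < class_size (labA st a) i).
  rewrite eval_Sum /V /= c_N //; apply: eq_bigr => i _; rewrite if_lt c_C //; congr (nat_of_bool (_ < _)).
  apply: eq_bigr => j _; have := @eval_SameLab _ (upd (upd rho 1 i) 2 j) a 1 2 i j h isT isT erefl erefl.
  by rewrite /= c_N.
have h2 : eval rho (cells st) (Sum 1 (V aN) (Sum 2 (V aN) (EAnd (Adj 1 2) (SameLab a 1 2)))) =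
    agreement adj (labA st a).
  rewrite eval_Sum /V /= c_N //; apply: eq_bigr => i _; apply: eq_bigr => j _.
  have := @eval_SameLab _ (upd (upd rho 1 i) 2 j) a 1 2 i j h isT isT erefl erefl.
  by rewrite /= c_N // c_adj // => ->; case: (adj i j).
rewrite /score /feasible /Score.
transitivity (if \sum_(i < n) (C < class_size (labA st a) i) == 0 then
      1 + agreement adj (labA st a) else 0); first by rewrite -h1 -h2 /=; case: ifP.
rewrite sum_nat_eq0 add1n; congr (if _ then _ else _).
by apply: eq_forallb => i; rewrite /= eqb0 -leqNgt.
Qed.
End Specs.

(** * Correctness of the local search *)

Lemma leq_cube B : 0 < B -> B <= B ^ 3.
Proof. by move=> h; rewrite -{1}(expn1 B) leq_pexp2l. Qed.

(** [Decode] writes the first [PH] digits of a guess; these include all [B^3] slots. *)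
Lemma ltn_slots B PH i : 0 < B -> B ^ (B ^ 3) <= PH -> i < B ^ 3 -> i < PH.
Proof.
move=> hB hPH h; apply: leq_trans hPH; apply: leq_trans h _.
case: (leqP B 1) => hB1; last exact: ltnW (ltn_expl _ hB1).
by have -> : B = 1 by lia.
Qed.

Lemma enum_set_filter n (S : {set 'I_n}) : enum S = [seq x <- enum 'I_n | x \in S].
Proof. by rewrite /enum_mem -filter_predI; apply: eq_filter => x /=; rewrite andbT. Qed.

Lemma eq_foldl (T : Type) (F G : nat -> T -> nat) a0 s :
  (forall a i, F a i = G a i) -> foldl F a0 s = foldl G a0 s.
Proof. by move=> h; elim: s a0 => //= i s IH a0; rewrite h IH. Qed.

Lemma foldl_seq_map (S T : Type) (f : S -> T) (F : nat -> T -> nat) a0 s :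
  foldl F a0 [seq f i | i <- s] = foldl (fun a i => F a (f i)) a0 s.
Proof. by elim: s a0 => //= i s IH a0; rewrite IH. Qed.

Lemma foldl_flatten (T : Type) (F : nat -> T -> nat) a0 ss :
  foldl F a0 (flatten ss) = foldl (fun a s => foldl F a s) a0 ss.
Proof. by elim: ss a0 => //= s ss IH a0; rewrite foldl_cat IH. Qed.

Lemma iteri_enum (F : nat -> nat -> nat) a0 m :
  iteri m F a0 = foldl (fun a (i : 'I_m) => F i a) a0 (enum 'I_m).
Proof.
rewrite -(foldl_seq_map val (fun a i => F i a)) val_enum_ord.
by elim: m => // m IH; rewrite -[in RHS]addn1 iotaD foldl_cat -IH.
Qed.

Lemma foldl_if (T : Type) (p : pred T) (F : nat -> T -> nat) a0 s :
  foldl (fun a i => if p i then F a i else a) a0 s = foldl F a0 [seq i <- s | p i].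
Proof. by elim: s a0 => //= i s IH a0; rewrite IH; case: (p i). Qed.

Lemma guess_exists (B G PH : nat) (g : nat -> nat) :
  (forall i, g i < B) -> B ^ G <= PH ->
  exists2 x, x < PH & forall i, i < G -> (x %/ B ^ i) %% B = g i.
Proof.
move=> hg hPH; have hB : 0 < B by exact: leq_ltn_trans (leq0n _) (hg 0).
suff [x hx h] : exists2 x, x < B ^ G & forall i, i < G -> (x %/ B ^ i) %% B = g i.
  by exists x => //; apply: leq_trans hPH.
elim: G g hg {hPH} => [|G IH] g hg; first by exists 0.
have [x hx h] := IH (fun i => g i.+1) (fun i => hg i.+1).
exists (x * B + g 0).
  by have := hg 0; rewrite expnS; nia.
case=> [|i] hi; first by rewrite expn0 divn1 modnMDl modn_small.
by rewrite expnS divnMA divnMDl // (divn_small (hg 0)) addn0 h.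
Qed.

Section Specs.
Variables (n C k B PH : nat) (adj : rel 'I_n).
Hypothesis B_gt0 : 0 < B.

Local Notation consts := (consts C k B PH adj).
Local Notation consts_frame := (@consts_frame n C k B PH adj).

Lemma eval_EMul_B st rho e : consts st -> eval rho (cells st) (EMul aB e) =
  \sum_(i < B) eval (upd rho 8 i) (cells st) e.
Proof. by move=> h; rewrite eval_Sum /V /= (c_B h). Qed.

Lemma eval_DivX st rho : consts st -> cells st aX 0 <= PH ->
  eval rho (cells st) DivX = cells st aX 0 %/ B.
Proof.
move=> h hx; rewrite /DivX eval_Sum.
transitivity (\sum_(i < PH) (i < cells st aX 0 %/ B : nat)).
  rewrite /V /= (c_PH h); apply: eq_bigr => i _; rewrite if_lt if_not (c_B h).
  by rewrite -leqNgt sum_nat_const card_ord addn1 leq_divRL // mulnC.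
have : cells st aX 0 %/ B <= PH by apply: leq_trans (leq_div _ _) hx.
elim: PH (_ %/ _) => [|m IH] q hq; first by rewrite big_ord0; case: q hq.
rewrite big_ord_recr /=; case: (ltnP m q) => hm.
  have -> : q = m.+1 by lia.
  rewrite -[RHS]addn1; congr (_ + _).
  transitivity (\sum_(i < m) 1); last by rewrite sum_nat_const card_ord muln1.
  by apply: eq_bigr => i _; rewrite ltnS ltnW.
by rewrite IH // addn0.
Qed.

Lemma run_Decode st rho x : consts st -> rho x <= PH ->
  forall i, i < PH -> cells (run rho (Decode x) st) aGS i = (rho x %/ B ^ i) %% B.
Proof.
move=> h hx; rewrite /Decode run_Seq; set st1 := run _ _ st.
have h1 : consts st1 by exact: consts_frame.
have e1 : cells st1 aX 0 = rho x by [].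
set body := Seq _ _.
have := @run_For_ind (fun j s => [/\ consts s, cells s aX 0 = rho x %/ B ^ j &
   forall i, i < j -> cells s aGS i = (rho x %/ B ^ i) %% B]) rho 13 (V aPH) body st1 PH (c_PH h1); case.
- by split=> //; rewrite e1 expn0 divn1.
- move=> j s hj [hc hX hG].
  have hX' : cells s aX 0 <= PH by rewrite hX; apply: leq_trans (leq_div _ _) hx.
  set s1 := run (upd rho 13 j) (Set_ aGS (Loc 13) (ESub (V aX) (EMul aB DivX))) s.
  have hc1 : consts s1 by apply: consts_frame.
  have eX1 : cells s1 aX = cells s aX by apply: run_frame.
  have -> : run (upd rho 13 j) body s = run (upd rho 13 j) (Set_ aX (Num 0) DivX) s1 by [].
  set s2 := run _ _ s1.
  have eD : cells s2 aX 0 = cells s aX 0 %/ B.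
    by rewrite -eX1 -(@eval_DivX s1 (upd rho 13 j)) // eX1.
  have eG i : cells s2 aGS i = if i == j then cells s aX 0 %% B else cells s aGS i.
    have -> : cells s2 aGS = cells s1 aGS by apply: run_frame.
    rewrite /s1 run_Set [eval _ _ (Loc 13)]/=; case: eqP => // _.
    rewrite eval_ESub eval_EMul_B // (eq_bigr (fun=> cells s aX 0 %/ B)) => [|i' _].
      rewrite sum_nat_const card_ord mulnC -[eval _ _ (V aX)]/(cells s aX 0).
      by rewrite [X in X - _](divn_eq _ B) addKn.
    exact: eval_DivX.
  split.
  + exact: consts_frame.
  + by rewrite eD hX expnSr divnMA.
  + move=> i; rewrite ltnS leq_eqVlt eG => /predU1P[->|hi]; first by rewrite eqxx hX.
    by rewrite ltn_eqF // hG.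
by move=> _ _ hG i hi; exact: hG.
Qed.

Section Geometry.
Variables (U : {set 'I_n}) (rp : 'I_n -> 'I_n).
Hypotheses (adj_sym : symmetric adj).
Hypotheses (rpU : forall v, (rp v \in U) = (v \in U)) (rpK : forall v, rp (rp v) = rp v)
  (rp_adj : forall v w, v \notin U -> w \notin U -> adj v w -> rp v = rp w)
  (rp_size : forall v, v \notin U -> \sum_(w < n) (rp w == rp v) <= k)
  (U_size : #|U| <= k).
Hypotheses (kB : k.*2 < B) (B_pieces : piece_bound k k <= B)
  (B_codes : 2 * (k.*2 + 2) ^ (k * (k.*2.+1)) <= B) (PH_big : B ^ (B ^ 3) <= PH).

Record geometry (st : state) : Prop := Geometry {
  g_consts : consts st;
  g_INU : forall v : 'I_n, cells st aINU v = (v \in U);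
  g_COMP : forall v : 'I_n, cells st aCOMP v = rp v
}.

Lemma geometry_frame rho c st :
  all (fun j => j \notin writes c) [:: aINU, aCOMP & const_arrays] ->
  geometry st -> geometry (run rho c st).
Proof.
case/and3P=> h1 h2 h3 [g1 g2 g3]; split; first exact: consts_frame.
- by move=> v; rewrite run_frame.
- by move=> v; rewrite run_frame.
Qed.

Definition digits (st : state) (a : nat) (v : 'I_n) : nat := cells st a v.

Lemma labA_labf st a : geometry st -> forall v, labA k st a v = labf k rp (digits st a) v.
Proof. by move=> h v; rewrite /labA /labf /digits g_COMP. Qed.

Lemma eval_score_digits st rho a : geometry st ->
  eval rho (cells st) (Score a) = score C adj (labf k rp (digits st a)).
Proof.
move=> h; rewrite (eval_Score _ _ (g_consts h)).
by apply: score_eq => v w; rewrite !labA_labf.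
Qed.

Lemma eval_RankC st (rho : nat -> nat) (x : nat) (v : 'I_n) : geometry st -> x != 4 -> rho x = v ->
  eval rho (cells st) (RankC x) = rank rp v.
Proof.
move=> h hx hv; rewrite rankE /RankC eval_Sum /V /= (c_N (g_consts h)); apply: eq_bigr => w _.
by rewrite (negbTE hx) hv if_lt if_eq if_and !g_COMP.
Qed.

Lemma run_Codes st rho (v : 'I_n) : geometry st ->
  cells (run rho Codes st) aCODE v = code k adj U rp (digits st aDIG) v.
Proof.
move=> h; have hc := g_consts h.
rewrite /Codes run_Tab_lt //; last by rewrite /= (c_N hc).
set b := k.*2 + 2; pose step a x := b * a + x.
rewrite /CodeExp /= (c_N hc) iteri_enum /code /horner /items -/b foldl_flatten foldl_seq_map.
rewrite /cl -foldl_if; apply: eq_foldl => a w.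
rewrite if_eq !g_COMP // (inj_eq val_inj) eqb0; case: (rp w == rp v) => //=.
have hpush c x : \sum_(i < cells st aBS 0) c + x = step c x.
  by rewrite sum_nat_const card_ord (c_BS hc) /step mulnC.
rewrite !iteri_enum foldl_cat !foldl_seq_map hpush.
rewrite enum_set_filter -!foldl_if.
set A := (X in foldl _ X _ = _); set A' := (X in _ = foldl _ X _).
have -> : A = A'.
  apply: eq_foldl => c u.
  by rewrite if_eq !g_COMP // (inj_eq val_inj) eqb0 if_neg (c_adj hc) hpush.
by apply: eq_foldl => c u; rewrite g_INU // eqb0 if_neg (c_adj hc) hpush.
Qed.

Lemma run_Cranks st rho (cd : 'I_n -> nat) (v : 'I_n) : geometry st ->
  (forall w : 'I_n, cells st aCODE w = cd w) ->
  (forall w : 'I_n, cd (rp w) = cd w) ->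
  cells (run rho Cranks st) aCR v = crank U rp cd (rp v).
Proof.
move=> h hcd hrp; have hc := g_consts h.
rewrite /Cranks run_Tab_lt //; last by rewrite /= (c_N hc).
rewrite /= (c_N hc); apply: eq_bigr => w _.
by rewrite g_INU // if_not if_eq if_lt if_eq !g_COMP // !hcd !if_and (inj_eq val_inj) hrp.
Qed.

Lemma run_NewDig st rho (v : 'I_n) : geometry st ->
  (forall w : 'I_n, cells st aCODE w = code k adj U rp (digits st aDIG) w) ->
  (forall w : 'I_n, cells st aCR w = crank U rp (code k adj U rp (digits st aDIG)) (rp w)) ->
  cells (run rho NewDig st) aNEW v = newdig k adj U rp (digits st aDIG) B (cells st aGS) v.
Proof.
move=> h hcd hcr; have hc := g_consts h.
rewrite /NewDig run_Tab_lt //; last by rewrite /= (c_N hc).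
have hslot : eval (upd rho 1 v) (cells st) Slot = slot k adj U rp (digits st aDIG) B v.
  rewrite /Slot /slot -hcr -hcd.
  transitivity (cells st aCODE v + eval (upd rho 1 v) (cells st) (EMul aB (EAdd (Cell aCR 1) (EMul aB (RankC 1))))).
    by [].
  rewrite (eval_EMul_B _ _ hc).
  rewrite (eq_bigr (fun=> cells st aCR v + B * rank rp v)) ?sum_nat_const ?card_ord // => i _.
  transitivity (cells st aCR v + eval (upd (upd rho 1 v) 8 i) (cells st) (EMul aB (RankC 1))).
    by [].
  rewrite (eval_EMul_B _ _ hc).
  rewrite (eq_bigr (fun=> rank rp v)) ?sum_nat_const ?card_ord // => j _.
  exact: eval_RankC.
rewrite /newdig -hcr.
transitivity (if cells st aINU v == 0 then
  if (cells st aCR v < B : nat) == 0 then cells st aDIG v else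
   k.*2 - (k.*2 - cells st aGS (eval (upd rho 1 v) (cells st) Slot)) else cells st aDIG v).
  by rewrite -if_lt -{1}(c_B hc) -!(c_K2 hc).
rewrite (g_INU h) !eqb0 !if_neg hslot minnE.
by [].
Qed.
Definition fit (st : state) (a : nat) : nat := score C adj (labf k rp (digits st a)).

Lemma run_Attempt st rho : geometry st -> rho 12 <= PH ->
  exists2 gs : nat -> nat, forall i, i < PH -> gs i = (rho 12 %/ B ^ i) %% B &
  let N := newdig k adj U rp (digits st aDIG) B gs in
  let st' := run rho Attempt st in
  if fit st aDIG < score C adj (labf k rp N)
  then (forall v, digits st' aDIG v = N v) else cells st' aDIG = cells st aDIG.
Proof.
move=> h hx; set st1 := run rho (Decode 12) st; exists (cells st1 aGS).
  exact: run_Decode (g_consts h) hx.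
rewrite /Attempt run_Seq -/st1 run_Seq; set st2 := run rho Codes st1.
rewrite run_Seq; set st3 := run rho Cranks st2; rewrite run_Seq; set st4 := run rho NewDig st3.
have h1 : geometry st1 by exact: geometry_frame.
have h2 : geometry st2 by exact: geometry_frame.
have h3 : geometry st3 by exact: geometry_frame.
have h4 : geometry st4 by exact: geometry_frame.
have d1 : cells st1 aDIG = cells st aDIG by apply: run_frame.
have d2 : cells st2 aDIG = cells st aDIG by rewrite -d1; apply: run_frame.
have d3 : cells st3 aDIG = cells st aDIG by rewrite -d2; apply: run_frame.
have d4 : cells st4 aDIG = cells st aDIG by rewrite -d3; apply: run_frame.
have dE s : cells s aDIG = cells st aDIG -> digits s aDIG = digits st aDIG by rewrite /digits => ->.
have gsE : cells st3 aGS = cells st1 aGS.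
  by transitivity (cells st2 aGS); apply: run_frame.
set N := newdig _ _ _ _ _ _ _.
have c2 (w : 'I_n) : cells st2 aCODE w = code k adj U rp (digits st aDIG) w.
  by rewrite run_Codes // dE.
have c3 (w : 'I_n) : cells st3 aCODE w = code k adj U rp (digits st aDIG) w.
  by rewrite -c2 /st3 run_frame.
have r3 (w : 'I_n) : cells st3 aCR w = crank U rp (code k adj U rp (digits st aDIG)) (rp w).
  apply: run_Cranks => // w'; by rewrite /code rpK.
have n4 (w : 'I_n) : cells st4 aNEW w = N w.
  by rewrite run_NewDig // dE // gsE.
have f4 : fit st4 aNEW = score C adj (labf k rp N).
  by apply: score_eq => v w; rewrite /labf /digits !n4.
rewrite -f4; have -> : fit st aDIG = fit st4 aDIG by rewrite /fit dE.
have -> (c1 c2' : cmd) : run rho (If (ELt (Score aDIG) (Score aNEW)) c1 c2') st4 =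
   if fit st4 aDIG < fit st4 aNEW then run rho c1 st4 else run rho c2' st4.
  rewrite /fit -!(eval_score_digits rho) //.
  transitivity (if ((eval rho (cells st4) (Score aDIG) < eval rho (cells st4) (Score aNEW)) : nat) == 0
    then run rho c2' st4 else run rho c1 st4); last by case: ltnP.
  by rewrite -if_lt.
case: (fit st4 aDIG < fit st4 aNEW); last exact: d4.
move=> v.
rewrite /digits run_Tab_lt ?n4 //; last by rewrite /= (c_N (g_consts h4)).
by rewrite /= n4.
Qed.
Definition searching (t : 'I_n -> nat) (st : state) : Prop :=
  [/\ geometry st, good k U (digits st aDIG), forall u, u \in U -> t u = digits st aDIG u &
     0 < fit st aDIG].

Lemma run_round t st rho : good k U t -> searching t st ->
  let st' := run rho (For 12 (V aPH) Attempt) st in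
  searching t st' /\ (fit st aDIG < score C adj (labf k rp t) -> fit st aDIG < fit st' aDIG) /\
  fit st aDIG <= fit st' aDIG.
Proof.
move=> ht hs; have [h hg hU hpos] := hs.
pose T := score C adj (labf k rp t).
have [y hy] : exists2 y, y < PH & fit st aDIG < T ->
    forall gs : nat -> nat, (forall i, i < PH -> gs i = (y %/ B ^ i) %% B) ->
      fit st aDIG < score C adj (labf k rp (newdig k adj U rp (digits st aDIG) B gs)).
  case: (ltnP (fit st aDIG) T) => hT; last first.
    by exists 0 => //; apply: (ltn_slots B_gt0 PH_big); rewrite expn_gt0 B_gt0.
  have [g hgb hgi] := guess_improvement adj_sym rpU rpK rp_adj rp_size U_size hg
    (leq_trans (leq_addr _ _) (etrans (congr1 (leq^~ B) (addnn k)) (ltnW kB)))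
    B_pieces B_codes ht hU hpos hT.
  have [y hy1 hy2] := @guess_exists B (B ^ 3) PH g (fun i => leq_ltn_trans (hgb i) kB) PH_big.
  exists y => // _ gs hgs; apply: hgi => i hi; rewrite hgs ?hy2 //; exact: (ltn_slots B_gt0 PH_big).
move=> himp.
(* The guess [y] is tailored to the labels at the start of the round. Either the score has already
   risen, or the labels are untouched and, below the target, [y] is still to come; at the end of the
   loop the latter is impossible. *)
have := @run_For_ind (fun j s => [/\ searching t s, fit st aDIG <= fit s aDIG &
   fit st aDIG < fit s aDIG \/ cells s aDIG = cells st aDIG /\ (fit st aDIG < T -> j <= y)])
   rho 12 (V aPH) Attempt st PH (c_PH (g_consts h)).
case.
- by split=> //; right; split.
- move=> j s hj [[s1 s2 s3 s4] hle hor].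
  have [gs hgs] := run_Attempt (rho := upd rho 12 j) s1 (ltnW hj).
  have s1' : geometry (run (upd rho 12 j) Attempt s) by exact: geometry_frame.
  cbv zeta; case: ifP => [hlt hd|hlt hd]; last first.
    have ed : digits (run (upd rho 12 j) Attempt s) aDIG = digits s aDIG by rewrite /digits hd.
    have ef : fit (run (upd rho 12 j) Attempt s) aDIG = fit s aDIG by rewrite /fit ed.
    rewrite ef hd; split=> //; first by split=> //; rewrite ?ed // ef.
    case: hor => [hh|[em hy']]; first by left.
    right; split=> // hT; have := hy' hT; rewrite leq_eqVlt => /predU1P[ejy|//].
    move: hlt; have <- : digits st aDIG = digits s aDIG by rewrite /digits em.
    have -> : fit s aDIG = fit st aDIG by rewrite /fit /digits em.
    by rewrite himp // => i hi; rewrite hgs //= ejy.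
  have ef : fit (run (upd rho 12 j) Attempt s) aDIG =
      score C adj (labf k rp (newdig k adj U rp (digits s aDIG) B gs)).
    by apply: score_eq => v w; rewrite /labf !hd.
  rewrite -ef in hlt.
  have hlt2 : fit st aDIG < fit (run (upd rho 12 j) Attempt s) aDIG by exact: leq_ltn_trans hlt.
  split; [|exact: ltnW|by left].
  have [n1 n2] := newdig_good adj rp B s2 gs.
  split=> //.
  + by split=> [u hu|v]; rewrite hd; [exact: n1|exact: n2].
  + by move=> u hu; rewrite hd /newdig hu s3.
  + exact: leq_ltn_trans hlt2.
move=> s1 hle hor; split=> //; split=> // hT.
by case: hor => // [[_ /(_ hT)]]; rewrite leqNgt hy.
Qed.
Lemma score_le l : score C adj l <= (n * n).+1.
Proof.
rewrite /score; case: ifP => // _; rewrite ltnS.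
apply: leq_trans (_ : \sum_(v < n) n <= _); last by rewrite sum_nat_const card_ord.
apply: leq_sum => v _; apply: leq_trans (_ : \sum_(w < n) 1 <= _).
  by apply: leq_sum => w _; case: (_ && _).
by rewrite sum_nat_const card_ord muln1.
Qed.

Lemma run_Local_search t st rho : good k U t -> searching t st ->
  score C adj (labf k rp t) <= fit (run rho Local_search st) aDIG.
Proof.
move=> ht hs; set T := score _ _ _; have hc := g_consts (let: And4 h _ _ _ := hs in h).
have [] := @run_For_ind (fun i s => searching t s /\ (T <= fit s aDIG \/ i * n.+1 <= fit s aDIG))
  rho 10 (V aN1) (For 11 (V aN1) (For 12 (V aPH) Attempt)) st n.+1 (c_N1 hc).
- by split=> //; right.
- move=> i s _ [s1 hor]; have hcs := g_consts (let: And4 h _ _ _ := s1 in h).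
  rewrite mulSn addnC.
  apply: (@run_For_ind (fun j s => searching t s /\ (T <= fit s aDIG \/ i * n.+1 + j <= fit s aDIG))
    (upd rho 10 i) 11 (V aN1) (For 12 (V aPH) Attempt) s n.+1 (c_N1 hcs)); first by rewrite addn0.
  move=> j s' _ [s1' hor']; have [r1 [r2 r3]] := run_round (upd (upd rho 10 i) 11 j) ht s1'.
  split=> //; case: (ltnP (fit s' aDIG) T) => hT; last by left; apply: leq_trans hT r3.
  by have := r2 hT; case: hor' => h; [left|right]; lia.
(* One unit of gain per round would lead to [(n + 1)^2], which is at least the maximal score
   [n^2 + 1]. *)
by move=> _ []; rewrite -/T // => h; have := score_le (labf k rp t); rewrite -/T /Local_search; nia.
Qed.

Lemma run_InitDig st rho (v : 'I_n) : geometry st ->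
  digits (run rho InitDig st) aDIG v =
  if v \in U then cells st aGS (index v (enum U)) else k + rank rp v.
Proof.
move=> h; have hc := g_consts h.
rewrite /digits /InitDig run_Tab_lt //; last by rewrite /= (c_N hc).
transitivity (if cells st aINU v == 0 then k + eval (upd rho 2 v) (cells st) (RankC 2)
   else cells st aGS (eval (upd rho 2 v) (cells st) (RankIn aINU))).
  by rewrite -(c_K hc).
rewrite (g_INU h) eqb0 if_neg (@eval_RankC st (upd rho 2 v) 2 v h isT erefl).
case: ifP => hv //; congr (cells st aGS _).
rewrite enum_set_filter index_filter_enum // /RankIn eval_Sum /V /= (c_N hc); apply: eq_bigr => w _.
by rewrite if_lt (g_INU h) if_and.
Qed.

(** [BV = 0] stands for the absence of a feasible labelling so far, in which case [BEST] carries no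
    information. *)
Definition sound (st : state) : Prop :=
  0 < cells st aBV 0 -> cells st aBV 0 = score C adj (fun v : 'I_n => cells st aBEST v).

Lemma run_Update st rho : geometry st -> sound st ->
  sound (run rho Update st) /\ cells (run rho Update st) aBV 0 = maxn (cells st aBV 0) (fit st aDIG).
Proof.
move=> h hs; have hc := g_consts h.
have -> : run rho Update st = if cells st aBV 0 < fit st aDIG then
    run rho (Tab aBEST 1 (V aN) (Lab aDIG 1)) (run rho (Set_ aBV (Num 0) (Score aDIG)) st) else st.
  rewrite /fit -(eval_score_digits rho) //.
  transitivity (if ((cells st aBV 0 < eval rho (cells st) (Score aDIG)) : nat) == 0 then st else
     run rho (Tab aBEST 1 (V aN) (Lab aDIG 1)) (run rho (Set_ aBV (Num 0) (Score aDIG)) st)).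
    by rewrite -if_lt.
  by case: ltnP.
case: ltnP => hlt; last by split.
set st1 := run rho (Set_ _ _ _) st; set st2 := run rho _ st1.
have h1 : geometry st1 by exact: geometry_frame.
have e1 : cells st1 aBV 0 = fit st aDIG by rewrite /st1 run_Set eqxx eval_score_digits.
have e2 : cells st2 aBV 0 = fit st aDIG by rewrite /st2 run_frame.
split; last exact: e2.
move=> _; rewrite e2; apply: score_eq => v w.
have hb (x : 'I_n) : cells st2 aBEST x = labf k rp (digits st aDIG) x.
  rewrite /st2 run_Tab_lt //; last by rewrite -[eval _ _ _]/(cells st1 aN 0) (c_N (g_consts h1)).
  rewrite (@eval_Lab n C k B PH adj st1 (upd rho 1 x) aDIG 1 x (g_consts h1) isT erefl) (labA_labf _ h1).
  by rewrite /labf /digits [cells st1 aDIG](run_frame).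
by rewrite !hb.
Qed.

Lemma rank_inj v w : rp v = rp w -> rank rp v = rank rp w -> v = w.
Proof.
move=> e h; have := congr1 (fun i => nth v (cl rp (rp v)) i) h.
by rewrite /rank nth_index ?mem_cl // e nth_index ?mem_cl.
Qed.

(** A competitor [l] is refined to a [good] labelling [d]. One of the guesses agrees with [d] on
    [U], and the local search started from it reaches at least the score of [d]. *)
Lemma run_Solve l st rho : geometry st -> sound st ->
  let st' := run rho Solve st in
  [/\ geometry st', sound st', cells st' aDONE 0 = 1 & score C adj l <= cells st' aBV 0].
Proof.
move=> h hs; rewrite /Solve run_Seq; set st1 := run rho (Set_ _ _ _) st.
have h1 : geometry st1 by exact: geometry_frame.
have s1 : sound st1 by [].
have d1 : cells st1 aDONE 0 = 1 by [].
have [d [dU dk] hd] := refine_labels C rp_adj rp_size U_size l.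
have [u0 hu0] : exists u0 : nat -> nat, forall u, u \in U -> u0 (index u (enum U)) = d u.
  exists (fun i => if [pick u in U | index u (enum U) == i] is Some u then d u else 0) => u hu.
  case: pickP => [u' /andP[hu' /eqP e]|/(_ u)]; last by rewrite hu eqxx.
  congr d; have := congr1 (nth u (enum U)) e; by rewrite !nth_index ?mem_enum.
(* The cap keeps the digits below [B]; at the positions of [U] it changes nothing because [d] is at
   most [2k]. *)
pose g i := if i < k then minn k.*2 (u0 i) else 0.
have [|z hz1 hz2] := @guess_exists B (B ^ 3) PH g _ PH_big.
  by move=> i; rewrite /g; case: ifP => // _; apply: leq_ltn_trans kB; exact: geq_minl.
set body := Seq _ _.
have := @run_For_ind (fun j s => [/\ geometry s, sound s, cells s aDONE 0 = 1 &
   z < j -> score C adj l <= cells s aBV 0]) rho 6 (V aPH) body st1 PH (c_PH (g_consts h1)).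
case; [by [] | | by move=> r1 r2 r3 r4; split=> //; exact: r4].
move=> j s hj [r1 r2 r3 r4]; rewrite /body !run_Seq.
set rho' := upd rho 6 j.
set sa := run rho' (Decode 6) s; set sb := run rho' InitDig sa; set sc := run rho' Local_search sb.
have ga : geometry sa by exact: geometry_frame.
have gb : geometry sb by exact: geometry_frame.
have gc : geometry sc by exact: geometry_frame.
have ec : cells sc aBV = cells s aBV.
  by transitivity (cells sb aBV); [|transitivity (cells sa aBV)]; apply: run_frame.
have eb : cells sc aBEST = cells s aBEST.
  by transitivity (cells sb aBEST); [|transitivity (cells sa aBEST)]; apply: run_frame.
have ed : cells sc aDONE = cells s aDONE.
  by transitivity (cells sb aDONE); [|transitivity (cells sa aDONE)]; apply: run_frame.
have [|u1 u2] := @run_Update sc rho' gc; first by rewrite /sound ec eb.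
split=> //; first exact: geometry_frame.
  by rewrite [cells (run _ _ _) _](run_frame) // ed.
rewrite u2 ec ltnS leq_eqVlt => /predU1P[ez|hz]; last by apply: leq_trans (r4 hz) _; exact: leq_maxl.
apply: leq_trans (leq_maxr _ _); case: (posnP (score C adj l)) => [->//|hlpos].
apply: leq_trans (hd) _; apply: (run_Local_search (t := d)) => //.
have hgs : forall i, i < B ^ 3 -> cells sa aGS i = g i.
  move=> i hi; rewrite (run_Decode (g_consts r1)) ?hz2 //; first by rewrite -hz2 //= ez.
    by rewrite /= ltnW.
  exact: (ltn_slots B_gt0 PH_big).
have hbU u : u \in U -> digits sb aDIG u = d u.
  move=> hu; rewrite run_InitDig // hu.
  have hi : index u (enum U) < k.
    by apply: leq_trans U_size; rewrite cardE index_mem mem_enum.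
  have hkB : k <= B by apply: leq_trans (ltnW kB); rewrite -addnn leq_addr.
  rewrite hgs; last exact: leq_trans (leq_trans hi hkB) (leq_cube B_gt0).
  by rewrite /g hi hu0 //; apply/minn_idPr.
have hbN v : v \notin U -> digits sb aDIG v = k + rank rp v.
  by move=> hv; rewrite run_InitDig // (negbTE hv).
split=> //.
- split=> [u hu|v]; first by rewrite hbU ?dU.
  case: (boolP (v \in U)) => hv; first by rewrite hbU.
  by rewrite hbN //; have := rank_lt rp_size hv; lia.
- by move=> u hu; rewrite hbU.
(* The starting classes refine those of [d]: they agree on [U] and are singletons elsewhere. *)
- have hfd : feasible C (labf k rp d).
    by move: (leq_trans hlpos hd); rewrite /score; case: ifP.
  rewrite /fit /score; have -> //: feasible C (labf k rp (digits sb aDIG)).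
  apply/forallP => v; apply: leq_trans (forallP hfd v); apply: leq_sum => w _.
  rewrite !labfE; case: (boolP (v \in U)) => hv; case: (boolP (w \in U)) => hw.
  + by rewrite /same !hbU.
  + by rewrite /same hbU // (hbN w) //; have := dU v hv; case: eqP => //; lia.
  + by rewrite /same (hbU w) // (hbN v) //; have := dU w hw; case: eqP => //; lia.
  + rewrite /same (hbN v) // (hbN w) // eqn_add2l ltnNge leq_addr /=.
    case: (rank rp v =P rank rp w) => //= hr; case: (rp v =P rp w) => //= hrp.
    by rewrite (rank_inj hrp hr) !eqxx orbT.
Qed.
End Geometry.
End Specs.

Lemma iteri_last (q : nat -> nat) n d :
  let r := iteri n (fun i a => if q i == 0 then a else i) d in
  (r < n /\ q r != 0) \/ (r = d /\ forall i, i < n -> q i = 0).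
Proof.
elim: n => [|n IH] /=; first by right.
case: eqP => h; last by left; split=> //; apply/eqP.
case: IH => [[h1 h2]|[h1 h2]]; first by left; split=> //; apply: ltnW.
by right; split=> // i; rewrite ltnS leq_eqVlt => /predU1P[->|/h2].
Qed.

Lemma eq_iteri n (F G : nat -> nat -> nat) d :
  (forall i a, i < n -> F i a = G i a) -> iteri n F d = iteri n G d.
Proof. by elim: n => //= n IH h; rewrite h // IH // => i a hi; apply/h/ltnW. Qed.

(** * Correctness of the branching *)

Section Linked.
Variables (n : nat) (adj : rel 'I_n).
Hypothesis adj_sym : symmetric adj.

Definition linked (W : {set 'I_n}) : rel 'I_n := connect [rel x y in W | adj x y].

Lemma linked_sym W v u : linked W v u = linked W u v.
Proof.
apply: sym_connect_sym => x y /=; rewrite adj_sym.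
by case: (x \in W); case: (y \in W).
Qed.

Lemma linked_in (W : {set 'I_n}) v u : v \in W -> linked W v u -> u \in W.
Proof.
move=> hv /connectP[p hp ->]; elim: p v hv hp => //= x p IH v hv /andP[/andP[/andP[_ hx] _]].
exact: IH.
Qed.

Definition component (U : {set 'I_n}) (v : 'I_n) : {set 'I_n} := [set u | linked (~: U) v u].

Lemma component_eq (U : {set 'I_n}) v u : linked (~: U) v u -> component U v = component U u.
Proof.
move=> h; apply/setP => w; rewrite !inE; apply/idP/idP => hw.
  by apply: connect_trans hw; rewrite -/(linked _ _ _) linked_sym.
exact: connect_trans hw.
Qed.

Definition small (k : nat) (U : {set 'I_n}) : Prop :=
  forall v, v \notin U -> #|component U v| <= k.

Lemma integrity_small k : integrity_at_most adj k ->
  exists2 U : {set 'I_n}, #|U| <= k & small k U.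
Proof.
case/existsP => U /andP[hU /forall_inP h]; exists U => // v hv.
apply: leq_trans (leq_subr #|U| k).
have := h [set y in ~: U | linked (~: U) v y]; rewrite /components /equivalence_partition.
move=> h'; apply: leq_trans (h' _); last by apply/imset_f; rewrite inE.
apply/subset_leq_card/subsetP => w; rewrite !inE => hw; rewrite hw andbT.
by have := @linked_in (~: U) v w; rewrite !inE; apply.
Qed.

(* A set grown greedily from [v] in the graph minus [U], with at most [k] additions. *)
Definition grown (k : nat) (U : {set 'I_n}) (v : 'I_n) (S : {set 'I_n}) : Prop :=
  [/\ v \in S, forall s, s \in S -> s \notin U,
      forall W : {set 'I_n}, S \subset W -> forall s, s \in S -> linked W v s &
      #|S| <= k -> forall w u, w \in S -> u \notin U -> adj w u -> u \in S].

Lemma grown_small k U v S : grown k U v S -> #|S| <= k -> S = component U v.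
Proof.
case=> hv hSU hl hc hk; have hcl := hc hk; apply/setP => u; rewrite inE; apply/idP/idP => hu.
  by apply: hl hu; apply/subsetP => s /hSU; rewrite inE.
case/connectP: hu => p hp ->; elim: p v hv hp {hl} => //= x p IH v hv.
case/andP=> /andP[/andP[_]]; rewrite inE => hx ha; apply: IH.
exact: hcl ha.
Qed.

Lemma grown_sub k U v S : grown k U v S -> S \subset component U v.
Proof.
case=> hv hSU hl _; apply/subsetP => u hu; rewrite inE.
by apply: hl hu; apply/subsetP => s /hSU; rewrite inE.
Qed.

(** If [T] missed [S], then [S] would be connected after removing [T] and lie in a component of more
    than [k] vertices. *)
Lemma grown_hits k U v S (T : {set 'I_n}) : grown k U v S -> k < #|S| -> small k T ->
  exists2 u, u \in S & u \in T.
Proof.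
case=> hv hSU hl _ hk hT; apply/exists_inP; apply: contraLR hk => /exists_inPn h.
have hS : S \subset ~: T by apply/subsetP => s hs; rewrite inE; exact: h.
rewrite -leqNgt; apply: leq_trans (hT v (h v hv)); apply/subset_leq_card/subsetP => u hu.
by rewrite inE; exact: hl hu.
Qed.

(** The value [n] for the empty set matches the default of [ELast] in the program. *)
Definition last_in (S : {set 'I_n}) : nat := foldl (fun a (i : 'I_n) => if i \in S then val i else a) n (enum 'I_n).

Lemma last_inP (S : {set 'I_n}) v : v \in S -> exists2 r, r \in S & last_in S = val r.
Proof.
move=> hv; rewrite /last_in.
suff H s a : (v \in s) || [exists r in S, a == val r] -> exists2 r, r \in S &
    foldl (fun a (i : 'I_n) => if i \in S then val i else a) a s = val r.
  by apply: H; rewrite mem_enum.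
elim: s a => [|i s IH] a /=; first by case/existsP=> r /andP[hr /eqP ->]; exists r.
rewrite inE -orbA => h; apply: IH; case: ifP => hi.
  by apply/orP; right; apply/existsP; exists i; rewrite hi eqxx.
by case/orP: h => [/eqP e|//]; rewrite -e hv in hi.
Qed.
Lemma last_in0 : last_in set0 = n.
Proof. by rewrite /last_in; elim: (enum _) => //= i s; rewrite inE. Qed.

Definition candidates (U S : {set 'I_n}) : {set 'I_n} :=
  [set u | [&& u \notin U, u \notin S & [exists w in S, adj w u]]].

Definition grow_step (U S : {set 'I_n}) : {set 'I_n} :=
  S :|: [set u | val u == last_in (candidates U S)].

Definition growset (k : nat) (U : {set 'I_n}) (v : 'I_n) : {set 'I_n} :=
  iter k (grow_step U) [set v].

(** After [i] rounds that all find a candidate the set has [i + 1] vertices. If it is smaller, some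
    round found none, and the set is closed under adjacency outside [U]. *)
Lemma growsetP k (U : {set 'I_n}) v : v \notin U -> grown k U v (growset k U v) /\ #|growset k U v| <= k.+1.
Proof.
move=> hv.
suff H i : let S := iter i (grow_step U) [set v] in [/\ v \in S /\ (forall s, s \in S -> s \notin U),
  forall W : {set 'I_n}, S \subset W -> forall s, s \in S -> linked W v s,
  #|S| <= i.+1 &
  #|S| <= i -> forall w u, w \in S -> u \notin U -> adj w u -> u \in S].
  by have [[h1 h2] h3 h4 h5] := H k.
elim: i => [|i /=]; cbv zeta.
  split; rewrite /= ?cards1 ?set11 //; first by split=> // s; rewrite inE => /eqP ->.
  by move=> W _ s; rewrite inE => /eqP ->; exact: connect0.
move: (iter i _ _) => S [[vS SU] hl hc hcl].
case: (set_0Vmem (candidates U S)) => [h0|[u0 hu0]].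
  have -> : grow_step U S = S.
    apply/setP => x; rewrite /grow_step h0 last_in0 !inE.
    by have := ltn_ord x; case: eqP => [->|_]; rewrite ?ltnn ?orbF.
  split=> //; first exact: leqW.
  move=> _ w u wS uU hwu; apply: contraT => uS.
  have : u \in candidates U S by rewrite inE uU uS; apply/exists_inP; exists w.
  by rewrite h0 inE.
have [u] := last_inP hu0; rewrite inE => /and3P[uU uS /exists_inP[w wS hwu]] eu.
have -> : grow_step U S = u |: S.
  by apply/setP => x; rewrite /grow_step eu !inE (inj_eq val_inj) orbC.
split.
- split; first by rewrite in_setU1 vS orbT.
  by move=> x; rewrite in_setU1 => /predU1P[->|/SU].
- move=> W hW x; have hSW : S \subset W by apply: subset_trans hW; exact: subsetUr.
  rewrite in_setU1 => /predU1P[->|]; last exact: hl.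
  apply: connect_trans (hl W hSW w wS) _; apply: connect1 => /=.
  by rewrite hwu (subsetP hSW) // (subsetP hW) // !inE eqxx.
- by rewrite cardsU1 uS add1n ltnS.
- rewrite cardsU1 uS add1n ltnS => hle.
  by move: uS; rewrite (hcl hle w u).
Qed.

(** The smallest offending vertex is unique, so the set that the program will mark is known in
    advance and the right digit can be fixed before the run. *)
Definition first_bad (k : nat) (U : {set 'I_n}) (v : 'I_n) : Prop :=
  [/\ v \notin U, k < #|growset k U v| &
    forall w : 'I_n, w < v -> w \notin U -> #|growset k U w| <= k].

Lemma first_bad_uniq k (U : {set 'I_n}) v w : first_bad k U v -> first_bad k U w -> v = w.
Proof.
move=> [v1 v2 v3] [w1 w2 w3]; case: (ltngtP v w) => h; last exact: val_inj.
  by have := w3 v h v1; rewrite leqNgt v2.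
by have := v3 w h w1; rewrite leqNgt w2.
Qed.

Lemma first_bad_or_small k (U : {set 'I_n}) : (exists v, first_bad k U v) \/ small k U.
Proof.
case: (pickP (fun v => (v \notin U) && (k < #|growset k U v|))) => [v0 h0|h]; last first.
  right=> v hv; have [h1 _] := growsetP k hv.
  have hk : #|growset k U v| <= k by rewrite leqNgt; have := h v; rewrite hv /= => ->.
  by rewrite -(grown_small h1 hk).
left; case: (@arg_minnP _ v0 (fun v => (v \notin U) && (k < #|growset k U v|)) (fun v => val v) h0) => v /andP[h1 h2] h3.
exists v; split=> // w hw hwU; rewrite leqNgt; apply/negP => hbad.
by have := h3 w; rewrite hwU hbad => /(_ isT); rewrite leqNgt hw.
Qed.
End Linked.

(** * Runs of the branching *)

Section BranchSpecs.
Variables (n C k B PH : nat) (adj : rel 'I_n).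
Hypotheses (adj_sym : symmetric adj).

Local Notation consts := (consts C k B PH adj).
Local Notation consts_frame := (@consts_frame n C k B PH adj).

Definition indicates (m : nat -> nat) (S : {set 'I_n}) : Prop := forall v : 'I_n, m v = (v \in S).

Lemma eval_last st (rho : nat -> nat) (S : {set 'I_n}) : consts st -> indicates (cells st aMARK) S ->
  eval rho (cells st) (ELast 2 0 (V aN) (V aN) (Cell aMARK 2)) = last_in S.
Proof.
move=> h hS; rewrite /= (c_N h) iteri_enum; apply: eq_foldl => a i.
by rewrite hS eqb0 if_neg.
Qed.

Lemma eval_count st (rho : nat -> nat) (S : {set 'I_n}) : consts st -> indicates (cells st aMARK) S ->
  eval rho (cells st) (Sum 2 (V aN) (Cell aMARK 2)) = #|S|.
Proof.
move=> h hS; rewrite eval_Sum /V /= (c_N h) -sum1_card [RHS]big_mkcond; apply: eq_bigr => i _.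
by rewrite hS; case: (i \in S).
Qed.

Lemma eval_Cand st (rho : nat -> nat) (U S : {set 'I_n}) (u : 'I_n) :
  consts st -> indicates (cells st aINU) U -> indicates (cells st aMARK) S ->
  (eval (upd rho 2 u) (cells st) Cand == 0) = ~~ [&& u \notin U, u \notin S & [exists w in S, adj w u]].
Proof.
move=> h hU hS; rewrite /Cand.
set e := Sum 4 _ _.
have he : (eval (upd rho 2 u) (cells st) e == 0) = ~~ [exists w in S, adj w u].
  rewrite /e eval_Sum /V /= (c_N h) sum_nat_eq0 negb_exists; apply: eq_forallb => w /=.
  by rewrite hS (c_adj h) eqb0 if_neg; case: (w \in S) => //=; rewrite eqb0.
transitivity ((if (u \notin U : nat) == 0 then 0 else if (u \notin S : nat) == 0 then 0 else
  eval (upd rho 2 u) (cells st) e) == 0).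
  by rewrite -(if_not (u \in U)) -(if_not (u \in S)) -hU -hS.
by case: (u \in U) => //=; case: (u \in S).
Qed.

Lemma run_Grow st (rho : nat -> nat) (U : {set 'I_n}) (v : 'I_n) : consts st ->
  indicates (cells st aINU) U -> rho 1 = v ->
  indicates (cells (run rho Grow st) aMARK) (growset adj k U v).
Proof.
move=> h hU hr; rewrite /Grow run_Seq; set st1 := run rho (Tab _ _ _ _) st.
have h1 : consts st1 by exact: consts_frame.
have hU1 : indicates (cells st1 aINU) U by move=> x; rewrite /st1 run_frame.
have [] // := @run_For_ind (fun i s => [/\ consts s, indicates (cells s aINU) U &
    indicates (cells s aMARK) (iter i (grow_step adj U) [set v])])
  rho 3 (V aK) (Set_ aMARK (ELast 2 0 (V aN) (V aN) Cand) (Num 1)) st1 k (c_K h1).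
- split=> // u; rewrite /st1 run_Tab_lt //; last by rewrite /= (c_N h).
  by rewrite /= hr if_eq inE.
- move=> i s hi [g1 g2 hS]; set rho' := upd rho 3 i; set s' := run rho' _ s.
  split; [exact: consts_frame|by move=> x; rewrite /s' run_frame|].
  rewrite [iter i.+1 _ _]iterS; set S := iter i _ _ in hS *; set r := last_in (candidates adj U S).
  have er : eval rho' (cells s) (ELast 2 0 (V aN) (V aN) Cand) = r.
    transitivity (iteri n (fun u a => if eval (upd (upd rho' 2 u) 0 a) (cells s) Cand == 0 then a else u) n).
      by rewrite -[in RHS](c_N g1).
    rewrite iteri_enum; apply: eq_foldl => a u.
    have -> : eval (upd (upd rho' 2 u) 0 a) (cells s) Cand = eval (upd rho' 2 u) (cells s) Cand by [].
    by rewrite (eval_Cand _ _ g1 g2 hS) if_neg inE.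
  move=> x; rewrite /s' run_Set er /grow_step -/r !inE hS /=.
  by case: eqP; rewrite ?orbT ?orbF.
Qed.

(** The last vertex of a component serves as its representative, since it does not depend on the
    vertex from which the component was grown. *)
Definition settled (U : {set 'I_n}) (st : state) (v : 'I_n) : Prop :=
  if v \in U then cells st aCOMP v = v
  else #|component adj U v| <= k /\ cells st aCOMP v = last_in (component adj U v).

Definition bad_set (U : {set 'I_n}) (st : state) : Prop :=
  exists v, first_bad adj k U v /\ indicates (cells st aMARK) (growset adj k U v).

Lemma run_Find st rho (U : {set 'I_n}) : consts st -> indicates (cells st aINU) U ->
  let st' := run rho Find st in
  if cells st' aFOUND 0 == 0 then forall v, settled U st' v else bad_set U st'.
Proof.
move=> h hU; rewrite /Find run_Seq; set st1 := run rho (Set_ _ _ _) st; set body := If _ _ _.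
have h1 : consts st1 by exact: consts_frame.
have hU1 : indicates (cells st1 aINU) U by move=> x; rewrite /st1 run_frame.
pose Inv i s := [/\ consts s, indicates (cells s aINU) U &
  if cells s aFOUND 0 == 0 then
    forall v : 'I_n, v < i -> settled U s v /\ (v \notin U -> #|growset adj k U v| <= k)
  else bad_set U s].
have [] := @run_For_ind Inv rho 1 (V aN) body st1 n (c_N h1).
- by split.
- move=> i s hi [g1 g2 g3]; set rho' := upd rho 1 i; pose v := Ordinal hi.
  have ev : rho' 1 = v by [].
  split; [exact: consts_frame|by move=> x; rewrite run_frame|].
  have keep s' : settled U s' v -> (v \notin U -> #|growset adj k U v| <= k) ->
      (forall x : 'I_n, x < i -> cells s' aCOMP x = cells s aCOMP x) ->
      (forall x : 'I_n, x < i -> settled U s x /\ (x \notin U -> #|growset adj k U x| <= k)) ->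
      forall x : 'I_n, x < i.+1 -> settled U s' x /\ (x \notin U -> #|growset adj k U x| <= k).
    move=> k1 k2 k3 k4 x; rewrite ltnS leq_eqVlt => /predU1P[ex|hx].
      by have -> : x = v by exact: val_inj.
    by have [k5 k6] := k4 x hx; split=> //; move: k5; rewrite /settled k3.
  rewrite /body run_If.
  have -> : eval rho' (cells s) (Cell aINU 1) = (v \in U) by rewrite -g2.
  rewrite eqb0; case: (boolP (v \in U)) => hv; rewrite ?if_neg.
    rewrite -[if ~~ true then _ else _]/(run rho' (Set_ aCOMP (Loc 1) (Loc 1)) s).
    set s' := run _ _ _.
    have ef : cells s' aFOUND = cells s aFOUND by apply: run_frame.
    have em : cells s' aMARK = cells s aMARK by apply: run_frame.
    rewrite ef; case: ifP g3 => hf g3; last by have [v' [b1 b2]] := g3; exists v'; rewrite em.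
    apply: keep g3; [by rewrite /settled hv /s' run_Set /= eqxx|by rewrite hv|].
    by move=> x hx; rewrite /s' run_Set /= ltn_eqF.
  rewrite -[if ~~ false then _ else _]/(run rho' (If (V aFOUND) Skip _) s) run_If.
  rewrite -[eval _ _ _]/(cells s aFOUND 0).
  case: ifP g3 => hf g3; last by rewrite /= hf.
  rewrite !run_Seq; set sg := run rho' Grow s; set sc := run _ _ sg; set sf := run _ _ sc.
  have m1 := run_Grow g1 g2 ev; have [m2 m3] := growsetP adj k hv.
  set S := growset adj k U v in m1 m2 m3.
  have gg : consts sg by exact: consts_frame.
  have gc : consts sc by exact: consts_frame.
  have mc : indicates (cells sc aMARK) S by move=> x; rewrite /sc run_frame // m1.
  have ms : indicates (cells sf aMARK) S by move=> x; rewrite /sf run_frame // mc.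
  have ef : cells sf aFOUND 0 = #|S| - k.
    rewrite /sf run_Set eqxx eval_ESub (eval_count _ gc mc).
    by rewrite -[eval _ _ (V aK)]/(cells sc aK 0) (c_K gc).
  have ec : forall x, cells sf aCOMP x = if x == i then last_in S else cells s aCOMP x.
    move=> x; have -> : cells sf aCOMP = cells sc aCOMP by apply: run_frame.
    rewrite /sc run_Set (eval_last _ gg m1) -[eval _ _ (Loc 1)]/i.
    by have -> : cells sg aCOMP = cells s aCOMP by apply: run_frame.
  rewrite ef subn_eq0; case: (leqP #|S| k) => hSk; last first.
    by exists v; split=> //; split=> // w hw hwU; have [_] := g3 w hw; apply.
  apply: keep g3 => //.
  + rewrite /settled (negbTE hv); have eS := grown_small m2 hSk.
    by rewrite -eS ec eqxx.
  + by move=> x hx; rewrite ec ltn_eqF.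
move=> _ _; case: ifP => // _ hs v; have [] := hs v (ltn_ord v); done.
Qed.

Lemma found_geometry st (U : {set 'I_n}) : consts st -> indicates (cells st aINU) U ->
  (forall v, settled U st v) ->
  exists rp : 'I_n -> 'I_n, [/\ geometry C k B PH adj U rp st,
    forall v, (rp v \in U) = (v \in U), forall v, rp (rp v) = rp v,
    forall v w, v \notin U -> w \notin U -> adj v w -> rp v = rp w &
    forall v, v \notin U -> \sum_(w < n) (rp w == rp v) <= k].
Proof.
move=> h hU hs; pose rp (v : 'I_n) : 'I_n := insubd v (cells st aCOMP v).
have self v : v \in component adj U v by rewrite inE; exact: connect0.
have rpin v : v \in U -> rp v = v.
  by move=> hv; have := hs v; rewrite /settled hv /rp => ->; exact: valKd.
have rpout v : v \notin U -> [/\ #|component adj U v| <= k, cells st aCOMP v = rp v,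
    rp v \in component adj U v & (rp v : nat) = last_in (component adj U v)].
  move=> hv; have := hs v; rewrite /settled (negbTE hv) => -[h1 h2].
  have [r hr er] := last_inP (self v).
  have e : rp v = r by rewrite /rp h2 er; exact: valKd.
  by rewrite e h2 er.
have inC v u : v \notin U -> u \in component adj U v -> u \notin U.
  by rewrite inE => hv /linked_in; rewrite !inE; apply.
have rpE v w : v \notin U -> w \notin U -> component adj U v = component adj U w -> rp v = rp w.
  move=> hv hw e; have [_ _ _ h1] := rpout v hv; have [_ _ _ h2] := rpout w hw.
  by apply: val_inj; rewrite /= h1 h2 e.
have compE v u : u \in component adj U v -> component adj U v = component adj U u.
  by rewrite inE; exact: component_eq.
have rpU v : (rp v \in U) = (v \in U).
  case: (boolP (v \in U)) => hv; first by rewrite rpin.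
  by apply/negbTE; have [_ _ h1 _] := rpout v hv; exact: inC h1.
exists rp; split=> //.
- split=> // v; case: (boolP (v \in U)) => hv; last by have [_ ->] := rpout v hv.
  by have := hs v; rewrite /settled hv rpin.
- move=> v; case: (boolP (v \in U)) => hv; first by rewrite !rpin.
  have [_ _ h1 _] := rpout v hv; apply: rpE => //; first exact: inC h1.
  by rewrite (compE _ _ h1).
- move=> v w hv hw ha; apply: rpE => //; apply: compE; rewrite inE.
  by apply: connect1; rewrite /= !inE hv hw.
- move=> v hv; have [h1 _ h2 _] := rpout v hv; apply: leq_trans h1.
  rewrite -sum1_card [X in _ <= X]big_mkcond; apply: leq_sum => w _.
  case: eqP => // e; have hw : w \notin U by rewrite -rpU e; exact: inC h2.
  have [_ _ h3 _] := rpout w hw; rewrite e in h3.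
  by rewrite (compE _ _ h2) -(compE _ _ h3) self.
Qed.

Definition Choice : expr :=
  ELast 2 0 (V aN) (V aN) (EAnd (Cell aMARK 2) (EEq (RankIn aMARK) (Cell aGS 5))).
Definition Branch_step : cmd := Seq Find (If (V aFOUND) (Set_ aINU Choice (Num 1)) Skip).

Lemma eval_Choice st (rho : nat -> nat) (S : {set 'I_n}) (u : 'I_n) : consts st ->
  indicates (cells st aMARK) S -> u \in S -> cells st aGS (rho 5) = index u (enum S) ->
  eval rho (cells st) Choice = u.
Proof.
move=> h hS hu hg.
pose q i := eval (upd (upd rho 2 i) 0 0) (cells st) (EAnd (Cell aMARK 2) (EEq (RankIn aMARK) (Cell aGS 5))).
have hq (v : 'I_n) : q v = (v \in S) && (index v (enum S) == index u (enum S)).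
  rewrite /q; transitivity (if (cells st aMARK v == 0) then 0 else
    (eval (upd (upd rho 2 v) 0 0) (cells st) (RankIn aMARK) == cells st aGS (rho 5) : nat)).
    by rewrite -if_eq.
  rewrite hS hg; case: (boolP (v \in S)) => //= hv; congr (nat_of_bool (_ == _)).
  rewrite (c_N h) enum_set_filter index_filter_enum //; apply: eq_bigr => w _.
  by rewrite if_lt hS if_and.
have -> : eval rho (cells st) Choice = iteri n (fun i a => if q i == 0 then a else i) n.
  transitivity (iteri n (fun i a => eval (upd (upd rho 2 i) 0 a) (cells st)
    (EIf (EAnd (Cell aMARK 2) (EEq (RankIn aMARK) (Cell aGS 5))) (Loc 2) (Loc 0))) n).
    by rewrite -[in RHS](c_N h).
  by apply: eq_iteri.
case: (iteri_last q n n) => [[h1 h2]|[_ /(_ u (ltn_ord u))]]; last by rewrite hq hu eqxx.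
move: h2; set r := iteri _ _ _ in h1 *.
rewrite -[r]/(val (Ordinal h1)) hq; case: (boolP (Ordinal h1 \in S)) => //= hr.
rewrite eqb0 negbK => /eqP e; have := congr1 (nth u (enum S)) e.
by rewrite !nth_index ?mem_enum // => <-.
Qed.

Lemma run_Branch_step st rho (U : {set 'I_n}) : consts st -> indicates (cells st aINU) U ->
  exists2 U' : {set 'I_n}, indicates (cells (run rho Branch_step st) aINU) U' & #|U'| <= #|U|.+1.
Proof.
move=> h hU; rewrite /Branch_step run_Seq; set sf := run rho Find st; rewrite run_If.
have hUf : indicates (cells sf aINU) U by move=> x; rewrite /sf run_frame.
case: ifP => _; first by exists U.
set r := eval rho (cells sf) Choice.
case: (ltnP r n) => hr.
  exists (Ordinal hr |: U); last by rewrite cardsU1; case: (_ \notin _); rewrite ?add1n.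
  move=> x; rewrite run_Set -/r in_setU1 hUf -(inj_eq val_inj) /=; by case: eqP.
(* If no vertex has the guessed rank, the write falls outside the vertex range and [U] is
   unchanged. *)
exists U => // x; rewrite run_Set -/r hUf; have := ltn_ord x.
by case: eqP => // ->; rewrite ltnNge hr.
Qed.
(** The loop unrolled from its first iteration, whereas [iteri] peels off the last one; backward
    induction on the rounds needs the former. *)
Fixpoint rest (rho : nat -> nat) (i m : nat) (s : state) : state :=
  if m is m'.+1 then rest rho i.+1 m' (run (upd rho 5 i) Branch_step s) else s.

Lemma iteri_rest rho m s :
  iteri m (fun i s => run (upd rho 5 i) Branch_step s) s = rest rho 0 m s.
Proof.
have restS i q s' : rest rho i q.+1 s' = run (upd rho 5 (i + q)) Branch_step (rest rho i q s').
  elim: q i s' => [|q IH] i s'; first by rewrite addn0.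
  by rewrite -[LHS]/(rest rho i.+1 q.+1 _) IH addSnnS.
by elim: m => // m IH; rewrite restS -IH.
Qed.

Lemma settled_small (U : {set 'I_n}) st : (forall v, settled U st v) -> small adj k U.
Proof. by move=> h v hv; have := h v; rewrite /settled (negbTE hv) => -[]. Qed.

(* The rank guessed in each round depends on the set reached so far, so the guesses are
   found by backward induction on the number of rounds left. *)
Lemma guided_branching (T : {set 'I_n}) m : small adj k T -> forall i (U : {set 'I_n}),
  small adj k U \/ U \subset T /\ #|T :\: U| <= m ->
  exists2 g : nat -> nat, forall t, g t <= k & forall rho s, consts s -> indicates (cells s aINU) U ->
    (forall t, t < m -> cells s aGS (i + t) = g t) ->
    exists2 U' : {set 'I_n}, indicates (cells (rest rho i m s) aINU) U' & small adj k U'.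
Proof.
move=> hT; elim: m => [|m IH] i U hJ.
  exists (fun=> 0) => // rho s hs hU _; exists U => //.
  case: hJ => // -[hUT]; rewrite leqn0 cards_eq0 setD_eq0 => hTU.
  by have -> : U = T by apply/eqP; rewrite eqEsubset hUT.
have small_not_bad : small adj k U -> forall v, ~ first_bad adj k U v.
  move=> hsm v [hv hk _]; have [hS _] := growsetP adj k hv.
  by have := hsm v hv; rewrite leqNgt (leq_trans hk) // subset_leq_card // (grown_sub hS).
(* If [U] already leaves only small components, [Find] reports none and the remaining rounds keep
   [U], whatever the digits. *)
case: (first_bad_or_small adj k U) => [[v hvbad]|hsm]; last first.
  have [g hg1 hg2] := IH i.+1 U (or_introl hsm).
  exists (fun t => if t is t'.+1 then g t' else 0) => [[|t]//|rho s h hU hgs].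
  set rho' := upd rho 5 i.
  rewrite -[rest _ _ _ _]/(rest rho i.+1 m (run rho' Branch_step s)).
  have := run_Find rho' h hU; cbv zeta; case: ifP => hF0 hF; last first.
    by have [v [/small_not_bad]] := hF.
  have e : run rho' Branch_step s = run rho' Find s.
    by rewrite /Branch_step run_Seq run_If -[eval _ _ _]/(cells (run rho' Find s) aFOUND 0) hF0.
  rewrite e; apply: hg2 => [||t ht]; first exact: consts_frame.
    by move=> x; rewrite run_frame.
  by rewrite run_frame // addSnnS hgs.
case: hJ => [/small_not_bad/(_ v)//|[hUT hcard]].
have [hv hk _] := hvbad; have [hS hS2] := growsetP adj k hv.
(* Guessing the rank of a common vertex of the oversized set and [T] brings [U] one vertex closer to
   [T]. *)
have [u uS uT] := grown_hits hS hk hT.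
have uU : u \notin U by case: hS => _ hSU _ _; exact: hSU.
have [|g hg1 hg2] := IH i.+1 (u |: U).
  right; split; first by rewrite subUset sub1set uT.
  have := cardsD1 u (T :\: U); rewrite inE uT uU /= => e.
  have -> : T :\: (u |: U) = (T :\: U) :\ u by apply/setP => x; rewrite !inE negb_or andbA.
  by move: hcard; rewrite e add1n ltnS.
exists (fun t => if t is t'.+1 then g t' else index u (enum (growset adj k U v))) => [[|t]//|rho s h hU hgs].
  by rewrite -ltnS; apply: leq_trans hS2; rewrite cardE index_mem mem_enum.
set rho' := upd rho 5 i.
rewrite -[rest _ _ _ _]/(rest rho i.+1 m (run rho' Branch_step s)).
set f := run rho' Find s.
have hf : consts f by exact: consts_frame.
have hUf : indicates (cells f aINU) U by move=> x; rewrite /f run_frame.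
have := run_Find rho' h hU; rewrite -/f; cbv zeta; case: ifP => hF0 hF.
  by case: (small_not_bad (settled_small hF) v).
have [v' [hv' hM]] := hF; rewrite (first_bad_uniq hv' hvbad) in hM.
have eC : eval rho' (cells f) Choice = u.
  apply: (eval_Choice hf hM uS).
  by rewrite /f run_frame // /rho' /= -[i]addn0 hgs.
have e : run rho' Branch_step s = run rho' (Set_ aINU Choice (Num 1)) f.
  by rewrite /Branch_step run_Seq run_If -[eval _ _ _]/(cells f aFOUND 0) hF0.
rewrite e; apply: hg2 => [||t ht]; first exact: consts_frame.
  by move=> x; rewrite run_Set eC in_setU1 hUf (inj_eq val_inj); case: eqP.
by rewrite run_frame // /f run_frame // addSnnS hgs.
Qed.

Hypotheses (kB : k.*2 < B) (B_pieces : piece_bound k k <= B)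
  (B_codes : 2 * (k.*2 + 2) ^ (k * (k.*2.+1)) <= B) (PH_big : B ^ (B ^ 3) <= PH).

Lemma run_Branch st rho : consts st -> exists2 U : {set 'I_n},
  indicates (cells (run rho Branch st) aINU) U & #|U| <= k.
Proof.
move=> h; rewrite /Branch run_Seq; set s0 := run rho (Tab _ _ _ _) st.
have h0 : consts s0 by exact: consts_frame.
rewrite run_Seq; set s1 := run rho (For _ _ _) s0.
have [U hU hc] : exists2 U : {set 'I_n}, indicates (cells s1 aINU) U & #|U| <= k.
  have [] := @run_For_ind (fun i s => consts s /\ exists2 U : {set 'I_n},
    indicates (cells s aINU) U & #|U| <= i) rho 5 (V aK) Branch_step s0 k (c_K h0).
  - split=> //; exists set0; rewrite ?cards0 // => v.
    by rewrite /s0 run_Tab_lt // ?inE //= (c_N h).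
  - move=> i s hi [g1 [U g2 g3]]; split; first exact: consts_frame.
    have [U' u1 u2] := run_Branch_step (upd rho 5 i) g1 g2.
    by exists U' => //; exact: leq_trans u2 _.
  by move=> _.
by exists U => // v; rewrite run_frame.
Qed.

(** A run with [FOUND = 0] certifies its [U], so [Solve] is only ever started on a valid separator.
    Integrity at most [k] guarantees that one of the guesses gets that far. *)
Lemma run_Body l st rho : consts st -> sound C adj st -> cells st aDONE 0 = 0 ->
  let st' := run rho Body st in
  [/\ consts st', sound C adj st', cells st' aDONE 0 = 0 \/ score C adj l <= cells st' aBV 0 &
    integrity_at_most adj k -> cells st' aDONE 0 != 0].
Proof.
move=> h hs hd; have B_gt0 : 0 < B by exact: leq_ltn_trans kB.
have h0 : consts (run rho (Tab aINU 2 (V aN) (Num 0)) st) by exact: consts_frame.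
(* The digits from [guided_branching] form one number [x] that depends on the graph alone, not on
   the state in which [Branch] is started. *)
have [x hx1 hx2] : exists2 x, x < PH & integrity_at_most adj k ->
    forall rho' s', consts s' -> (forall i, i < PH -> cells s' aGS i = (x %/ B ^ i) %% B) ->
    cells (run rho' Branch s') aFOUND 0 = 0.
  case: (boolP (integrity_at_most adj k)) => [/integrity_small[T hT1 hT2]|_]; last first.
    by exists 0 => //; apply: (ltn_slots B_gt0 PH_big); rewrite expn_gt0 B_gt0.
  have [|g hg1 hg2] := @guided_branching T k hT2 0 set0.
    by right; rewrite sub0set setD0.
  have hkB i : g i < B by apply: leq_ltn_trans (hg1 i) _; apply: leq_ltn_trans kB; rewrite -addnn leq_addr.
  have [x hx1 hx2] := guess_exists hkB PH_big.
  exists x => // _ rho' s hc hgs; rewrite /Branch run_Seq; set s0 := run rho' (Tab _ _ _ _) s.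
  have hc0 : consts s0 by exact: consts_frame.
  have hU0 : indicates (cells s0 aINU) set0.
    by move=> v; rewrite /s0 run_Tab_lt // ?inE //= (c_N hc).
  rewrite run_Seq.
  have -> : run rho' (For 5 (V aK) Branch_step) s0 = rest rho' 0 k s0.
    by rewrite -iteri_rest -[in RHS](c_K hc0).
  have [|U hU hsm] := hg2 rho' s0 hc0 hU0.
    move=> t ht; rewrite add0n /s0 run_frame //.
    have htB : t < B ^ 3.
      apply: leq_trans (leq_cube B_gt0); apply: leq_ltn_trans kB; rewrite -addnn.
      exact: leq_trans (ltnW ht) (leq_addr _ _).
    by rewrite hgs ?hx2 //; exact: (ltn_slots B_gt0 PH_big).
  set s1 := rest _ _ _ _ in hU *.
  have hs1 : consts s1.
    rewrite /s1 -iteri_rest; elim: {2}k => [|m IHm]; [exact: hc0|exact: consts_frame].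
  have := run_Find rho' hs1 hU; cbv zeta; case: eqP => // _ [v [[v1 v2 _] _]].
  have [hS _] := growsetP adj k v1.
  by have := hsm v v1; rewrite leqNgt (leq_trans v2) // subset_leq_card // (grown_sub hS).
set body := Seq (Decode 14) (Seq Branch (If (V aFOUND) Skip Solve)).
have := @run_For_ind (fun j s => [/\ consts s, sound C adj s,
   cells s aDONE 0 = 0 \/ score C adj l <= cells s aBV 0 &
   x < j -> integrity_at_most adj k -> cells s aDONE 0 != 0]) rho 14 (V aPH) body st PH (c_PH h).
case; [by split=> //; left| |by move=> r1 r2 r3 r4; split=> // hi; exact: r4].
move=> j s hj [r1 r2 r3 r4]; rewrite /body run_Seq; set rho' := upd rho 14 j.
set s1 := run rho' (Decode 14) s; rewrite run_Seq; set s2 := run rho' Branch s1.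
have h1 : consts s1 by exact: consts_frame.
have h2 : consts s2 by exact: consts_frame.
have eBV : cells s2 aBV = cells s aBV by transitivity (cells s1 aBV); apply: run_frame.
have eBEST : cells s2 aBEST = cells s aBEST by transitivity (cells s1 aBEST); apply: run_frame.
have eDONE : cells s2 aDONE = cells s aDONE by transitivity (cells s1 aDONE); apply: run_frame.
have so2 : sound C adj s2 by rewrite /sound eBV eBEST.
have gs1 : forall i, i < PH -> cells s1 aGS i = (j %/ B ^ i) %% B.
  by move=> i hi; rewrite (run_Decode B_gt0 r1) //= ltnW.
rewrite run_If -[eval _ _ _]/(cells s2 aFOUND 0).
have [U hU hUk] := run_Branch rho' h1.
have hset : cells s2 aFOUND 0 = 0 -> forall v, settled U s2 v.
  move=> hF; move: hF hU; rewrite /s2 /Branch run_Seq; set sa := run rho' (Tab _ _ _ _) s1.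
  have ha : consts sa by exact: consts_frame.
  rewrite run_Seq; set sb := run rho' (For _ _ _) sa.
  have hb : consts sb by exact: consts_frame.
  move=> hF hU; have hUb : indicates (cells sb aINU) U by move=> v; rewrite -hU run_frame.
  by have := run_Find rho' hb hUb; cbv zeta; rewrite hF.
case: (cells s2 aFOUND 0 =P 0) => hF; last first.
  rewrite -[run _ Skip _]/s2 eBV eDONE; split=> //.
  rewrite ltnS leq_eqVlt => /predU1P[e|//] hint; case: hF.
  by rewrite /s2 hx2 // -?e // => i hi; rewrite gs1 ?e.
have [rp [g1 g2 g3 g4 g5]] := found_geometry h2 hU (hset hF).
have [q1 q2 q3 q4] := run_Solve B_gt0 adj_sym g2 g3 g4 g5 hUk kB B_pieces B_codes PH_big l rho' g1 so2.
split=> //; [exact: consts_frame|by right|by rewrite q3].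
Qed.
End BranchSpecs.

(** * The main program *)

(** The bounds of these loops are not scalars, so [ecost_le] does not cover them and their cost is
    computed directly. *)
Definition EPow (e : expr) : expr := Fold 1 0 e (Num 1) (EAdd (Loc 0) (Loc 0)).
Definition ETower (h : nat) (e : expr) : expr := iter h EPow e.
Definition tower (h x : nat) : nat := iter h (expn 2) x.

Lemma eval_EPow rho m e : eval rho m (EPow e) = 2 ^ eval rho m e.
Proof.
rewrite /EPow /=; elim: (eval rho m e) => //= i ->.
by rewrite addnn -mul2n -expnS.
Qed.

Lemma eval_ETower rho m h e : eval rho m (ETower h e) = tower h (eval rho m e).
Proof. by elim: h => // h IH; rewrite /ETower iterS eval_EPow -/(ETower h e) IH. Qed.

Lemma ecost_EPow rho m e : ecost rho m (EPow e) = ecost rho m e + 12 * eval rho m e + 5.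
Proof.
rewrite /EPow /= sum_nat_const card_ord; lia.
Qed.

Lemma tower_le h x y : x <= y -> tower h x <= tower h y.
Proof. by move=> hxy; elim: h => //= h IH; rewrite leq_pexp2l. Qed.

Lemma ltn_tower h x : x <= tower h x.
Proof. by elim: h => //= h IH; apply: leq_trans IH _; apply/ltnW/ltn_expl. Qed.

Lemma ecost_ETower rho m h e : ecost rho m (ETower h e) <= ecost rho m e + h * (12 * tower h (eval rho m e) + 5).
Proof.
elim: h => [|h IH]; first by rewrite addn0.
rewrite /ETower iterS ecost_EPow -/(ETower h e) eval_ETower.
have : tower h (eval rho m e) <= tower h.+1 (eval rho m e) by rewrite /tower iterS; exact/ltnW/ltn_expl.
nia.
Qed.

(** Height 3 dominates [piece_bound k k], which is doubly exponential, and the number of codes. It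
    also suffices for [word_bound]: [B^(B^3) <= 2^(B^4) <= 2^(2^(4B))], and the shift by 2 pays for
    the factor 4. *)
Definition guess_bound (k : nat) : nat := tower 3 (k + 2).
Definition word_bound (k : nat) : nat := tower 3 (guess_bound k + 2).

(** With [a = 2D + 1], the next coordinate has [2aD + 1 <= a^2] in place of [a], and the exponent
    becomes [1 + 2 (2^m - 1)]. *)
Lemma piece_bound_le m D : piece_bound m D <= (D.*2.+1) ^ (2 ^ m - 1).
Proof.
elim: m D => [|m IH] D //=; set a := D.*2.+1.
have ha : (a * D).*2.+1 <= a ^ 2 by rewrite /a -!addnn expnS expn1; nia.
apply: leq_trans (_ : a * (a ^ 2) ^ (2 ^ m - 1) <= _).
  rewrite leq_mul2l; apply/orP; right; apply: leq_trans (IH _) _.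
  by case: (2 ^ m - 1) => // q; rewrite leq_exp2r.
rewrite -expnM -expnS leq_pexp2l // expnS.
by have : 0 < 2 ^ m; [rewrite expn_gt0|lia].
Qed.

Lemma double_le_pow k c : k + c.+1 <= 2 ^ (k + c).
Proof. by rewrite addnS; exact: ltn_expl. Qed.

Lemma double_lt_guess k : k.*2 < guess_bound k.
Proof.
rewrite /guess_bound; apply: leq_trans (_ : 2 ^ (k + 2) <= _).
  by have := double_le_pow k 0; rewrite addn0 expnD -addnn; lia.
exact: (ltn_tower 2).
Qed.

Lemma odd_le_pow k : k.*2 + 2 <= 2 ^ k.+1.
Proof. by have := double_le_pow k 0; rewrite addn0 expnS -addnn; lia. Qed.

Lemma piece_bound_guess k : piece_bound k k <= guess_bound k.
Proof.
apply: leq_trans (piece_bound_le _ _) _.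
apply: leq_trans (_ : (2 ^ k.+1) ^ (2 ^ k) <= _).
  apply: leq_trans (_ : (2 ^ k.+1) ^ (2 ^ k - 1) <= _).
    case: (2 ^ k - 1) => // q; rewrite leq_exp2r //.
    by apply: leq_trans (odd_le_pow k); lia.
  by rewrite leq_pexp2l ?expn_gt0 // leq_subr.
rewrite -expnM /guess_bound /tower /= leq_pexp2l //.
apply: leq_trans (_ : 2 ^ k.+1 * 2 ^ k <= _); first by rewrite leq_mul2r ltnW ?orbT // ltn_expl.
rewrite -expnD leq_pexp2l //.
apply: leq_trans (_ : k.*2 + 2 <= _); first by lia.
by apply: leq_trans (odd_le_pow k) _; rewrite leq_pexp2l // addn2.
Qed.

Lemma code_bound_guess k : 2 * (k.*2 + 2) ^ (k * k.*2.+1) <= guess_bound k.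
Proof.
apply: leq_trans (_ : 2 * (2 ^ k.+1) ^ (k * k.*2.+1) <= _).
  rewrite leq_mul2l; case: (k * _) => //= q; by rewrite leq_exp2r // odd_le_pow.
rewrite -expnM -expnS /guess_bound /tower /= leq_pexp2l //.
have h0 := double_le_pow k 0; rewrite addn0 addn1 in h0.
have h1 := odd_le_pow k.
apply: leq_trans (_ : 2 ^ (k + (k + k.+1)).+1 <= _).
  rewrite expnS !expnD.
  have : k.+1 * (k * k.*2.+1) <= 2 ^ k * (2 ^ k * 2 ^ k.+1).
    by apply: leq_mul => //; apply: leq_mul; lia.
  have : 0 < 2 ^ k * (2 ^ k * 2 ^ k.+1) by rewrite !muln_gt0 !expn_gt0.
  lia.
rewrite leq_pexp2l //.
by rewrite addn2 !expnS; have := expn_gt0 2 k; rewrite orTb => h2; rewrite expnS in h1; lia.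
Qed.

Lemma word_bound_big k : guess_bound k ^ (guess_bound k ^ 3) <= word_bound k.
Proof.
rewrite /word_bound; set B := guess_bound k.
have hB : 0 < B by apply: leq_ltn_trans (double_lt_guess k).
apply: leq_trans (_ : (2 ^ B) ^ (B ^ 3) <= _).
  by rewrite leq_exp2r ?expn_gt0 ?hB // ltnW // ltn_expl.
rewrite -expnM -expnS /tower /= leq_pexp2l //.
apply: leq_trans (_ : (2 ^ B) ^ 4 <= _); first by rewrite leq_exp2r // ltnW // ltn_expl.
rewrite -expnM leq_pexp2l // expnD; apply: leq_mul => //.
by rewrite ltnW // ltn_expl.
Qed.

Definition Setup : cmd :=
  Seq (Set_ aK (Num 0) (Loc 15))
  (Seq (Set_ aK2 (Num 0) (EAdd (Loc 15) (Loc 15)))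
  (Seq (Set_ aBS (Num 0) (EAdd (EAdd (Loc 15) (Loc 15)) (Num 2)))
  (Seq (Set_ aB (Num 0) (ETower 3 (EAdd (Loc 15) (Num 2))))
       (Set_ aPH (Num 0) (ETower 3 (EAdd (V aB) (Num 2))))))).

(** [ROW] records where each row starts, so that matrix entries are addressed by an addition
    alone. *)
Definition ReadGraph : cmd :=
  For 1 (V aN) (Seq (Set_ aROW (Loc 1) (V aPTR))
    (For 2 (V aN) (Seq (ReadC aADJ (V aPTR)) (Set_ aPTR (Num 0) (EAdd (V aPTR) (Num 1)))))).
Definition ReadInput : cmd :=
  Seq (ReadC aN (Num 0)) (Seq (ReadC aC (Num 0))
    (Seq (Set_ aN1 (Num 0) (EAdd (V aN) (Num 1))) ReadGraph)).
Definition Outer : cmd := For 15 (V aN1) (If (V aDONE) Skip (Seq Setup Body)).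
(** A best score of 0 means that no labelling is feasible. The empty graph has score 1, and its list
    of labels is empty as well. *)
Definition Output : cmd := If (V aBV) (For 1 (V aN) (WriteC (Cell aBEST 1))) Skip.
Definition Main : cmd := Seq ReadInput (Seq Outer Output).

Lemma Main_wf : cwf Main. Proof. by []. Qed.
Lemma Main_dep : cdep Main < base. Proof. by []. Qed.

Lemma nth_rows (n : nat) (ss : seq (seq nat)) u v :
  (forall s, s \in ss -> size s = n) -> u < size ss -> v < n ->
  nth 0 (flatten ss) (u * n + v) = nth 0 (nth [::] ss u) v.
Proof.
elim: ss u => // s ss IH [|u] hs hu hv /=; rewrite nth_cat hs ?inE ?eqxx //.
  by rewrite mul0n add0n hv.
rewrite mulSn -addnA ltnNge leq_addr /= addKn IH // => s' hs'.
by rewrite hs // inE hs' orbT.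
Qed.

Lemma nth_adjacency (I : instance) (x y : 'I_(nb_vertices I)) :
  nth 0 [seq (adj x y : nat) | x <- enum 'I_(nb_vertices I), y <- enum 'I_(nb_vertices I)]
    (x * nb_vertices I + y) = adj x y.
Proof.
rewrite nth_rows ?size_map ?size_enum_ord //.
  by rewrite (nth_map x) ?size_enum_ord // (nth_map y) ?size_enum_ord // !nth_ord_enum.
  by move=> s /mapP[z _ ->]; rewrite size_map size_enum_ord.
by rewrite -enumT size_enum_ord.
Qed.

Lemma run_ReadGraph rho st n L : cells st aN 0 = n -> cells st aPTR 0 = 0 -> win st = L ->
  let st' := run rho ReadGraph st in
  forall u v, u < n -> v < n -> cells st' aADJ (cells st' aROW u + v) = nth 0 L (u * n + v).
Proof.
move=> hN hP hL.
pose Inv i j s := [/\ cells s aN = cells st aN, cells s aPTR 0 = i * n + j, win s = drop (i * n + j) L &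
  forall p, p < i * n + j -> cells s aADJ p = nth 0 L p].
have [] := @run_For_ind (fun i s => Inv i 0 s /\ forall u, u < i -> cells s aROW u = u * n) rho 1 (V aN)
  (Seq (Set_ aROW (Loc 1) (V aPTR))
    (For 2 (V aN) (Seq (ReadC aADJ (V aPTR)) (Set_ aPTR (Num 0) (EAdd (V aPTR) (Num 1))))))
  st n hN.
- by split=> //; split=> //; rewrite hL drop0.
- move=> i s hi [[g1 g2 g3 g4] g5]; rewrite run_Seq; set s1 := run _ (Set_ _ _ _) s.
  have i1 : Inv i 0 s1 by split.
  have hN1 : cells s1 aN 0 = n by case: i1 => -> _ _ _.
  set s2 := run _ _ s1.
  have i2 : Inv i n s2.
    apply: (@run_For_ind (Inv i) _ 2 (V aN) _ s1 n hN1 i1) => j s' hj [h1 h2 h3 h4].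
    rewrite run_Seq; set sr := run _ (ReadC _ _) s'.
    have wr : win sr = drop (i * n + j.+1) L.
      by rewrite /sr /= h3 -drop1 drop_drop; congr (drop _ L); lia.
    have ar p : cells sr aADJ p = if p == i * n + j then nth 0 L (i * n + j) else cells s' aADJ p.
      by rewrite /sr /= /upd /= h2 h3 -nth0 nth_drop addn0.
    split=> //.
    + by rewrite run_Set /= /upd /= h2; lia.
    + move=> p hp; rewrite run_frame // ar; case: eqP => [->//|hne]; apply: h4; lia.
  split.
    by case: i2 => j1 j2 j3 j4; split=> //; [rewrite j2|rewrite j3; congr (drop _ L)|move=> p hp; apply: j4]; lia.
  move=> u; rewrite ltnS leq_eqVlt /s2 [cells (run _ (For _ _ _) _) _]run_frame // /s1 run_Set.
  rewrite -[eval _ _ (Loc 1)]/i -[eval _ _ (V aPTR)]/(cells s aPTR 0) g2 addn0.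
  by case: eqP => [->//|_] /= /g5.
move=> [g1 g2 g3 g4] g5; cbv zeta => u v hu hv; rewrite g5 // g4 //; nia.
Qed.

Section Main.
Variables (n C : nat) (adj : rel 'I_n).
Hypotheses (adj_sym : symmetric adj).

Definition input_read (st : state) : Prop :=
  [/\ cells st aN 0 = n, cells st aN1 0 = n.+1, cells st aC 0 = C &
   forall x y : 'I_n, cells st aADJ (cells st aROW x + y) = adj x y].

Lemma input_read_frame rho c st :
  all (fun j => j \notin writes c) [:: aN; aN1; aC; aROW; aADJ] -> input_read st -> input_read (run rho c st).
Proof.
move=> /allP h [h1 h2 h3 h4]; split; rewrite ?run_frame //; try exact: h.
Qed.

Lemma run_Setup rho st : input_read st ->
  consts C (rho 15) (guess_bound (rho 15)) (word_bound (rho 15)) adj (run rho Setup st).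
Proof.
move=> h; have [h1 h2 h3 h4] : input_read (run rho Setup st) by exact: input_read_frame.
have eB : cells (run rho Setup st) aB 0 = guess_bound (rho 15).
  by rewrite /Setup !run_Seq run_frame // run_Set eqxx eval_ETower.
split=> //.
- rewrite /word_bound -eB /Setup !run_Seq run_Set eqxx eval_ETower [in RHS]run_frame //.
- by rewrite /Setup !run_Seq; do 3 rewrite run_frame //; rewrite run_Set /= addnn.
- by rewrite /Setup !run_Seq; do 2 rewrite run_frame //; rewrite run_Set /= addnn.
Qed.

(** The last clause serves twice: it forces success by [k = n], and it shows that no round beyond
    the vertex integrity does any work. *)
Definition outer_inv (j : nat) (s : state) : Prop :=
  [/\ input_read s, sound C adj s,
   cells s aDONE 0 = 0 \/ (forall l, score C adj l <= cells s aBV 0) &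
   cells s aDONE 0 = 0 -> forall k, k < j -> ~~ integrity_at_most adj k].

Lemma outer_step i s : outer_inv i s ->
  outer_inv i.+1 (run (upd (fun=> 0) 15 i) (If (V aDONE) Skip (Seq Setup Body)) s).
Proof.
move=> [h1 h2 h3 h4]; rewrite run_If -[eval _ _ _]/(cells s aDONE 0).
case: eqP => hD; last by split=> // h; case: hD.
set rho := upd _ 15 i; rewrite run_Seq; set s1 := run rho Setup s.
have c1 : consts C i (guess_bound i) (word_bound i) adj s1 by exact: (run_Setup rho).
have D1 : cells s1 aDONE 0 = 0 by rewrite /s1 run_frame.
have so1 : sound C adj s1 by rewrite /sound /s1 !run_frame.
have hB l := run_Body adj_sym (double_lt_guess i) (piece_bound_guess i) (code_bound_guess i)
   (word_bound_big i) l rho c1 so1 D1.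
have [c2 so2 _ hint] := hB (fun=> 0).
split=> //.
- by apply: input_read_frame => //; apply: input_read_frame.
- case: (cells (run rho Body s1) aDONE 0 =P 0) => hD2; [by left|right=> l].
  by have [_ _ [/hD2|]] := hB l.
- move=> hD2 k; rewrite ltnS leq_eqVlt => /predU1P[->|]; last exact: h4.
  by apply/negP => /hint; rewrite hD2.
Qed.

Lemma integrity_n : integrity_at_most adj n.
Proof.
apply/existsP; exists [set: 'I_n]; rewrite cardsT card_ord leqnn /=.
by apply/forall_inP => D /imsetP[x]; rewrite setCT inE.
Qed.

Lemma outer_start st : input_read st -> cells st aDONE 0 = 0 -> cells st aBV 0 = 0 -> outer_inv 0 st.
Proof. by move=> h hD hB; split=> //; [rewrite /sound hB|left]. Qed.

(** A tower of height 3 costs about 36 times its value; the two values are [guess_bound] and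
    [word_bound], whence 72. *)
Lemma ccost_Setup rho st : ccost rho Setup st <= 150 + 72 * word_bound (rho 15).
Proof.
have ctower h e m : ecost rho m (ETower h (EAdd e (Num 2))) <=
    ecost rho m e + h * 5 + 2 + h * (12 * tower h (eval rho m e + 2)).
  by have := ecost_ETower rho m h (EAdd e (Num 2)); rewrite /=; lia.
have cSeq c1 c2 s : ccost rho (Seq c1 c2) s = ccost rho c1 s + ccost rho c2 (run rho c1 s) by [].
have cSet a e1 e2 s : ccost rho (Set_ a e1 e2) s = ecost rho (cells s) e1 + 8 + ecost rho (cells s) e2 + 1 by [].
rewrite /Setup !cSeq !cSet.
set s1 := run _ (Set_ aK _ _) _; set s2 := run _ (Set_ aK2 _ _) _; set s3 := run _ (Set_ aBS _ _) _.
set s4 := run _ (Set_ aB _ _) _.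
have hB : cells s4 aB 0 = guess_bound (rho 15) by rewrite /s4 run_Set eqxx eval_ETower.
have := ctower 3 (Loc 15) (cells s3); rewrite -[eval _ _ (Loc 15)]/(rho 15) -/(guess_bound _).
have := ctower 3 (V aB) (cells s4); rewrite -[eval _ _ (V aB)]/(cells s4 aB 0) hB -/(word_bound _).
have : guess_bound (rho 15) <= word_bound (rho 15).
  by apply: leq_trans (ltn_tower 3 _); rewrite leq_addr.
have cNum m x : ecost rho m (Num x) = 1 by [].
have cLoc m x : ecost rho m (Loc x) = 2 by [].
have cAdd m a b : ecost rho m (EAdd a b) = ecost rho m a + ecost rho m b + 1 by [].
have cV m j : ecost rho m (V j) = 10 by [].
rewrite !(cNum, cLoc, cV) ![ecost _ _ (EAdd _ _)]cAdd !(cNum, cLoc, cAdd).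
move: (ecost _ _ (ETower _ _)) (ecost _ _ (ETower _ _)) (guess_bound _) (word_bound _) => a b g w; lia.
Qed.
End Main.

(** * Correctness and running time of the main program *)

Lemma size_bit_size (w : seq nat) : size w <= bit_size w.
Proof. by rewrite -sum1_size; apply: leq_sum. Qed.

(** Here [a], [b] and [c] stand for reading, search and output. The exponents 14 and 8 are [csz] of
    [ReadGraph] and [Output], and [q] will be [csz Body]; 17 is the 16 of [ccost_le] plus 1 for the
    bound [N + 1]. *)
Lemma cost_arith (n w q a b c : nat) (A := w + n + 17) :
  a <= A ^ 14 -> b <= n.+1 * (166 + 72 * w + A ^ q) -> c <= A ^ 8 ->
  44 + a + (b + 12) + (c + 12) <= A ^ (q + 20).
Proof.
move=> ha hb hc; have hA : 17 <= A by rewrite leq_addl.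
have mono i j : i <= j -> A ^ i <= A ^ j by move=> h; rewrite leq_pexp2l // (leq_trans _ hA).
have hP : 0 < A ^ q by rewrite expn_gt0 (leq_trans _ hA).
have le i : i <= 14 -> A ^ i <= A ^ (q + 14) by move=> h; apply: mono; lia.
have h2 : 17 * 17 <= A ^ 2 by rewrite -mulnn leq_mul.
have hb' : b <= A ^ 4 + A ^ q.+1.
  apply: leq_trans hb _; rewrite (expnS A 3) (expnS A q) -mulnDr; apply: leq_mul; first by rewrite /A; lia.
  rewrite leq_add2r (expnS A 2); apply: leq_trans (leq_mul (leqnn A) h2); rewrite /A; lia.
have hq : A ^ q.+1 <= A ^ (q + 14) by apply: mono; lia.
apply: leq_trans (_ : A ^ (q + 14) * 17 <= _).
  have := le 14 isT; have := le 8 isT; have := le 4 isT; have := le 2 isT; lia.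
rewrite [X in _ <= A ^ X](_ : _ = (q + 14) + 6); last by lia.
rewrite [in leqRHS]expnD leq_mul2l; apply/orP; right; exact: leq_trans hA (mono 1 6 isT).
Qed.

Section Correctness.
Variable I : instance.
Let n := nb_vertices I.
Let C := capacity I.
Let e := @adj I.
Let rho0 : nat -> nat := fun=> 0.
Let s1 := run rho0 ReadInput (start (encode I)).
Let body := If (V aDONE) Skip (Seq Setup Body).
Let outer j := iteri j (fun i s => run (upd rho0 15 i) body s) s1.

Lemma run_ReadInput : outer_inv C e 0 s1.
Proof.
apply: outer_start; last 2 first.
- by rewrite /s1 run_frame.
- by rewrite /s1 run_frame.
rewrite /s1 /ReadInput !run_Seq.
set sa := run _ (Set_ aN1 _ _) _.
have hN : cells sa aN 0 = n by [].
split.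
- by rewrite run_frame.
- by rewrite run_frame // /sa run_Set /= addn1.
- by rewrite run_frame.
- by move=> x y; rewrite (run_ReadGraph rho0 hN (erefl : cells sa aPTR 0 = 0) erefl) // nth_adjacency.
Qed.

Lemma eval_N1 : eval rho0 (cells s1) (V aN1) = n.+1.
Proof. by case: run_ReadInput => [[_ + _ _] _ _ _]. Qed.

Lemma outer_ok j : j <= n.+1 -> outer_inv C e j (outer j).
Proof.
apply: iteri_ind; first exact: run_ReadInput.
by move=> i y _; apply: outer_step; exact: adj_sym.
Qed.

Lemma integrity_parameter_ok : integrity_at_most e (integrity_parameter I).
Proof. by rewrite /integrity_parameter /vertex_integrity; case: ex_minnP. Qed.

Lemma outer_end (s := outer n.+1) :
  [/\ cells s aN 0 = n, sound C e s & forall l, score C e l <= cells s aBV 0].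
Proof.
have [[hN _ _ _] hs hD hk] := outer_ok (leqnn _).
split=> //; case: hD => // /hk /(_ n (ltnSn n)); by rewrite integrity_n.
Qed.

Lemma run_Main : coalition_solution I (wout (run rho0 Main (start (encode I)))).
Proof.
have -> : run rho0 Main (start (encode I)) = run rho0 Output (outer n.+1).
  by rewrite /Main !run_Seq -/s1 /outer -eval_N1.
have w0 j : wout (outer j) = [::].
  elim: j => [|j IH]; first by rewrite -[outer 0]/s1 /s1 run_silent.
  by rewrite -[outer j.+1]/(run _ body (outer j)) run_silent.
have {w0} := w0 n.+1.
have := outer_end; cbv zeta.
move: (outer n.+1) => s [hN hs hopt] w0.
rewrite /Output run_If -[eval _ _ (V aBV)]/(cells s aBV 0); case: eqP => hB.
  right; split; last exact: w0.
  by apply: score_infeasible => l; apply/eqP; rewrite -leqn0 -hB.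
have -> : wout (run rho0 (For 1 (V aN) (WriteC (Cell aBEST 1))) s) = [seq cells s aBEST i | i <- iota 0 n].
  have [] // := @run_For_ind (fun i s' => cells s' = cells s /\ wout s' = [seq cells s aBEST i | i <- iota 0 i])
    rho0 1 (V aN) (WriteC (Cell aBEST 1)) s n hN.
  move=> i s' _ [h1 h2]; split; first by rewrite -h1.
  by rewrite -[in iota 0 _]addn1 iotaD map_cat cats1 -h2 -h1.
left; split; first by rewrite size_map size_iota.
have hB' : 0 < cells s aBV 0 by rewrite lt0n; apply/eqP.
apply: (@score_optimal n C e (@adj_sym I) (@adj_irr I) _ (fun v => cells s aBEST v)).
- by move=> v; rewrite (nth_map 0) ?size_iota // nth_iota.
- by rewrite -(hs hB').
- by move=> l; rewrite -(hs hB').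
Qed.

Lemma ccost_outer j (k := integrity_parameter I) (M := word_bound k + n) : j <= n ->
  ccost (upd rho0 15 j) body (outer j) + 5 <= 166 + 72 * word_bound k + (M + 17) ^ csz Body.
Proof.
move=> hj; have [hin _ _ hk] := outer_ok (leqW hj); move: (outer j) hin hk => s hin hk.
have -> : ccost (upd rho0 15 j) body s = 11 +
    (if cells s aDONE 0 == 0 then ccost (upd rho0 15 j) (Seq Setup Body) s else 1) by [].
case: eqP => [/hk {}hk|_]; last by move: (_ ^ _) => x; lia.
(* A round that still does work excludes all smaller parameters, so its own is at most the vertex
   integrity; this makes the bound depend on the parameter rather than on [n]. *)
have jk : j <= k.
  by rewrite leqNgt; apply/negP => /hk; rewrite integrity_parameter_ok.
have wk : word_bound j <= word_bound k.
  by apply: tower_le; rewrite leq_add2r; apply: tower_le; rewrite leq_add2r.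
set rho := upd rho0 15 j.
have -> : ccost rho (Seq Setup Body) s = ccost rho Setup s + ccost rho Body (run rho Setup s) by [].
have := ccost_Setup rho s; rewrite -[rho 15]/j => h1.
have /(ccost_le rho) : forall a, a \in limits -> cells (run rho Setup s) a 0 <= M + 1.
  have [cN cN1 _ cK cB cPH _ cBS _] := run_Setup rho hin; rewrite -[rho 15]/j in cK cB cPH cBS.
  have gw : guess_bound j <= word_bound k.
    by apply: leq_trans wk; apply: leq_trans (ltn_tower 3 _); rewrite leq_addr.
  have h2 : j.*2 + 2 <= M + 1 by have := double_lt_guess j; rewrite /M; lia.
  move: wk h2; rewrite /M /n => wk h2 a; rewrite !inE.
  by move=> /orP[|/orP[|/orP[|/orP[|/orP[]]]]] /eqP ->; rewrite ?cN ?cN1 ?cK ?cB ?cPH ?cBS //; lia.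
move/(_ Body Body_ok); rewrite -addnA; move: (ccost _ Body _) (_ ^ _) => x y; lia.
Qed.

Lemma ccost_Main (k := integrity_parameter I) :
  ccost rho0 Main (start (encode I)) <= (word_bound k + n + 17) ^ (csz Body + 20).
Proof.
have [[hN hN1 _ _] _ _ _] := run_ReadInput.
have -> : ccost rho0 Main (start (encode I)) =
    ccost rho0 ReadInput (start (encode I)) + (ccost rho0 Outer s1 + ccost rho0 Output (run rho0 Outer s1)) by [].
have hr : ccost rho0 ReadInput (start (encode I)) <= 44 + (word_bound k + n + 17) ^ 14.
  rewrite /ReadInput; set sa := run rho0 (Set_ aN1 (Num 0) (EAdd (V aN) (Num 1)))
    (run rho0 (ReadC aC (Num 0)) (run rho0 (ReadC aN (Num 0)) (start (encode I)))).
  rewrite -[ccost _ _ _]/(44 + ccost rho0 ReadGraph sa) leq_add2l.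
  have /(ccost_le rho0) : forall a, a \in [:: aN] -> cells sa a 0 <= word_bound k + n + 1.
    by move=> a; rewrite inE => /eqP ->; rewrite -[cells sa aN 0]/n; lia.
  move/(_ ReadGraph isT); rewrite -addnA; exact.
have ho : ccost rho0 Output (run rho0 Outer s1) <= (word_bound k + n + 17) ^ 8.
  have /(ccost_le rho0) : forall a, a \in [:: aN] -> cells (run rho0 Outer s1) a 0 <= word_bound k + n + 1.
    by move=> a; rewrite inE => /eqP ->; rewrite (@run_frame Outer) // hN; exact: leq_trans (leq_addl _ _) (leq_addr _ _).
  move/(_ Output isT); rewrite -addnA; exact.
have hm : ccost rho0 Outer s1 <= n.+1 * (166 + 72 * word_bound k + (word_bound k + n + 17) ^ csz Body) + 12.
  have -> : ccost rho0 Outer s1 = 11 + (\sum_(i < cells s1 aN1 0) (ccost (upd rho0 15 i) body (outer i) + 5) + 1) by [].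
  rewrite hN1; have := @leq_sum _ (index_enum 'I_n.+1) xpredT _ _ (fun i _ => ccost_outer (leq_ord i)).
  rewrite sum_nat_const card_ord; move: (\sum_(_ < _) _) (_ * _) => x y; lia.
have := @cost_arith n (word_bound k) (csz Body) _ _ _ (leqnn _) (leqnn _) (leqnn _).
apply: leq_trans; move: hr ho hm.
move: (_ ^ 14) (_ ^ 8) (_ * _) (ccost _ _ _) (ccost _ _ _) (ccost _ _ _) => x y z a b c; lia.
Qed.
End Correctness.

Definition time_bound (k : nat) : nat := (word_bound k + 17) ^ (csz Body + 20).

Lemma time_bound_ok (I : instance) :
  (word_bound (integrity_parameter I) + nb_vertices I + 17) ^ (csz Body + 20) <=
  time_bound (integrity_parameter I) * bit_size (encode I) ^ (csz Body + 20).
Proof.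
rewrite /time_bound -expnMn leq_exp2r; last by rewrite addn_gt0 orbT.
(* The adjacency matrix alone gives [n^2] input numbers. Then [w + n + 17 <= (w + 17) (n + 1)]
   separates the parameter from the input size. *)
have : nb_vertices I < bit_size (encode I).
  apply: leq_trans (size_bit_size _); rewrite /= size_allpairs size_enum_ord; nia.
move: (word_bound _) (bit_size _) => w b; nia.
Qed.

(** Witnesses the computability of the time bound; the exponent is a constant of the program, and
    the power is built by repeated multiplication. *)
Definition Bound (S : nat) : cmd :=
  Seq (ReadC aN (Num 0))
  (Seq (Set_ aB (Num 0) (ETower 3 (EAdd (V aN) (Num 2))))
  (Seq (Set_ aPH (Num 0) (ETower 3 (EAdd (V aB) (Num 2))))
  (Seq (Set_ aX (Num 0) (EAdd (V aPH) (Num 17)))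
  (Seq (Set_ aK (Num 0) (Num 1))
  (Seq (For 1 (Num S) (Set_ aK (Num 0) (EMul aX (V aK))))
       (WriteC (V aK))))))).

Lemma run_Bound (S k : nat) :
  wout (run (fun=> 0) (Bound S) (start [:: k])) = [:: (word_bound k + 17) ^ S].
Proof.
rewrite /Bound !run_Seq.
set s1 := run _ (ReadC _ _) _; set s2 := run _ (Set_ aB _ _) s1.
set s3 := run _ (Set_ aPH _ _) s2; set s4 := run _ (Set_ aX _ _) s3; set s5 := run _ (Set_ aK _ _) s4.
set s6 := run _ (For _ _ _) _.
have h2 : cells s2 aB 0 = guess_bound k by rewrite /s2 run_Set eqxx eval_ETower.
have h3 : cells s3 aPH 0 = word_bound k by rewrite /s3 run_Set eqxx eval_ETower /word_bound -h2.
have h4 : cells s4 aX 0 = word_bound k + 17 by rewrite -h3.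
have [h6 _] : cells s6 aK 0 = (word_bound k + 17) ^ S /\ cells s6 aX 0 = word_bound k + 17.
  apply: (@run_For_ind (fun i s => cells s aK 0 = (word_bound k + 17) ^ i /\ cells s aX 0 = word_bound k + 17)) => //.
  move=> i s _ [hK hX]; rewrite run_Set eqxx run_frame //; split=> //.
  rewrite eval_Sum -[eval _ _ (V aX)]/(cells s aX 0) hX.
  under eq_bigr => x _ do rewrite -[eval _ _ _]/(cells s aK 0) hK.
  by rewrite sum_nat_const card_ord -expnS.
rewrite -[wout (run _ (WriteC _) _)]/(rcons (wout s6) (cells s6 aK 0)) h6.
by rewrite /s6 run_silent.
Qed.

Lemma time_bound_computable : computable time_bound.
Proof.
exists (compile (Bound (csz Body + 20))) => k.
exists (ccost (fun=> 0) (Bound (csz Body + 20)) (start [:: k])).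
have := @compile_ok (Bound (csz Body + 20)) [:: k] _ _ _ (leqnn _).
rewrite run_Bound; exact.
Qed.

Theorem theorem1p7 :
  fpt_solvable encode coalition_solution integrity_parameter.
Proof.
exists (compile Main), time_bound, (csz Body + 20); split; first exact: time_bound_computable.
move=> I; exists (wout (run (fun=> 0) Main (start (encode I)))); last exact: run_Main.
apply: (compile_ok Main_wf Main_dep).
exact: leq_trans (ccost_Main I) (time_bound_ok I).
Qed.
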